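(* Let $\Omega\subset\mathbb R^n$ be a strictly convex quasi-homogeneous affine domain. Then $\Omega$ is affinely equivalent to the $n$-dimensional paraboloid $\{(x_1,\dots,x_n)\in\mathbb R^n \mid x_n> x_1^2+\dots+x_{n-1}^2\}$.
   Context: An affine domain is a connected open subset $\Omega\subset\mathbb R^n$. It is quasi-homogeneous if there are a compact set $K\subset\Omega$ and a subgroup $G$ of the group $\mathrm{Aut}_{\mathrm{aff}}(\Omega)$ of affine transformations of $\mathbb R^n$ preserving $\Omega$ with $GK=\Omega$. The affine domain $\Omega$ is strictly convex if it is convex and its boundary in $\mathbb R^n$ contains no nondegenerate line segment.
   Formalization: The domain Ω is assumed nonempty and different from all of R^n (with n ≥ 1); without this the claim fails, since R^n is strictly convex with empty boundary and quasi-homogeneous under translations but is not affinely equivalent to the paraboloid. *)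

(* Defs.v *)
From HB Require Import structures.
From mathcomp Require Import all_boot all_order all_algebra.
From mathcomp Require Import all_classical all_reals all_analysis.
Set Implicit Arguments. Unset Strict Implicit. Unset Printing Implicit Defensive.
Import Order.TTheory GRing.Theory Num.Theory.
Import numFieldNormedType.Exports.
Local Open Scope classical_set_scope.
Local Open Scope ring_scope.

Definition affine_map (R : realType) (n : nat) (A : 'M[R]_n) (b : 'rV[R]_n)
  : 'rV[R]_n -> 'rV[R]_n := fun x => x *m A + b.

Definition is_affine_transf (R : realType) (n : nat) (f : 'rV[R]_n -> 'rV[R]_n) : Prop :=
  exists (A : 'M[R]_n) (b : 'rV[R]_n), A \in unitmx /\ f = affine_map A b.

Definition Aut_aff (R : realType) (n : nat) (Omega : set 'rV[R]_n)
  : set ('rV[R]_n -> 'rV[R]_n) :=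
  [set f | is_affine_transf f /\ f @` Omega = Omega].

Definition is_subgroup_Aut_aff (R : realType) (n : nat) (Omega : set 'rV[R]_n)
  (G : set ('rV[R]_n -> 'rV[R]_n)) : Prop :=
  [/\ G `<=` Aut_aff Omega,
      G id,
      (forall g h, G g -> G h -> G (g \o h))
    & (forall g, G g -> exists2 h, G h & (h \o g = id /\ g \o h = id))].

Definition affine_domain (R : realType) (n : nat) (Omega : set 'rV[R]_n) : Prop :=
  open Omega /\ connected Omega.

Definition quasi_homogeneous (R : realType) (n : nat) (Omega : set 'rV[R]_n) : Prop :=
  exists (K : set 'rV[R]_n) (G : set ('rV[R]_n -> 'rV[R]_n)),
    [/\ compact K, K `<=` Omega, is_subgroup_Aut_aff Omega G
      & [set g x | g in G & x in K] = Omega].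

Definition convex_dom (R : realType) (n : nat) (Omega : set 'rV[R]_n) : Prop :=
  forall x y t, Omega x -> Omega y -> 0 <= t <= 1 -> Omega ((1 - t) *: x + t *: y).

Definition boundary (R : realType) (n : nat) (Omega : set 'rV[R]_n) : set 'rV[R]_n :=
  closure Omega `\` interior Omega.

Definition strictly_convex (R : realType) (n : nat) (Omega : set 'rV[R]_n) : Prop :=
  convex_dom Omega /\
  ~ (exists x y : 'rV[R]_n, x != y /\
       forall t : R, 0 <= t <= 1 -> boundary Omega ((1 - t) *: x + t *: y)).

Definition paraboloid (R : realType) (n : nat) : set 'rV[R]_n.+1 :=
  [set x | \sum_(i < n) (x ord0 (widen_ord (leqnSn n) i)) ^+ 2 < x ord0 ord_max].
Arguments paraboloid : clear implicits.

(* Main.v *)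
Require Import Defs.
From HB Require Import structures.
From mathcomp Require Import all_boot all_order all_algebra.
From mathcomp Require Import all_classical all_reals all_analysis.
From mathcomp Require Import ring lra.
Set Implicit Arguments. Unset Strict Implicit. Unset Printing Implicit Defensive.
Import Order.TTheory GRing.Theory Num.Theory.
Import numFieldNormedType.Exports.
Local Open Scope classical_set_scope.
Local Open Scope ring_scope.

(**
  Strict convexity and cocompactness produce, near every boundary point,
  contracting affine automorphisms fixing a nearby boundary point: an
  automorphism carrying the compact set [K] close to the boundary maps a ball to
  a small ellipsoid, since otherwise a boundary segment would appear in the
  limit. Hence the domain is unbounded, and pulling back points going to infinity
  shows in the same way that its recession cone is a single ray. Composing high
  powers of a contraction with inverse powers of another one and passing to the
  limit, the automorphism group is transitive on the boundary.

  The domain is thus the epigraph of a strictly convex function [f] on [R^n] with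
  a transitive group of symmetries [f (x A + b) = l * f x + affine] and a
  contraction fixing the origin. A paraboloid touching the graph from above at
  one point, and another one touching from below, give by transitivity
  [c |x|^2 <= D y x <= C |x|^2] for the divergence
  [D y x = f (y + x) - f y - f'(y) x], so that the linear parts [A / sqrt l] form
  a bounded group. Among the quadratic forms [Q] with [Q x <= D y x] for all [y]
  there is an invariant maximal one. The zero set of [D y - Q] is then a linear
  subspace independent of [y]; were it proper, [Q] could be enlarged
  transversally to it. So [D 0 = Q], and [f] is quadratic.

  Limits are taken along one fixed nonprincipal ultrafilter on [nat], so that
  bounded sequences converge without passing to subsequences.
*)

(** * Limits along an ultrafilter *)

(** Every limit of automorphisms rests on one fact: the closure of the domain contains no line, so
    automorphisms that keep the centre of a fixed ball of the domain in a bounded region have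
    bounded linear parts. Such a limit degenerates only when a point of the domain is carried to the
    boundary. This is why maps between boundary points are controlled at points shifted inwards by
    the recession direction, and why their scale factor along that direction has to stay away from
    zero.

    No smoothness of the boundary is given. Transitivity replaces it: what is found at one extremal
    point of an optimisation problem over a ball holds at every point, so a gradient exists
    everywhere and is unique.

    An invariant form below the divergence need not equal it, and maximality has to be obtained
    together with invariance. Both come from one closest-point problem: the target [(C + 1)%:M]
    exceeds all admissible forms, and the distance is measured uniformly over the orbit. The
    contraction is used once more for the zero set: its normalised powers show that the zeros form a
    cone, and translation of the base point turns this cone into a subspace. *)

Lemma ultrafilter_nat_ex : exists F : set_system nat, UltraFilter F /\ \oo `<=` F.
Proof. by have [G [GU sFG]] := @ultraFilterLemma nat \oo _; exists G. Qed.

Definition omega : set_system nat := projT1 (cid ultrafilter_nat_ex).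

#[global] Instance omega_ultra : UltraFilter omega.
Proof. by rewrite /omega; case: cid => F []. Qed.

#[global] Instance omega_proper : ProperFilter omega.
Proof. exact: ultra_proper. Qed.

Lemma omega_oo : \oo `<=` omega.
Proof. by rewrite /omega; case: cid => F []. Qed.

Lemma omega_ge (P : nat -> Prop) N :
  (forall k, (N <= k)%N -> P k) -> \forall k \near omega, P k.
Proof. by move=> NP; apply: omega_oo; exists N. Qed.

Lemma omega_and (P Q : nat -> Prop) :
  (\forall k \near omega, P k) -> (\forall k \near omega, Q k) ->
  \forall k \near omega, P k /\ Q k.
Proof. exact: filterI. Qed.

Lemma omega_ex (P : nat -> Prop) : (\forall k \near omega, P k) -> exists k, P k.
Proof. exact: filter_ex. Qed.

Lemma cvg_omega (T : topologicalType) (u : nat -> T) (l : T) :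
  u @ \oo --> l -> u @ omega --> l.
Proof. by move=> ul A /ul; exact: omega_oo. Qed.

Lemma ultra_fmap (S T : Type) (f : S -> T) (F : set_system S) :
  UltraFilter F -> UltraFilter (f @ F).
Proof.
move=> FU; split; first exact: fmap_proper_filter.
move=> G GP FG; apply/seteqP; split => // A GA.
have [//|/= FAC] := in_ultra_setVsetC (f @^-1` A) FU.
have /FG GAC : (f @ F) (~` A) by [].
have : G (A `&` ~` A) by exact: filterI.
by rewrite setICr; move=> G0; case: (@filter_not_empty _ G GP G0).
Qed.

Section Limits.
Variable R : realType.

Lemma mx_norm_coord m n (A : 'M[R]_(m, n)) i j : `|A i j| <= `|A|.
Proof.
rewrite -[leRHS]/(mx_norm A) mx_normrE.
by apply/bigmax_geP; right; exists (i, j).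
Qed.

Lemma mx_norm_leP m n (A : 'M[R]_(m, n)) (M : R) : 0 <= M ->
  (forall i j, `|A i j| <= M) -> `|A| <= M.
Proof.
move=> M0 AM; rewrite -[leLHS]/(mx_norm A) mx_normrE.
by apply/bigmax_leP; split => // -[i j] _; exact: AM.
Qed.

Lemma mx_norm_mul m n p (A : 'M[R]_(m, n)) (B : 'M[R]_(n, p)) :
  `|A *m B| <= n%:R * `|A| * `|B|.
Proof.
apply: mx_norm_leP => [|i j]; first by rewrite !mulr_ge0.
rewrite mxE (le_trans (ler_norm_sum _ _ _))//.
rewrite -mulrA mulr_natl -[X in _ *+ X]card_ord -sumr_const.
by apply: ler_sum => k _; rewrite normrM ler_pM// mx_norm_coord.
Qed.

Lemma real_cvg_omega (u : nat -> R) M :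
  (\forall k \near omega, `|u k| <= M) -> exists l : R, u @ omega --> l.
Proof.
move=> uM; have := @segment_compact R (- M) M; rewrite compact_ultra.
move=> /(_ (u @ omega) (ultra_fmap u omega_ultra)) [|l [_ ?]]; last by exists l.
by apply: filterS uM => k; rewrite /= in_itv /= -ler_norml.
Qed.

Lemma mx_cvg (T : Type) (F : set_system T) {FF : Filter F} m n
    (u : T -> 'M[R]_(m, n)) (l : 'M[R]_(m, n)) :
  (forall i j, (fun k => u k i j) @ F --> l i j) -> u @ F --> l.
Proof.
move=> ul; apply/cvgrPdist_le => e e0.
have H : \forall k \near F, forall ij, `|l ij.1 ij.2 - u k ij.1 ij.2| <= e.
  apply: (filter_forall (f := fun ij k => `|l ij.1 ij.2 - u k ij.1 ij.2| <= e)).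
  by case=> i j; have /cvgrPdist_le /(_ _ e0) := ul i j.
apply: filterS H => k H; apply: mx_norm_leP => [|i j]; first exact: ltW.
by rewrite !mxE; exact: (H (i, j)).
Qed.

Lemma cvg_coord (T : Type) (F : set_system T) {FF : Filter F} m n
    (u : T -> 'M[R]_(m, n)) (l : 'M[R]_(m, n)) i j :
  u @ F --> l -> (fun k => u k i j) @ F --> l i j.
Proof. by move=> ul; exact: (continuous_cvg _ (@coord_continuous _ _ _ i j l) ul). Qed.

Lemma mx_cvg_omega m n (u : nat -> 'M[R]_(m, n)) M :
  (\forall k \near omega, `|u k| <= M) -> exists l : 'M[R]_(m, n), u @ omega --> l.
Proof.
move=> uM.
have H i j : exists l : R, (fun k => u k i j) @ omega --> l.
  apply: (@real_cvg_omega _ M); apply: filterS uM => k.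
  exact: le_trans (mx_norm_coord _ _ _).
pose l := \matrix_(i, j) (projT1 (cid (H i j))).
exists l; apply: mx_cvg => i j; rewrite mxE.
exact: (projT2 (cid (H i j))).
Qed.

Lemma cvg_sumr (T : Type) (F : set_system T) {FF : Filter F} (I : Type)
    (r : seq I) (f : I -> T -> R) (a : I -> R) :
  (forall i, f i @ F --> a i) ->
  (fun k => \sum_(i <- r) f i k) @ F --> \sum_(i <- r) a i.
Proof.
move=> fa; elim: r => [|i r IH].
  by rewrite big_nil (_ : (fun k => _) = fun=> 0);
    [exact: cvg_cst|apply/funext => k; rewrite big_nil].
rewrite big_cons (_ : (fun k => _) = f i + (fun k => \sum_(j <- r) f j k)).
  exact: cvgD.
by apply/funext => k; rewrite big_cons.
Qed.

Lemma cvg_mulmx (T : Type) (F : set_system T) {FF : Filter F} m n p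
    (u : T -> 'M[R]_(m, n)) (v : T -> 'M[R]_(n, p)) (a : 'M[R]_(m, n)) (b : 'M[R]_(n, p)) :
  u @ F --> a -> v @ F --> b -> (fun k => u k *m v k) @ F --> a *m b.
Proof.
move=> ua vb; apply: mx_cvg => i j; rewrite mxE.
rewrite (_ : (fun k => _) = fun k => \sum_l u k i l * v k l j); last first.
  by apply/funext => k; rewrite mxE.
apply: (@cvg_sumr _ _ _ _ _ (fun l k => u k i l * v k l j) (fun l => a i l * b l j)) => l.
by apply: cvgM; exact: cvg_coord.
Qed.

Lemma cvg_trmx (T : Type) (F : set_system T) {FF : Filter F} m n
    (u : T -> 'M[R]_(m, n)) (a : 'M[R]_(m, n)) :
  u @ F --> a -> (fun k => (u k)^T) @ F --> a^T.
Proof.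
move=> ua; apply: mx_cvg => i j; rewrite mxE.
rewrite (_ : (fun k => _) = fun k => u k j i); last by apply/funext => k; rewrite mxE.
exact: cvg_coord.
Qed.

Lemma cvg_addm (T : Type) (F : set_system T) {FF : Filter F} m n
    (u v : T -> 'M[R]_(m, n)) (a b : 'M[R]_(m, n)) :
  u @ F --> a -> v @ F --> b -> (fun k => u k + v k) @ F --> a + b.
Proof. exact: cvgD. Qed.

Lemma cvg_subm (T : Type) (F : set_system T) {FF : Filter F} m n
    (u v : T -> 'M[R]_(m, n)) (a b : 'M[R]_(m, n)) :
  u @ F --> a -> v @ F --> b -> (fun k => u k - v k) @ F --> a - b.
Proof. exact: cvgB. Qed.

Lemma cvg_scalem (T : Type) (F : set_system T) {FF : Filter F} m n
    (s : T -> R) (u : T -> 'M[R]_(m, n)) (c : R) (a : 'M[R]_(m, n)) :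
  s @ F --> c -> u @ F --> a -> (fun k => s k *: u k) @ F --> c *: a.
Proof. exact: cvgZ. Qed.

Lemma cvg_scalec (T : Type) (F : set_system T) {FF : Filter F} m n
    (c : R) (u : T -> 'M[R]_(m, n)) (a : 'M[R]_(m, n)) :
  u @ F --> a -> (fun k => c *: u k) @ F --> c *: a.
Proof. by move=> ua; apply: cvg_scalem ua; exact: cvg_cst. Qed.

Lemma cvg_cstm (T : Type) (F : set_system T) {FF : Filter F} m n (a : 'M[R]_(m, n)) :
  (fun _ : T => a) @ F --> a.
Proof. exact: cvg_cst. Qed.

Lemma cvg_cstr (T : Type) (F : set_system T) {FF : Filter F} (a : R) :
  (fun _ : T => a) @ F --> a.
Proof. exact: cvg_cst. Qed.

Lemma cvg_add0 m n (u : nat -> 'M[R]_(m, n)) (p : 'M[R]_(m, n)) :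
  u @ omega --> (0 : 'M[R]_(m, n)) -> (fun k => p + u k) @ omega --> p.
Proof.
move=> u0; have := cvg_addm (@cvg_cstm _ omega _ _ _ p) u0.
by rewrite addr0; exact.
Qed.

Lemma omega_lim_le (u v : nat -> R) (a b : R) :
  u @ omega --> a -> v @ omega --> b -> (forall k, u k <= v k) -> a <= b.
Proof.
move=> ua vb uv; apply: (ler_cvg_to ua vb).
by apply: (@omega_ge _ 0) => k _.
Qed.

Lemma omega_open m n (u : nat -> 'M[R]_(m, n)) (l : 'M[R]_(m, n)) (O : set 'M[R]_(m, n)) :
  open O -> O l -> u @ omega --> l -> \forall k \near omega, O (u k).
Proof. by move=> oO Ol; apply; apply: open_nbhs_nbhs. Qed.

Lemma omega_closure m n (u : nat -> 'M[R]_(m, n)) (l : 'M[R]_(m, n)) (O : set 'M[R]_(m, n)) :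
  u @ omega --> l -> (\forall k \near omega, closure O (u k)) -> closure O l.
Proof. by move=> ul Ou; exact: (closed_cvg _ (@closed_closure _ O) Ou l ul). Qed.

Lemma cvg_mx_unique m n (u : nat -> 'M[R]_(m, n)) (a b : 'M[R]_(m, n)) :
  u @ omega --> a -> u @ omega --> b -> a = b.
Proof. by move=> ua ub; apply: (cvg_unique _ ua ub); exact: norm_hausdorff. Qed.

Lemma cvg_real_unique (u : nat -> R) (a b : R) :
  u @ omega --> a -> u @ omega --> b -> a = b.
Proof. by move=> ua ub; apply: (cvg_unique _ ua ub); exact: norm_hausdorff. Qed.

Lemma closure_seq m n (O : set 'M[R]_(m, n)) x : closure O x ->
  forall e, 0 < e -> exists2 y, O y & `|x - y| < e.
Proof.
move=> clx e e0; have [y [Oy]] := clx _ (nbhsx_ballx x e e0).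
by rewrite mx_norm_ball /ball_ /=; exists y.
Qed.

Lemma invn_cvg0 : (fun k : nat => k.+1%:R^-1 : R) @ omega --> (0 : R).
Proof. by apply: cvg_omega; exact: cvg_harmonic. Qed.

Lemma invn_cvg1 : (fun k : nat => 1 - k.+1%:R^-1 : R) @ omega --> (1 : R).
Proof.
have := @cvgB R R nat omega _ (fun=> 1 : R) (fun k : nat => k.+1%:R^-1 : R) 1 0
  (cvg_cst _) invn_cvg0.
by rewrite subr0; exact.
Qed.

Lemma mx_cvg0 m n (u : nat -> 'M[R]_(m, n)) (v : nat -> R) :
  (forall k, `|u k| <= v k) -> v @ omega --> (0 : R) -> u @ omega --> (0 : 'M[R]_(m, n)).
Proof.
move=> uv v0; apply/cvgrPdist_le => e e0.
have /cvgrPdist_le /(_ _ e0) := v0; apply: filterS => k.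
rewrite !sub0r !normrN; apply: le_trans; apply: le_trans (uv k) _.
exact: ler_norm.
Qed.

Lemma cvg_invn m n (u : nat -> 'M[R]_(m, n)) (l : 'M[R]_(m, n)) :
  (forall k, `|l - u k| <= k.+1%:R^-1) -> u @ omega --> l.
Proof.
move=> lu; rewrite -[l in _ --> l]subr0.
rewrite (_ : u = (fun=> l) - (fun k => l - u k)); last first.
  by apply/funext => k; rewrite fctE opprB addrC subrK.
apply: cvgB; first exact: cvg_cst.
exact: (mx_cvg0 lu invn_cvg0).
Qed.

End Limits.

(** * Strictly convex domains and their automorphisms *)

(** The norm is the largest absolute value of an entry, and evaluating at [r] times a basis vector
    reads off a row. *)
Lemma mx_norm_rows (R : realType) m n (A : 'M[R]_(m, n)) (r M : R) : 0 < r -> 0 <= M ->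
  (forall v : 'rV_m, `|v| <= r -> `|v *m A| <= M) -> `|A| <= M / r.
Proof.
move=> r0 M0 H; apply: mx_norm_leP => [|i j]; first by rewrite divr_ge0// ltW.
have := H (r *: delta_mx 0 i); rewrite mx_normZ gtr0_norm//.
rewrite -scalemxAl -rowE mx_normZ gtr0_norm// => /(_ _) Hi.
rewrite ler_pdivlMr// mulrC; apply: le_trans (Hi _).
  rewrite ler_pM2l//; apply: le_trans (mx_norm_coord (row i A) 0 j).
  by rewrite mxE.
rewrite -[leRHS]mulr1 ler_pM2l//; apply: mx_norm_leP => // k l; rewrite mxE.
by case: (_ && _); rewrite ?normr1 ?normr0 ?ler01.
Qed.

Lemma sub_linear_comb (R : realType) n (x y : 'rV[R]_n) t :
  (1 - t) *: x + t *: y = x + t *: (y - x).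
Proof. by apply/rowP => i; rewrite !mxE; ring. Qed.

Section ConvexDomain.
Variables (R : realType) (d : nat) (Om : set 'rV[R]_d).
Hypothesis oOm : open Om.
Hypothesis cOm : convex_dom Om.

Lemma open_ball (x : 'rV[R]_d) : Om x -> exists2 r : R, 0 < r & forall v : 'rV[R]_d, `|v| <= r -> Om (x + v).
Proof.
move=> Omx; have /nbhs_ballP[e e0 He] : nbhs x Om by exact: open_nbhs_nbhs.
exists (e / 2); first by rewrite divr_gt0.
move=> v vr; apply: He; rewrite mx_norm_ball /ball_ /=.
by rewrite opprD addrA subrr sub0r normrN (le_lt_trans vr)// gtr_pMr// invf_lt1// ltr1n.
Qed.

Lemma closure_convex (x y : 'rV[R]_d) (t : R) : closure Om x -> closure Om y -> 0 <= t <= 1 ->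
  closure Om ((1 - t) *: x + t *: y).
Proof.
move=> clx cly t01.
have /choice [u Hu] : forall k, exists w, Om w.1 /\ Om w.2 /\
    `|x - w.1| <= k.+1%:R^-1 :> R /\ `|y - w.2| <= k.+1%:R^-1 :> R.
  move=> k; have k0 : 0 < k.+1%:R^-1 :> R by rewrite invr_gt0.
  have [x' ? /ltW ?] := closure_seq clx k0; have [y' ? /ltW ?] := closure_seq cly k0.
  by exists (x', y').
have ux : (fun k => (u k).1) @ omega --> x.
  by apply: cvg_invn => k; have [_ [_ []]] := Hu k.
have uy : (fun k => (u k).2) @ omega --> y.
  by apply: cvg_invn => k; have [_ [_ []]] := Hu k.
apply: (@omega_closure _ _ _ (fun k => (1 - t) *: (u k).1 + t *: (u k).2)).
  by apply: cvg_addm; exact: cvg_scalec.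
apply: (@omega_ge _ 0) => k _; apply: subset_closure.
by have [? [? _]] := Hu k; apply: cOm.
Qed.

(** Replace [z] by a nearby [z'] in [Om]; the error, rescaled by [t / (1 - t)], is absorbed by
    moving [x] inside its ball. *)
Lemma segment_interior (x z : 'rV[R]_d) (t : R) : Om x -> closure Om z -> 0 <= t < 1 ->
  Om ((1 - t) *: x + t *: z).
Proof.
move=> Omx clz /andP[t0 t1].
have [r r0 Hr] := open_ball Omx.
have t1' : 0 < 1 - t by rewrite subr_gt0.
have e0 : 0 < r * (1 - t) by rewrite mulr_gt0.
have [z' Omz' zz'] := closure_seq clz e0.
have Omx' : Om (x + (t / (1 - t)) *: (z - z')).
  apply: Hr; rewrite mx_normZ ger0_norm ?divr_ge0// 1?ltW//.
  rewrite mulrAC ltr_pdivrMr// (le_lt_trans _ zz')//.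
  by rewrite -[leRHS]mul1r ler_wpM2r// ltW.
have := cOm Omx' Omz'  (t := t); rewrite t0 (ltW t1) => /(_ isT).
congr Om; apply/rowP => i; rewrite !mxE; field.
by rewrite gt_eqF.
Qed.

Lemma boundary_on_segment (x z : 'rV[R]_d) : Om x -> ~ Om z ->
  exists t : R, [/\ 0 < t, t <= 1, closure Om (x + t *: (z - x)) & ~ Om (x + t *: (z - x))].
Proof.
move=> Omx nz.
pose E := [set t : R | 0 <= t <= 1 /\ Om (x + t *: (z - x))].
have E0 : E 0 by split; rewrite ?lexx ?ler01// scale0r addr0.
have Eub : ubound E 1 by move=> t [/andP[]].
have supE : has_sup E by split; [exists 0|exists 1].
set s := sup E.
have s0 : 0 <= s by apply: ub_le_sup => //; exists 1.
have s1 : s <= 1 by apply: ge_sup => //; exists 0.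
have Elt t : 0 <= t -> t < s -> Om (x + t *: (z - x)).
  move=> t0 ts; have [t' [/andP[t'0 t'1] Ot']] := sup_adherent (eps := s - t) ltac:(by rewrite subr_gt0) supE.
  rewrite subKr => tt'.
  have t'p : 0 < t' by exact: le_lt_trans tt'.
  have := cOm Omx Ot' (t := t / t').
  rewrite divr_ge0// ler_pdivrMr// mul1r (ltW tt') => /(_ isT).
  by congr Om; apply/rowP => i; rewrite !mxE; field; rewrite gt_eqF.
have nOs : ~ Om (x + s *: (z - x)).
  move=> Os; have [r r0 Hr] := open_ball Os.
  have s1' : s < 1.
    rewrite lt_neqAle s1 andbT; apply/eqP => s1'; apply: nz.
    by move: Os; rewrite s1' scale1r addrC subrK.
  (* Small enough to keep [s + e] at most 1 and to move the point by at most [r]. *)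
  pose e := Num.min (1 - s) (r / (1 + `|z - x|)).
  have nz0 : 0 < 1 + `|z - x| by rewrite ltr_wpDr.
  have e0 : 0 < e by rewrite lt_min subr_gt0 s1' divr_gt0.
  have : E (s + e).
    have e1 : e <= 1 - s by rewrite ge_min lexx.
    split; first by apply/andP; split; lra.
    have -> : x + (s + e) *: (z - x) = x + s *: (z - x) + e *: (z - x).
      by rewrite scalerDl addrA.
    apply: Hr; rewrite mx_normZ gtr0_norm//.
    apply: (@le_trans _ _ (r / (1 + `|z - x|) * `|z - x|)).
      by rewrite ler_wpM2r// ge_min lexx orbT.
    by rewrite mulrAC ler_pdivrMr// ler_pM2l// lerDr.
  move=> /(ub_le_sup (ex_intro _ 1 Eub)); rewrite -/s; lra.
have sp : 0 < s.
  rewrite lt_neqAle s0 andbT; apply/eqP => s0'; apply: nOs.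
  by rewrite -s0' scale0r addr0.
exists s; split => //.
apply: (@omega_closure _ _ _ (fun k => x + (s - s * k.+1%:R^-1) *: (z - x))).
  apply: cvg_addm; first exact: cvg_cst.
  apply: cvg_scalem; last exact: cvg_cst.
  rewrite -[s in _ --> s]subr0 -(mulr0 s).
  apply: cvgB; first exact: cvg_cst.
  by apply: cvgM; [exact: cvg_cst|exact: invn_cvg0].
apply: (@omega_ge _ 0) => k _; apply: subset_closure; apply: Elt.
  by rewrite subr_ge0 -[leRHS]mulr1 ler_pM2l// invf_le1// ler1n.
by rewrite ltrBlDr ltrDl mulr_gt0// invr_gt0.
Qed.

End ConvexDomain.

(** Recorded by its coefficients, so that limits of automorphisms are limits of matrices; the
    equivalence says that the image of [Om] is exactly [Om]. *)
Definition aut (R : realType) d (Om : set 'rV[R]_d) (A : 'M[R]_d) (b : 'rV[R]_d) :=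
  A \in unitmx /\ forall x, Om x <-> Om (x *m A + b).

Section StrictlyConvex.
Variables (R : realType) (d : nat) (Om : set 'rV[R]_d).
Hypothesis oOm : open Om.
Hypothesis scOm : strictly_convex Om.
Hypothesis Om0 : Om !=set0.
Hypothesis OmT : Om <> setT.

Let cOm : convex_dom Om := scOm.1.

Lemma notOm_ex : exists z, ~ Om z.
Proof. by apply/existsNP => H; apply: OmT; apply/seteqP; split. Qed.

(** If one inner point of the segment were missing from [Om], so would all the others: a point of
    [Om] on the segment, joined to the endpoint beyond the missing one, would cover it. The whole
    segment would then lie in the boundary. *)
Lemma segment_strict (p q : 'rV[R]_d) (t : R) : closure Om p -> closure Om q -> p != q ->
  0 < t < 1 -> Om ((1 - t) *: p + t *: q).
Proof.
move=> clp clq pq /andP[t0 t1]; apply: contrapT => nm.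
have [_ []] := scOm.
have clpq s : 0 <= s <= 1 -> closure Om ((1 - s) *: p + s *: q) by move=> ?; exact: closure_convex.
exists p, q; split => // s s01; split; first exact: clpq.
move/interior_id: (oOm) => ->  Oms; apply: nm.
have /andP[s0 s1] := s01.
have [ts|st|ts] := ltgtP t s; last by rewrite ts.
  have := @segment_interior _ _ _ oOm cOm _ _ ((s - t) / s) Oms clp.
  have s0' : 0 < s by exact: lt_trans ts.
  have -> : 0 <= (s - t) / s < 1.
    by rewrite ltr_pdivrMr// mul1r gtrBl t0 divr_ge0// subr_ge0 ltW.
  move=> /(_ isT).
  by congr Om; apply/rowP => i; rewrite !mxE; field; rewrite gt_eqF.
have := @segment_interior _ _ _ oOm cOm _ _ ((t - s) / (1 - s)) Oms clq.
have s0' : 0 < 1 - s by rewrite subr_gt0 (lt_trans st).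
have -> : 0 <= (t - s) / (1 - s) < 1.
  by rewrite ltr_pdivrMr// mul1r ltrD2r t1 divr_ge0 ?subr_ge0 ?(ltW st).
move=> /(_ isT).
by congr Om; apply/rowP => i; rewrite !mxE; field; rewrite gt_eqF.
Qed.

Lemma symmetric_strict (p w : 'rV[R]_d) : closure Om (p + w) -> closure Om (p - w) -> w != 0 -> Om p.
Proof.
move=> c1 c2 w0; have := segment_strict c1 c2 _ (t := 2^-1).
have -> : (1 - 2^-1) *: (p + w) + 2^-1 *: (p - w) = p.
  by apply/rowP => i; rewrite !mxE; field.
apply; last by apply/andP; split; lra.
apply: contra w0 => /eqP/(congr1 (fun v => 2^-1 *: (v - p + w))).
have -> : 2^-1 *: (p + w - p + w) = w by apply/rowP => i; rewrite !mxE; field.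
have -> : 2^-1 *: (p - w - p + w) = 0 by apply/rowP => i; rewrite !mxE; ring.
by move=> ->.
Qed.

Lemma boundary_ex : exists2 p, closure Om p & ~ Om p.
Proof.
have [x Omx] := Om0; have [z nz] := notOm_ex.
by have [t [_ _ ? ?]] := boundary_on_segment oOm cOm Omx nz; exists (x + t *: (z - x)).
Qed.

(** [y + s v] is the limit of points on segments from [y] to ever more distant points of the line,
    the latter taken with weight [1 / (k + 1)]. *)
Lemma closure_shift_line (x v : 'rV[R]_d) : (forall s : R, closure Om (x + s *: v)) ->
  forall (y : 'rV[R]_d) (s : R), closure Om y -> closure Om (y + s *: v).
Proof.
move=> H y s cy.
apply: (@omega_closure _ _ _ (fun k => (1 - k.+1%:R^-1) *: y + k.+1%:R^-1 *: (x + (s * k.+1%:R) *: v))).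
  rewrite (_ : (fun k => _) = fun k => (1 - k.+1%:R^-1) *: y + (k.+1%:R^-1 *: x + s *: v)); last first.
    apply/funext => k; congr (_ + _); rewrite scalerDr scalerA; congr (_ + _ *: _).
    by rewrite mulrCA mulVf// mulr1.
  have -> : y + s *: v = 1 *: y + (0 *: x + s *: v) by rewrite scale1r scale0r add0r.
  apply: cvg_addm.
    by apply: cvg_scalem; [exact: invn_cvg1|exact: cvg_cstm].
  apply: cvg_addm; last exact: cvg_cstm.
  by apply: cvg_scalem; [exact: invn_cvg0|exact: cvg_cstm].
apply: (@omega_ge _ 0) => k _; apply: closure_convex => //.
by rewrite invr_ge0 ler0n invf_le1// ler1n.
Qed.

(** The line could be moved to a boundary point, which would then be the midpoint of two points of
    the closure. *)
Lemma no_line (x v : 'rV[R]_d) : (forall s : R, closure Om (x + s *: v)) -> v = 0.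
Proof.
move=> H; apply/eqP; apply: contrapT => /negP v0.
have [p cp np] := boundary_ex; apply: np.
have := closure_shift_line H (y := p).
move=> H'; apply: (symmetric_strict (w := v)) => //.
  by have := H' 1 cp; rewrite scale1r.
by have := H' (-1) cp; rewrite scaleN1r.
Qed.

(** Otherwise the closure contains longer and longer segments with centres in a bounded region, and
    in the limit a whole line. *)
Lemma symmetric_bounded (M0 : R) : exists2 M : R, 0 <= M & forall y v : 'rV[R]_d, `|y| <= M0 ->
  closure Om (y + v) -> closure Om (y - v) -> `|v| <= M.
Proof.
apply: contrapT => H.
have /choice [w Hw] : forall k : nat, exists w : 'rV[R]_d * 'rV[R]_d,
    [/\ `|w.1| <= M0, closure Om (w.1 + w.2), closure Om (w.1 - w.2) & k.+1%:R < `|w.2|].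
  move=> k; apply: contrapT => Hk; apply: H; exists k.+1%:R => // y v yM c1 c2.
  by rewrite leNgt; apply/negP => lt; apply: Hk; exists (y, v).
pose u k := `|(w k).2|^-1 *: (w k).2.
have wp k : 0 < `|(w k).2| by have [_ _ _] := Hw k; apply: lt_trans.
have nu k : `|u k| = 1.
  by rewrite mx_normZ ger0_norm ?invr_ge0// mulVf// gt_eqF.
have [l ul] : exists l : 'rV[R]_d, u @ omega --> l.
  by apply: (@mx_cvg_omega _ _ _ _ 1); apply: (@omega_ge _ 0) => k _; rewrite nu.
have [y wy] : exists y : 'rV[R]_d, (fun k => (w k).1) @ omega --> y.
  by apply: (@mx_cvg_omega _ _ _ _ M0); apply: (@omega_ge _ 0) => k _; have [] := Hw k.
have nl : `|l| = 1.
  apply: (@cvg_real_unique _ (fun k => `|u k|)); first exact: cvg_norm.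
  by rewrite (_ : (fun k => _) = fun=> 1); [exact: cvg_cst|apply/funext => k].
have /no_line l0 : forall s : R, closure Om (y + s *: l).
  move=> s; apply: (@omega_closure _ _ _ (fun k => (w k).1 + s *: u k)).
    by apply: cvg_addm => //; exact: cvg_scalec.
  apply: (@omega_ge _ (Num.bound `|s|)) => k sk.
  have [_ c1 c2 lt] := Hw k.
  have sw : `|s| <= `|(w k).2|.
    apply: ltW; apply: lt_trans lt; apply: lt_le_trans (archi_boundP _) _ => //.
    by rewrite ler_nat (leq_trans _ (leqnSn _)).
  have := closure_convex cOm c2 c1 (t := (1 + s / `|(w k).2|) / 2).
  have -> : (1 - (1 + s / `|(w k).2|) / 2) *: ((w k).1 - (w k).2) +
    ((1 + s / `|(w k).2|) / 2) *: ((w k).1 + (w k).2) = (w k).1 + s *: u k.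
    by apply/rowP => i; rewrite !mxE; field; rewrite gt_eqF.
  have /andP[? ?] : -1 <= s / `|(w k).2| <= 1.
    by rewrite -ler_norml normrM normfV normr_id ler_pdivrMr// mul1r.
  by apply; apply/andP; split; lra.
by move: nl; rewrite l0 normr0 => /eqP; rewrite eq_sym oner_eq0.
Qed.

End StrictlyConvex.

Section Automorphisms.
Variables (R : realType) (d : nat) (Om : set 'rV[R]_d).
Hypothesis oOm : open Om.
Hypothesis scOm : strictly_convex Om.
Hypothesis Om0 : Om !=set0.
Hypothesis OmT : Om <> setT.

Let cOm : convex_dom Om := scOm.1.

Lemma aut_inv A b : aut Om A b -> aut Om (invmx A) (- b *m invmx A).
Proof.
move=> [uA H]; split; first by rewrite unitmx_inv.
move=> x; rewrite -mulmxDl (H ((x - b) *m invmx A)) mulmxKV// subrK.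
by [].
Qed.

Lemma aut_comp A b A' b' : aut Om A b -> aut Om A' b' ->
  aut Om (A *m A') (b *m A' + b').
Proof.
move=> [uA H] [uA' H']; split; first by rewrite unitmx_mul uA.
by move=> x; rewrite (H x) (H' (x *m A + b)) mulmxDl mulmxA addrA.
Qed.

Lemma aut_closure A b x : aut Om A b -> closure Om x -> closure Om (x *m A + b).
Proof.
move=> [_ H] cx.
have /choice [u Hu] : forall k, exists w, Om w /\ `|x - w| <= k.+1%:R^-1 :> R.
  move=> k; have k0 : 0 < k.+1%:R^-1 :> R by rewrite invr_gt0.
  by have [w ? /ltW ?] := closure_seq cx k0; exists w.
apply: (@omega_closure _ _ _ (fun k => u k *m A + b)).
  apply: cvg_addm; last exact: cvg_cstm.
  apply: cvg_mulmx; last exact: cvg_cstm.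
  by apply: cvg_invn => k; have [] := Hu k.
by apply: (@omega_ge _ 0) => k _; apply: subset_closure; apply: (H _).1; case: (Hu k).
Qed.

(* The image of a ball around [y] is symmetric about [y A + b]. *)
Lemma aut_norm_bound (M0 : R) : exists2 M : R, 0 <= M & forall A b y r, aut Om A b -> 0 < r ->
  (forall v, `|v| <= r -> Om (y + v)) -> `|y *m A + b| <= M0 -> `|A| <= M / r.
Proof.
have [M M_ge0 HM] := symmetric_bounded oOm scOm Om0 OmT M0.
exists M => // A b y r [uA H] r0 Hr yM; apply: mx_norm_rows => // v vr.
apply: HM yM _ _; apply: subset_closure.
  have /H := Hr _ vr; rewrite mulmxDl; congr Om.
  by rewrite addrAC.
have /H : Om (y - v) by apply: Hr; rewrite normrN.
by rewrite mulmxBl; congr Om; rewrite addrAC.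
Qed.

Lemma cvg_norm_bound (u : nat -> 'rV[R]_d) (x : 'rV[R]_d) : u @ omega --> x ->
  \forall k \near omega, `|u k| <= `|x| + 1.
Proof.
move=> /cvgrPdist_le /(_ 1 ltr01); apply: filterS => k xu.
have := ler_normD x (u k - x); rewrite (addrC x) subrK => /le_trans; apply.
by rewrite lerD2l distrC.
Qed.

(** The ball of radius [r] about [y'] contains the balls of radius [r / 2] about nearly all [y k],
    so one constant serves them all. *)
Lemma aut_bounded_seq (A : nat -> 'M[R]_d) (b y : nat -> 'rV[R]_d) (y' x : 'rV[R]_d) :
  (forall k, aut Om (A k) (b k)) -> y @ omega --> y' -> Om y' ->
  (fun k => y k *m A k + b k) @ omega --> x -> exists M, \forall k \near omega, `|A k| <= M.
Proof.
move=> autA yy' Omy' xx.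
have [r r0 Hr] := open_ball oOm Omy'.
have [M M0 HM] := aut_norm_bound (`|x| + 1).
exists (M / (r / 2)).
have r20 : 0 < r / 2 by rewrite divr_gt0.
have /cvgrPdist_le/(_ _ r20) yr := yy'.
apply: filterS2 (cvg_norm_bound xx) yr => k xk yk.
apply: (HM _ _ _ _ (autA k) r20 _ xk) => v vr.
have -> : y k + v = y' + (y k - y' + v) by rewrite addrA (addrC y') subrK.
apply: Hr; apply: le_trans (ler_normD _ _) _.
by rewrite distrC [leRHS](splitr r) lerD.
Qed.

(** A priori the limit map only sends [Om] into the closure. Extending the segment from [y] slightly
    beyond [z] makes the image of [z] an inner point of a segment from a point of [Om] to a point of
    the closure. *)
Lemma aut_limit_half (A : nat -> 'M[R]_d) (b : nat -> 'rV[R]_d)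
    (A' : 'M[R]_d) (b' y : 'rV[R]_d) :
  (forall k, aut Om (A k) (b k)) -> A @ omega --> A' -> b @ omega --> b' ->
  Om y -> Om (y *m A' + b') -> forall z, Om z -> Om (z *m A' + b').
Proof.
move=> autA AA' bb' Omy Omy' z Omz.
have cl w : Om w -> closure Om (w *m A' + b').
  move=> Omw; apply: (@omega_closure _ _ _ (fun k => w *m A k + b k)).
    by apply: cvg_addm => //; apply: cvg_mulmx => //; exact: cvg_cstm.
  apply: (@omega_ge _ 0) => k _; apply: subset_closure.
  by have [_ H] := autA k; apply: (H _).1.
have [r r0 Hr] := open_ball oOm Omz.
have n0 : 0 < 1 + `|z - y| by rewrite ltr_wpDr.
pose e := r / (1 + `|z - y|).
have e0 : 0 < e by rewrite divr_gt0.
have /cl clz : Om (z + e *: (z - y)).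
  apply: Hr; rewrite mx_normZ gtr0_norm// /e mulrAC ler_pdivrMr// ler_pM2l//.
  by rewrite lerDr.
have := segment_interior oOm cOm Omy' clz (t := (1 + e)^-1).
have e1 : 0 < 1 + e by rewrite addr_gt0.
rewrite invr_ge0 (ltW e1) invf_lt1// ltrDl e0 => /(_ isT).
congr Om; rewrite sub_linear_comb.
have -> : (z + e *: (z - y)) *m A' + b' - (y *m A' + b') = (1 + e) *: ((z - y) *m A').
  by rewrite opprD addrACA subrr addr0 -mulmxBl -addrA (addrC _ (- y)) addrA
   -[X in X + _]scale1r -scalerDl -scalemxAl.
rewrite scalerA mulVf ?gt_eqF// scale1r mulmxBl [y *m A' + _]addrC.
by rewrite -addrA subrKC addrC.
Qed.

(** The inverses carry the convergent images back to the convergent points [y k], so they are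
    bounded too, and the limit of the linear parts is invertible. For this both limit points have to
    lie in [Om]. *)
Lemma aut_limit (A : nat -> 'M[R]_d) (b y : nat -> 'rV[R]_d) (y' x : 'rV[R]_d) :
  (forall k, aut Om (A k) (b k)) -> y @ omega --> y' -> Om y' ->
  (fun k => y k *m A k + b k) @ omega --> x -> Om x ->
  exists A' b', [/\ aut Om A' b', A @ omega --> A' & b @ omega --> b'].
Proof.
move=> autA yy' Omy' xx Omx.
have [M HM] := aut_bounded_seq autA yy' Omy' xx.
have [A' AA'] := mx_cvg_omega HM.
have autAi k := aut_inv (autA k).
have yE k : (y k *m A k + b k) *m invmx (A k) + (- b k *m invmx (A k)) = y k.
  by have [uA _] := autA k; rewrite -mulmxDl addrK mulmxK.
have [Mi HMi] : exists M, \forall k \near omega, `|invmx (A k)| <= M.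
  apply: (aut_bounded_seq autAi xx Omx (x := y')).
  by rewrite (_ : (fun k => _) = y)//; apply/funext.
have [B BB] := mx_cvg_omega HMi.
have AB : A' *m B = 1%:M.
  apply: (@cvg_mx_unique _ _ _ (fun k => A k *m invmx (A k))); first exact: cvg_mulmx.
  rewrite (_ : (fun k => _) = fun=> 1%:M); first exact: cvg_cst.
  by apply/funext => k; rewrite mulmxV//; have [] := autA k.
have [uA' _] := mulmx1_unit AB.
have BE : invmx A' = B by rewrite -[LHS]mulmx1 -AB mulKmx.
pose b' := x - y' *m A'.
have bb' : b @ omega --> b'.
  rewrite (_ : b = fun k => (y k *m A k + b k) - y k *m A k); last first.
    by apply/funext => k; rewrite addrC addKr.
  by apply: cvg_subm => //; exact: cvg_mulmx.
exists A', b'; split => //; split => // z.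
have xE : y' *m A' + b' = x by rewrite /b' addrC subrK.
split; first by apply: (aut_limit_half autA AA' bb' Omy'); rewrite xE.
move=> Omz.
have bi : (fun k => - b k *m invmx (A k)) @ omega --> - b' *m B.
  by apply: cvg_mulmx => //; apply: cvgN.
have := aut_limit_half autAi BB bi Omx; rewrite -xE -mulmxDl addrK -mulmxA AB mulmx1.
by move=> /(_ Omy' _ Omz); rewrite -mulmxDl addrK -mulmxA AB mulmx1.
Qed.

End Automorphisms.

(** * Contractions and the recession cone *)

Definition contracting (R : realType) d (A : 'M[R]_d) :=
  forall v : 'rV[R]_d, `|v *m A| <= 2^-1 * `|v|.

Lemma contracting_pow (R : realType) d (A : 'M[R]_d) k (v : 'rV[R]_d) :
  contracting A -> `|v *m A ^+ k| <= 2^-1 ^+ k * `|v|.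
Proof.
move=> cA; elim: k => [|k IH]; first by rewrite !expr0 mulmx1 mul1r.
rewrite exprSr -[_ * A]/(_ *m A) mulmxA (le_trans (cA _))//.
by rewrite exprS -mulrA ler_pM2l.
Qed.

Lemma half_pow_cvg0 (R : realType) : (fun k => (2^-1 : R) ^+ k) @ omega --> (0 : R).
Proof. by apply: cvg_omega; apply: cvg_expr; rewrite ger0_norm// invf_lt1// ltr1n. Qed.

Lemma contracting_cvg0 (R : realType) d (A : 'M[R]_d) (v : 'rV[R]_d) :
  contracting A -> (fun k => v *m A ^+ k) @ omega --> (0 : 'rV[R]_d).
Proof.
move=> cA; apply: (@mx_cvg0 _ _ _ _ (fun k => 2^-1 ^+ k * `|v|)).
  by move=> k; exact: contracting_pow.
rewrite -(mul0r `|v|); apply: cvgM; [exact: half_pow_cvg0|exact: cvg_cstr].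
Qed.

(** The translation part is the one for which [p] is a fixed point. *)
Definition fixaut (R : realType) d (Om : set 'rV[R]_d) (A : 'M[R]_d) (p : 'rV[R]_d) :=
  aut Om A (p - p *m A).

Lemma fixautE (R : realType) d (Om : set 'rV[R]_d) A p : fixaut Om A p ->
  forall v, Om (p + v) <-> Om (p + v *m A).
Proof.
move=> [_ H] v; rewrite (H (p + v)) mulmxDl.
have -> : p *m A + v *m A + (p - p *m A) = p + v *m A; last by [].
by move: (p *m A) (v *m A) => a c; apply/rowP => i; rewrite !mxE; ring.
Qed.

Lemma fixaut_pow (R : realType) d (Om : set 'rV[R]_d) A p k : fixaut Om A p ->
  fixaut Om (A ^+ k) p.
Proof.
move=> H; elim: k => [|k IH].
  rewrite /fixaut expr0 mulmx1 subrr; split; first exact: unitmx1.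
  by move=> x; rewrite mulmx1 addr0.
have := aut_comp IH H; rewrite /fixaut exprSr -[_ * A]/(_ *m A) mulmxBl mulmxA.
congr (aut Om _ _).
by move: (p *m A ^+ k *m A) (p *m A) => a c; apply/rowP => i; rewrite !mxE; ring.
Qed.

Section QuasiHomogeneous.
Variables (R : realType) (d : nat) (Om : set 'rV[R]_d).
Hypothesis oOm : open Om.
Hypothesis scOm : strictly_convex Om.
Hypothesis Om0 : Om !=set0.
Hypothesis OmT : Om <> setT.

Let cOm : convex_dom Om := scOm.1.

Lemma fixaut_inv A p : fixaut Om A p -> fixaut Om (invmx A) p.
Proof.
move=> H; have [uA _] := H; have := aut_inv H; rewrite /fixaut opprB mulmxBl mulmxK//.
Qed.

Lemma contracting_unit (A : 'M[R]_d) : contracting A -> 1%:M - A \in unitmx.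
Proof.
move=> cA; rewrite -row_free_unit; apply/inj_row_free => v.
rewrite mulmxBr mulmx1 => /eqP; rewrite subr_eq0 => /eqP vA.
apply/eqP; rewrite -normr_le0; have := cA v; rewrite -vA; have := normr_ge0 v; lra.
Qed.

(** Iterates of a point of [Om] stay in [Om] and converge to [p]. If [p] were in the open set [Om],
    the iterates of any point would enter it, and [Om] would be everything. *)
Lemma contracting_fixpoint A p : contracting A -> fixaut Om A p ->
  closure Om p /\ ~ Om p.
Proof.
move=> cA H; split.
  have [x Omx] := Om0.
  apply: (@omega_closure _ _ _ (fun k => p + (x - p) *m A ^+ k)).
    by apply: cvg_add0; exact: contracting_cvg0.
  apply: (@omega_ge _ 0) => k _; apply: subset_closure.
  by apply: (fixautE (fixaut_pow k H) _).1; rewrite addrC subrK.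
move=> Omp; apply: OmT; apply/seteqP; split => // z _.
have /filter_ex [k Hk] : \forall k \near omega, Om (p + (z - p) *m A ^+ k).
  apply: (omega_open (l := p) oOm Omp).
  by apply: cvg_add0; exact: contracting_cvg0.
by have := (fixautE (fixaut_pow k H) _).2 Hk; rewrite addrC subrK.
Qed.

Variable K : set 'rV[R]_d.
Hypothesis cK : compact K.
Hypothesis KOm : K `<=` Om.
Hypothesis qhK : forall x, Om x -> exists y A b, [/\ K y, aut Om A b & x = y *m A + b].

Lemma compact_cvg_omega (y : nat -> 'rV[R]_d) : (forall k, K (y k)) ->
  exists2 y' : 'rV[R]_d, K y' & y @ omega --> y'.
Proof.
move=> Ky; have := cK; rewrite compact_ultra.
move=> /(_ (y @ omega) (ultra_fmap y omega_ultra)) [|l [? ?]]; last by exists l.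
by apply: (@omega_ge (fun k => K (y k)) 0) => k _.
Qed.

Lemma compact_norm_bound : exists M : R, forall y, K y -> `|y| <= M.
Proof.
have [M [_ HM]] := compact_bounded cK; exists (M + 1) => y Ky.
by apply: HM => //; rewrite ltrDl.
Qed.

(** Compactness gives a limit [y'] of [y], hence bounded linear parts with a limit [A']. The image
    of a ball under [A'], centred at [p], lies in the closure; a nonzero [v *m A'] would make [p]
    the midpoint of two points of the closure. *)
Lemma aut_norm_cvg0 (A : nat -> 'M[R]_d) (b y : nat -> 'rV[R]_d) (p : 'rV[R]_d) :
  (forall k, K (y k)) -> (forall k, aut Om (A k) (b k)) ->
  (fun k => y k *m A k + b k) @ omega --> p -> ~ Om p -> A @ omega --> (0 : 'M[R]_d).
Proof.
move=> Ky autA xp np; have [y' Ky' yy'] := compact_cvg_omega Ky.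
have [M HM] := aut_bounded_seq oOm scOm Om0 OmT autA yy' (KOm Ky') xp.
have [A' AA'] := mx_cvg_omega HM.
have [r r0 Hr] := open_ball oOm (KOm Ky').
suff A'0 (v : 'rV[R]_d) : `|v| <= r -> v *m A' = 0.
  suff -> : 0 = A' :> 'M[R]_d by [].
  apply/esym/eqP; rewrite -normr_le0.
  by rewrite -(mul0r r^-1); apply: mx_norm_rows => // v /A'0 ->; rewrite normr0.
move=> vr.
have clv w : `|w| <= r -> closure Om (p + w *m A').
  move=> wr; apply: (@omega_closure _ _ _ (fun k => (y k *m A k + b k) + w *m A k)).
    by apply: cvg_addm => //; apply: cvg_mulmx => //; exact: cvg_cstm.
  have yw : (fun k => y k + w) @ omega --> y' + w.
    by apply: cvg_addm => //; exact: cvg_cstm.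
  have := omega_open oOm (Hr w wr) yw.
  apply: filterS => k Omk; apply: subset_closure.
  by rewrite addrAC -mulmxDl; apply: ((autA k).2 _).1.
apply/eqP; apply: contrapT => /negP v0; apply: np.
apply: (symmetric_strict oOm scOm _ _ v0); first exact: clv.
by rewrite -mulNmx; apply: clv; rewrite normrN.
Qed.

Lemma contraction_ex p (e : R) : closure Om p -> ~ Om p -> 0 < e ->
  exists A q, [/\ fixaut Om A q, contracting A, closure Om q, ~ Om q & `|p - q| <= e].
Proof.
move=> cp np e0.
have /choice [x Hx] : forall k, exists w, Om w /\ `|p - w| <= k.+1%:R^-1 :> R.
  move=> k; have k0 : 0 < k.+1%:R^-1 :> R by rewrite invr_gt0.
  by have [w ? /ltW ?] := closure_seq cp k0; exists w.
have /choice [g Hg] : forall k, exists g : 'rV[R]_d * 'M[R]_d * 'rV[R]_d,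
    [/\ K g.1.1, aut Om g.1.2 g.2 & x k = g.1.1 *m g.1.2 + g.2].
  by move=> k; have [y [A [b H]]] := qhK (Hx k).1; exists (y, A, b).
pose y k := (g k).1.1; pose A k := (g k).1.2; pose b k := (g k).2.
have Ky k : K (y k) by have [] := Hg k.
have autA k : aut Om (A k) (b k) by have [] := Hg k.
have xE k : x k = y k *m A k + b k by have [] := Hg k.
have xp : x @ omega --> p by apply: cvg_invn => k; have [] := Hx k.
have A0 : A @ omega --> (0 : 'M[R]_d).
  apply: (aut_norm_cvg0 Ky autA _ np).
  by rewrite (_ : (fun k => _) = x)//; apply/funext => k; rewrite xE.
have [M HM] := compact_norm_bound.
(* [c] bounds the distance from [y k] in [K] to [x k] near [p]. If the linear part contracts by
   [eta], then [x k], the image of [y k], is within [2 * eta * c] of the fixed point, and the choice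
   of [eta] makes this at most [e / 2]. *)
pose c := `|p| + 1 + `|M|.
have c0 : 0 < c by rewrite /c -addrA addrCA ltr_wpDr// addr_ge0.
pose eta := Num.min 2^-1 (e / (4 * c)).
have eta0 : 0 < eta by rewrite lt_min invr_gt0 ltr0n divr_gt0// mulr_gt0.
have eta2 : eta <= 2^-1 by rewrite ge_min lexx.
have etac : eta * (4 * c) <= e.
  by rewrite -ler_pdivlMr ?mulr_gt0// ge_min lexx orbT.
have d0 : 0 < d.+1%:R :> R by rewrite ltr0n.
(* Division by [d.+1] makes up for the dimension factor in [mx_norm_mul] and is meaningful also for
   [d = 0]. *)
have ed0 : 0 < eta / d.+1%:R by rewrite divr_gt0.
have e20 : 0 < e / 2 by rewrite divr_gt0.
have /cvgrPdist_le /(_ _ ed0) HA := A0.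
have /cvgrPdist_le /(_ _ e20) Hxp := xp.
have [k [[Ak xk] xn]] := omega_ex (omega_and (omega_and HA Hxp) (cvg_norm_bound xp)).
rewrite sub0r normrN in Ak.
have ctr (v : 'rV[R]_d) : `|v *m A k| <= eta * `|v|.
  apply: le_trans (mx_norm_mul _ _) _.
  rewrite mulrAC ler_wpM2r// (le_trans (ler_wpM2l _ Ak))//.
  rewrite mulrCA -[leRHS]mulr1 ler_pM2l// ler_pdivrMr// mul1r ler_nat.
  exact: leqnSn.
have cA : contracting (A k).
  by move=> v; rewrite (le_trans (ctr v))// ler_wpM2r.
have uA := contracting_unit cA.
(* The solution of [q = q *m A k + b k]. *)
pose q := b k *m invmx (1%:M - A k).
have qE : b k = q - q *m A k.
  by rewrite -{1}[q]mulmx1 -mulmxBr mulmxKV.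
have fA : fixaut Om (A k) q by rewrite /fixaut -qE.
have [cq nq] := contracting_fixpoint cA fA.
exists (A k), q; split => //.
have xq : x k - q = (y k - q) *m A k by rewrite xE qE mulmxBl; rewrite addrAC addrA subrK.
have h1 : `|x k - q| <= eta * (`|y k - x k| + `|x k - q|).
  rewrite {1}xq; rewrite (le_trans (ctr _))// ler_pM2l//.
  by rewrite -{1}(subrK (x k) (y k)) -addrA ler_normD.
have h2 : `|y k - x k| <= c.
  apply: le_trans (ler_normB _ _) _; rewrite addrC lerD//.
  by apply: le_trans (HM _ (Ky k)) _; exact: ler_norm.
have h3 : `|x k - q| <= e / 2.
  have h4 : eta * `|x k - q| <= 2^-1 * `|x k - q| by rewrite ler_wpM2r.
  have h5 : eta * `|y k - x k| <= eta * c by rewrite ler_pM2l.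
  lra.
by rewrite -(subrK (x k) p) -addrA (le_trans (ler_normD _ _))// [leRHS](splitr e) lerD.
Qed.

End QuasiHomogeneous.

Local Opaque closure.

(** Stated on the closure, so that limits of recession directions are recession directions; zero
    counts as one. *)
Record recession (R : realType) d (Om : set 'rV[R]_d) (v : 'rV[R]_d) : Prop := Recession {
  recessionP : forall (x : 'rV[R]_d) (s : R),
    closure Om x -> 0 <= s -> closure Om (x + s *: v) }.

(** * The recession cone: existence of a direction and its uniqueness up to scaling *)

Section Recession.
Variables (R : realType) (d : nat) (Om : set 'rV[R]_d).
Hypothesis oOm : open Om.
Hypothesis scOm : strictly_convex Om.
Hypothesis Om0 : Om !=set0.
Hypothesis OmT : Om <> setT.

Let cOm : convex_dom Om := scOm.1.

(** One ray suffices: far points of it, joined to [y] with weight [1 / (k + 1)], converge to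
    [y + s v]. *)
Lemma recession_ray (x v : 'rV[R]_d) :
  (forall s : R, 0 <= s -> closure Om (x + s *: v)) -> recession Om v.
Proof.
move=> H; split=> y s cy s0.
apply: (@omega_closure _ _ _ (fun k => (1 - k.+1%:R^-1) *: y + k.+1%:R^-1 *: (x + (s * k.+1%:R) *: v))).
  rewrite (_ : (fun k => _) = fun k => (1 - k.+1%:R^-1) *: y + (k.+1%:R^-1 *: x + s *: v)); last first.
    apply/funext => k; congr (_ + _); rewrite scalerDr scalerA; congr (_ + _ *: _).
    by rewrite mulrCA mulVf// mulr1.
  have -> : y + s *: v = 1 *: y + (0 *: x + s *: v) by rewrite scale1r scale0r add0r.
  apply: cvg_addm.
    by apply: cvg_scalem; [exact: invn_cvg1|exact: cvg_cstm].
  apply: cvg_addm; last exact: cvg_cstm.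
  by apply: cvg_scalem; [exact: invn_cvg0|exact: cvg_cstm].
apply: (@omega_ge _ 0) => k _; apply: closure_convex => //.
  by apply: H; rewrite mulr_ge0.
by rewrite invr_ge0 ler0n invf_le1// ler1n.
Qed.

Lemma recessionZ (v : 'rV[R]_d) (c : R) : 0 <= c -> recession Om v -> recession Om (c *: v).
Proof.
move=> c0 H; split=> x s cx s0.
by rewrite scalerA; apply: (recessionP H) => //; rewrite mulr_ge0.
Qed.

Lemma recessionD (v w : 'rV[R]_d) : recession Om v -> recession Om w -> recession Om (v + w).
Proof.
move=> Hv Hw; split=> x s cx s0.
by rewrite scalerDr addrA; apply: (recessionP Hw) => //; exact: (recessionP Hv).
Qed.

Lemma recession_add (x v : 'rV[R]_d) : recession Om v -> closure Om x -> closure Om (x + v).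
Proof. by move=> H cx; have := recessionP H cx ler01; rewrite scale1r. Qed.

Lemma recession_lim (u : nat -> 'rV[R]_d) (v : 'rV[R]_d) : (forall k, recession Om (u k)) ->
  u @ omega --> v -> recession Om v.
Proof.
move=> Hu uv; split=> x s cx s0; apply: (@omega_closure _ _ _ (fun k => x + s *: u k)).
  by apply: cvg_addm; [exact: cvg_cstm|exact: cvg_scalec].
by apply: (@omega_ge _ 0) => k _; exact: (recessionP (Hu k)).
Qed.

Lemma recession_pointed (v : 'rV[R]_d) : recession Om v -> recession Om (- v) -> v = 0.
Proof.
move=> H H'; have [x Omx] := Om0; have cx := subset_closure Omx.
apply: (@no_line _ _ _ oOm scOm Om0 OmT x) => s.
have [s0|s0] := leP 0 s; first exact: (recessionP H).
rewrite -[s *: v]opprK -scalerN -scaleNr; apply: (recessionP H') => //.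
by rewrite oppr_ge0 ltW.
Qed.

Lemma recession_aut A b (v : 'rV[R]_d) : aut Om A b -> recession Om v -> recession Om (v *m A).
Proof.
move=> autA H; split=> x s cx s0.
have cx' := aut_closure (aut_inv autA) cx.
have := aut_closure autA (recessionP H cx' s0); have [uA _] := autA.
by rewrite -[x *m _ + _]mulmxDl [(_ + s *: v) *m A]mulmxDl (mulmxKV uA) addrAC subrK scalemxAl.
Qed.

(** The point is the midpoint of [p] and [p + 2 t v]. It provides points of [Om] attached to a
    boundary point, at which limits of automorphisms can be taken. *)
Lemma boundary_recession (p v : 'rV[R]_d) (t : R) : closure Om p -> recession Om v -> v != 0 -> 0 < t ->
  Om (p + t *: v).
Proof.
move=> cp H v0 t0; apply: (@symmetric_strict _ _ _ oOm scOm _ (t *: v)).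
- by rewrite -addrA -scalerDl; apply: (recessionP H) => //; rewrite addr_ge0 ?ltW.
- by rewrite addrK.
- by rewrite scaler_eq0 negb_or v0 gt_eqF.
Qed.

Lemma closure_shrink (p u : 'rV[R]_d) (s t : R) : closure Om p -> closure Om (p + t *: u) ->
  0 <= s <= t -> closure Om (p + s *: u).
Proof.
move=> cp ct /andP[s0]; rewrite le_eqVlt => /predU1P[->//|st].
have t0 : 0 < t by exact: le_lt_trans st.
have := closure_convex cOm cp ct (t := s / t).
rewrite sub_linear_comb [p + t *: u]addrC addrK scalerA mulfVK; last by rewrite gt_eqF.
by apply; rewrite divr_ge0 ?(ltW t0)// ler_pdivrMr// mul1r ltW.
Qed.

(** If multiples of [e] could be subtracted without bound, dividing by the multiple would make [- e]
    a recession direction, against [recession_pointed]. The supremum is attained because the cone is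
    closed. *)
Lemma recession_sup (v e : 'rV[R]_d) : recession Om v -> recession Om e -> e != 0 ->
  exists2 s : R, 0 <= s & recession Om (v - s *: e) /\
    forall eps : R, 0 < eps -> ~ recession Om (v - s *: e - eps *: e).
Proof.
move=> Hv He e0.
pose E := [set s : R | 0 <= s /\ recession Om (v - s *: e)].
have E0 : E 0 by split => //; rewrite scale0r subr0.
have Edown s t : E t -> 0 <= s <= t -> E s.
  move=> [_ Ht] /andP[s0 st]; split => //.
  have -> : v - s *: e = v - t *: e + (t - s) *: e.
    by rewrite scalerBl addrA subrK.
  by apply: recessionD => //; apply: recessionZ => //; rewrite subr_ge0.
have Eub : has_ubound E.
  apply: contrapT => nub.
  have Ek k : E k.+1%:R.
    have /existsNP [t /not_implyP [Et /negP]] : ~ ubound E k.+1%:R.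
      by move=> ub; apply: nub; exists k.+1%:R.
    by rewrite -ltNge => kt; apply: Edown Et _; rewrite ler0n ltW.
  case/negP: e0; apply/eqP; apply: recession_pointed => //.
  apply: (@recession_lim (fun k => - e + k.+1%:R^-1 *: v)).
    move=> k; have [_ /(@recessionZ _ k.+1%:R^-1)] := Ek k.
    by rewrite scalerBr scalerA mulVf// scale1r addrC; apply; rewrite invr_ge0.
  apply: cvg_add0; rewrite -(scale0r v).
  by apply: cvg_scalem; [exact: invn_cvg0|exact: cvg_cstm].
have supE : has_sup E by split => //; exists 0.
set s := sup E.
have s0 : 0 <= s by apply: ub_le_sup.
exists s => //; split; last first.
  move=> eps eps0 H; suff : s + eps <= s by lra.
  apply: ub_le_sup => //; split; first by rewrite addr_ge0// ltW.
  by rewrite scalerDl opprD addrA.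
have [s00|sn0] := eqVneq s 0; first by rewrite s00 scale0r subr0.
have sp : 0 < s by rewrite lt_def sn0.
apply: (@recession_lim (fun k => v - s *: e + (s * k.+1%:R^-1) *: e)); last first.
  apply: cvg_add0; rewrite -(scale0r e); apply: cvg_scalem; last exact: cvg_cstm.
  rewrite -(mulr0 s); apply: cvgM; [exact: cvg_cstr|exact: invn_cvg0].
move=> k; have k0 : 0 < s * k.+1%:R^-1 by rewrite mulr_gt0// invr_gt0.
have [t Et tk] := sup_adherent k0 supE.
have : E (s - s * k.+1%:R^-1).
  apply: Edown Et _; rewrite (ltW tk) andbT subr_ge0.
  by rewrite -[leRHS]mulr1 ler_pM2l// invf_le1// ler1n.
by move=> [_]; rewrite scalerBl opprB addrA addrAC.
Qed.

Variable K : set 'rV[R]_d.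
Hypothesis cK : compact K.
Hypothesis KOm : K `<=` Om.
Hypothesis qhK : forall x, Om x -> exists y A b, [/\ K y, aut Om A b & x = y *m A + b].

(** Inverse powers of a contraction expand: [x - p] is the image of [z k - p] under the [k]-th
    power, so bounded [z k] would force [x = p]. *)
Lemma unbounded_ex (M : R) : exists2 x, Om x & M < `|x|.
Proof.
have [p0 cp0 np0] := boundary_ex oOm scOm Om0 OmT.
have [A [p [fA cA cp np _]]] :=
  contraction_ex oOm scOm Om0 OmT cK KOm qhK cp0 np0 ltr01.
have [x Omx] := Om0.
pose z k := p + (x - p) *m invmx (A ^+ k).
have Omz k : Om (z k).
  by apply: (fixautE (fixaut_inv (fixaut_pow k fA)) _).1; rewrite addrC subrK.
have xp : 0 < `|x - p|.
  by rewrite normr_gt0 subr_eq0; apply: contra_notN np => /eqP <-.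
apply: contrapT => H.
have zM k : `|z k - p| <= `|M| + `|p|.
  apply: le_trans (ler_normB _ _) _; rewrite lerD2r; apply: le_trans (ler_norm M).
  by rewrite leNgt; apply/negP => lt; apply: H; exists (z k).
have : `|x - p| <= 0.
  apply: (@omega_lim_le _ (fun=> `|x - p|) (fun k => 2^-1 ^+ k * (`|M| + `|p|))).
  - exact: cvg_cstr.
  - by rewrite -(mul0r (`|M| + `|p|)); apply: cvgM; [exact: half_pow_cvg0|exact: cvg_cstr].
  move=> k; have := contracting_pow k (z k - p) cA.
  rewrite /z addrC addKr mulmxKV; last by have [] := fixaut_pow k fA.
  move=> /le_trans; apply; rewrite ler_wpM2l ?exprn_ge0 ?invr_ge0//.
  by have := zM k; rewrite /z addrC addKr.
by rewrite leNgt xp.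
Qed.

(** The normalised directions from [p] to points going to infinity have a limit, and by convexity
    the segments to those points fill a ray in the limit. *)
Lemma recession_ex : exists2 e, recession Om e & e != 0.
Proof.
have [p Omp] := Om0; have cp := subset_closure Omp.
have /choice [z Hz] : forall k : nat, exists z, Om z /\ k.+1%:R + `|p| < `|z|.
  by move=> k; have [z ? ?] := unbounded_ex (k.+1%:R + `|p|); exists z.
have zp k : k.+1%:R < `|z k - p|.
  have [_ H] := Hz k; rewrite -(ltrD2r `|p|) (lt_le_trans H)//.
  by rewrite -{1}(subrK p (z k)) ler_normD.
have zp0 k : 0 < `|z k - p| by exact: lt_trans (zp k).
pose u k := `|z k - p|^-1 *: (z k - p).
have nu k : `|u k| = 1 by rewrite mx_normZ ger0_norm ?invr_ge0// mulVf// gt_eqF.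
have [e ue] : exists e : 'rV[R]_d, u @ omega --> e.
  by apply: (@mx_cvg_omega _ _ _ _ 1); apply: (@omega_ge _ 0) => k _; rewrite nu.
have ne : `|e| = 1.
  apply: (@cvg_real_unique _ (fun k => `|u k|)); first exact: cvg_norm.
  by rewrite (_ : (fun k => _) = fun=> 1); [exact: cvg_cst|apply/funext => k].
exists e; last by rewrite -normr_eq0 ne oner_neq0.
apply: (@recession_ray p) => s s0.
apply: (@omega_closure _ _ _ (fun k => p + s *: u k)).
  by apply: cvg_addm; [exact: cvg_cstm|exact: cvg_scalec].
apply: (@omega_ge _ (Num.bound s)) => k sk.
apply: (@closure_shrink _ _ _ `|z k - p|) => //.
  rewrite scalerA mulfV ?gt_eqF// scale1r addrC subrK.
  by apply: subset_closure; have [] := Hz k.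
rewrite s0 ltW// (le_lt_trans _ (zp k))// ltW// (lt_le_trans (archi_boundP s0))//.
by rewrite ler_nat (leq_trans sk).
Qed.

(* Going to infinity along [a + a'] and pulling back by automorphisms turns the
   nearly flat pieces of boundary along [a] and [a'] into boundary segments. *)
Lemma recession_two_extreme (a a' : 'rV[R]_d) : recession Om a -> recession Om a' ->
  (forall eps : R, 0 < eps -> ~ recession Om (a - eps *: a')) ->
  (forall eps : R, 0 < eps -> ~ recession Om (a' - eps *: a)) -> False.
Proof.
move=> Ha Ha' na na'.
have aa' : a + a' != 0.
  apply/negP; rewrite addr_eq0 => /eqP aE.
  have a0 : a' = 0 by apply: recession_pointed => //; rewrite -aE.
  by apply: (na 1) => //; rewrite a0 scaler0 subr0.
have [p cp np] := boundary_ex oOm scOm Om0 OmT.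
have Haa := recessionD Ha Ha'.
have /choice [g Hg] : forall k : nat, exists g : 'rV[R]_d * 'M[R]_d * 'rV[R]_d,
    [/\ K g.1.1, aut Om g.1.2 g.2 & p + k.+1%:R *: (a + a') = g.1.1 *m g.1.2 + g.2].
  move=> k; have Hk : Om (p + k.+1%:R *: (a + a')) by exact: boundary_recession.
  by have [y [A [b H]]] := qhK Hk; exists (y, A, b).
pose y k := (g k).1.1; pose A k := (g k).1.2; pose b k := (g k).2.
have Ky k : K (y k) by have [] := Hg k.
have autA k : aut Om (A k) (b k) by have [] := Hg k.
have xE k : p + k.+1%:R *: (a + a') = y k *m A k + b k by have [] := Hg k.
(* [pull v k] is the vector [k.+1 v] seen through the inverse of the [k]-th automorphism; the point
   [q k] defined next is the preimage of the boundary point [p]. *)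
pose pull (v : 'rV[R]_d) k := k.+1%:R *: (v *m invmx (A k)).
pose q k := y k - pull a k - pull a' k.
have qA k (v : 'rV[R]_d) (s : R) : (q k + s *: pull v k) *m A k + b k = p + (s * k.+1%:R) *: v.
  have [uA _] := autA k.
  rewrite /q /pull !(mulmxDl, mulNmx) -!scalemxAl !mulmxKV// scalerA.
  have -> : p = y k *m A k + b k - k.+1%:R *: (a + a') by rewrite -xE addrK.
  by move: (y k *m A k) => c; apply/rowP => i; rewrite !mxE; ring.
have cq k : closure Om (q k).
  have := aut_closure (aut_inv (autA k)) cp; have [uA _] := autA k.
  rewrite -mulmxDl -[p](addr0 p) -(scale0r a) -(mul0r k.+1%:R) -qA scale0r addr0 addrK mulmxK//.
have rp v k : recession Om v -> recession Om (pull v k).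
  by move=> Hv; apply: recessionZ => //; apply: recession_aut Hv; exact: aut_inv.
have [M0 HM0] := compact_norm_bound cK.
have [M _ HM] := symmetric_bounded oOm scOm Om0 OmT M0.
(* [y k + pull v k] and [y k - pull v k] both lie in the closure, and their centre [y k] stays in
   [K]. *)
have bnd v v' k : recession Om v -> recession Om v' -> q k = y k - pull v k - pull v' k ->
    `|pull v k| <= M.
  move=> Hv Hv' qE; apply: (HM (y k)); first exact: HM0.
    by apply: recession_add; [exact: rp|apply: subset_closure; exact: KOm].
  have -> : y k - pull v k = q k + pull v' k by rewrite qE subrK.
  by apply: recession_add; [exact: rp|exact: cq].
have [l al] : exists l : 'rV[R]_d, pull a @ omega --> l.
  by apply: (@mx_cvg_omega _ _ _ _ M); apply: (@omega_ge _ 0) => k _; exact: (bnd a a').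
have [l' al'] : exists l : 'rV[R]_d, pull a' @ omega --> l.
  apply: (@mx_cvg_omega _ _ _ _ M); apply: (@omega_ge _ 0) => k _.
  by apply: (bnd a' a) => //; rewrite /q addrAC.
have [y' Ky' yy'] := compact_cvg_omega cK Ky.
pose q' := y' - l - l'.
have qq' : q @ omega --> q'.
  by apply: cvg_subm; [apply: cvg_subm; [exact: yy'|exact: al]|exact: al'].
have cq' : closure Om q'.
  by apply: (omega_closure qq'); apply: (@omega_ge _ 0) => k _.
(* If the limit [m] were nonzero, [q' + m / 2] would be in [Om], and by openness also after a small
   shift along [- m']. Mapped forward again, this gives points of the closure arbitrarily far from
   [p] in the direction [c - eps c'], which would then be a recession direction. *)
have key c c' (m m' : 'rV[R]_d) : recession Om c -> recession Om c' ->
    (forall eps : R, 0 < eps -> ~ recession Om (c - eps *: c')) ->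
    pull c @ omega --> m -> pull c' @ omega --> m' -> m = 0.
  move=> Hc Hc' nc cm cm'; apply/eqP; apply: contrapT => /negP m0.
  have Hm : recession Om m by apply: recession_lim cm => k; exact: rp.
  have Om2 : Om (q' + 2^-1 *: m) by apply: boundary_recession.
  have [r r0 Hr] := open_ball oOm Om2.
  pose eps := r / (1 + `|m'|).
  have n0 : 0 < 1 + `|m'| by rewrite ltr_wpDr.
  have eps0 : 0 < eps by rewrite divr_gt0.
  have Ome : Om (q' + 2^-1 *: (m - eps *: m')).
    rewrite scalerBr addrA; apply: Hr; rewrite normrN !mx_normZ !gtr0_norm//.
    have : eps * `|m'| <= r by rewrite /eps mulrAC ler_pdivrMr// ler_pM2l// lerDr.
    have : 0 <= eps * `|m'| by rewrite mulr_ge0// ltW.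
    lra.
  have /existsNP [s /not_implyP [s0 ns]] :
      ~ forall s : R, 0 <= s -> closure Om (p + s *: (c - eps *: c')).
    by move=> H; apply: (nc eps eps0); exact: recession_ray H.
  have pE k : pull (c - eps *: c') k = pull c k - eps *: pull c' k.
    by rewrite /pull mulmxBl -scalemxAl scalerBr !scalerA mulrC.
  have Hk1 : \forall k \near omega, Om (q k + 2^-1 *: pull (c - eps *: c') k).
    apply: (omega_open oOm Ome); apply: cvg_addm; [exact: qq'|apply: cvg_scalec].
    rewrite (_ : pull _ = fun k => pull c k - eps *: pull c' k); last by apply/funext.
    by apply: cvg_subm; [exact: cm|apply: cvg_scalec; exact: cm'].
  have Hk2 : \forall k \near omega, (Num.bound (2 * s) <= k)%N.
    by apply: (@omega_ge _ (Num.bound (2 * s))) => k.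
  have [k [Ok sk]] := omega_ex (omega_and Hk1 Hk2).
  apply: ns; apply: (@closure_shrink _ _ _ (2^-1 * k.+1%:R) cp).
    by rewrite -qA; apply: subset_closure; apply: ((autA k).2 _).1.
  have : 2 * s < k.+1%:R.
    have s20 : 0 <= 2 * s by rewrite mulr_ge0.
    by rewrite (lt_le_trans (archi_boundP s20))// ler_nat (leq_trans sk).
  by move=> ?; apply/andP; split => //; lra.
(* With both limits zero, the boundary points [q k] would converge to the point [y'] of [Om]. *)
have l0 : l = 0 by exact: (key a a' l l').
have l'0 : l' = 0 by exact: (key a' a l' l).
have Omq : Om q' by rewrite /q' l0 l'0 !subr0; exact: KOm.
have [k Ok] := omega_ex (omega_open oOm Omq qq').
apply: np; have := ((autA k).2 _).1 Ok.
have := qA k a 0; rewrite mul0r !scale0r !addr0 => ->.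
by [].
Qed.

(** Subtract from [v] as much of [e] as the cone permits. If a nonzero [a] remains, subtract from
    [e] as much of [a] as possible: the two remainders are extreme with respect to each other, which
    [recession_two_extreme] excludes. *)
Lemma recession_unique (e v : 'rV[R]_d) : recession Om e -> e != 0 -> recession Om v ->
  exists2 s : R, 0 <= s & v = s *: e.
Proof.
move=> He e0 Hv; have [s s0 [Ha na]] := recession_sup Hv He e0.
have [a0|a0] := eqVneq (v - s *: e) 0.
  by exists s => //; apply/eqP; rewrite -subr_eq0 a0.
exfalso; set a := v - s *: e in Ha na a0.
have [t t0 [Hb nb]] := recession_sup He Ha a0.
apply: (@recession_two_extreme a (e - t *: a)) => // eps eps0.
have et : 0 < 1 + eps * t by rewrite ltr_wpDr// mulr_ge0// ltW.
have -> : a - eps *: (e - t *: a) = (1 + eps * t) *: (a - (eps / (1 + eps * t)) *: e).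
  by move: a {Ha na a0 Hb nb} => a; apply/rowP => i; rewrite !mxE; field; rewrite gt_eqF.
move=> /(@recessionZ _ (1 + eps * t)^-1); rewrite invr_ge0 (ltW et) => /(_ isT).
by rewrite scalerA mulVf ?gt_eqF// scale1r; apply: na; rewrite divr_gt0.
Qed.

End Recession.

(** * Transitivity on the boundary *)

Section Transitivity.
Variables (R : realType) (d : nat) (Om : set 'rV[R]_d).
Hypothesis oOm : open Om.
Hypothesis scOm : strictly_convex Om.
Hypothesis Om0 : Om !=set0.
Hypothesis OmT : Om <> setT.
Variable K : set 'rV[R]_d.
Hypothesis cK : compact K.
Hypothesis KOm : K `<=` Om.
Hypothesis qhK : forall x, Om x -> exists y A b, [/\ K y, aut Om A b & x = y *m A + b].

Let cOm : convex_dom Om := scOm.1.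

Variable e : 'rV[R]_d.
Hypothesis re : recession Om e.
Hypothesis e0 : e != 0.

Lemma aut_eigen A b : aut Om A b -> exists2 l : R, 0 < l & e *m A = l *: e.
Proof.
move=> autA; have rA := recession_aut autA re.
have [l l0 eA] := recession_unique oOm scOm Om0 OmT cK KOm qhK re e0 rA.
exists l => //; rewrite lt_neqAle l0 andbT; apply: contra_neq e0 => l00.
have [uA _] := autA.
by rewrite -[e](mulmxK uA) eA -l00 scale0r mul0mx.
Qed.

Lemma eigen_pow (A : 'M[R]_d) (l : R) k : e *m A = l *: e -> e *m A ^+ k = l ^+ k *: e.
Proof.
move=> eA; elim: k => [|k IH]; first by rewrite !expr0 mulmx1 scale1r.
by rewrite exprSr -[_ * A]/(_ *m A) mulmxA IH -scalemxAl eA scalerA exprSr.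
Qed.

Lemma eigen_inv (A : 'M[R]_d) (l : R) : A \in unitmx -> 0 < l -> e *m A = l *: e ->
  e *m invmx A = l^-1 *: e.
Proof.
move=> uA l0 eA; rewrite -{1}[e]scale1r -(mulVf (lt0r_neq0 l0)) -scalerA -eA.
by rewrite -scalemxAl mulmxK.
Qed.

Lemma contracting_eigen (A : 'M[R]_d) (l : R) : contracting A -> 0 < l -> e *m A = l *: e ->
  l <= 2^-1.
Proof.
move=> cA l0 eA; have := cA e; rewrite eA mx_normZ gtr0_norm//.
by rewrite ler_pM2r// normr_gt0.
Qed.

Lemma pow_le_ex (a b : R) : 0 < a <= 2^-1 -> 0 < b -> exists k : nat, a ^+ k <= b.
Proof.
move=> /andP[a0 a2] b0.
have /cvgrPdist_le /(_ _ b0) H := @half_pow_cvg0 R.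
have [k Hk] := omega_ex H; exists k; apply: le_trans (lerXn2r _ _ _ a2) _.
- by rewrite nnegrE ltW.
- by rewrite nnegrE.
- by move: Hk; rewrite sub0r normrN ger0_norm// exprn_ge0.
Qed.

(* [k] is chosen so that [l1 ^+ k / l2 ^+ m] stays in [[l1, 1]]; then the maps
   [g1 ^ k \o g2 ^ -m] subconverge and send [p2] to [p1] in the limit. *)
Lemma contraction_fixpoints_equiv A1 p1 (l1 : R) A2 p2 :
  fixaut Om A1 p1 -> contracting A1 -> 0 < l1 -> e *m A1 = l1 *: e ->
  fixaut Om A2 p2 -> contracting A2 ->
  exists A b (l : R), [/\ aut Om A b, p2 *m A + b = p1, e *m A = l *: e & l1 <= l <= 1].
Proof.
move=> f1 c1 l10 eA1 f2 c2; have [l2 l20 eA2] := aut_eigen f2.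
have l12 := contracting_eigen c1 l10 eA1; have l22 := contracting_eigen c2 l20 eA2.
have [cp1 np1] := contracting_fixpoint oOm Om0 OmT c1 f1.
have [cp2 np2] := contracting_fixpoint oOm Om0 OmT c2 f2.
have exk m : exists k, l1 ^+ k <= l2 ^+ m.
  by apply: pow_le_ex; rewrite ?l10// exprn_gt0.
pose k m := ex_minn (exk m).
have k1 m : l1 ^+ k m <= l2 ^+ m by rewrite /k; case: ex_minnP.
(* Minimality of [k m]: one exponent less fails the inequality, unless [k m = 0], where the bound is
   trivial. *)
have k2 m : l1 * l2 ^+ m <= l1 ^+ k m.
  rewrite /k; case: ex_minnP => -[|j] Hj minj.
    rewrite expr0 -[leRHS]mulr1 ler_pM//; first exact: ltW.
    - by rewrite exprn_ge0// ltW.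
    - lra.
    - by rewrite exprn_ile1//; lra.
  rewrite exprS ler_pM2l// leNgt; apply/negP => /ltW /minj.
  by rewrite ltnn.
pose rho m := l1 ^+ k m / l2 ^+ m.
have rho1 m : rho m <= 1 by rewrite ler_pdivrMr ?mul1r ?exprn_gt0.
have rho2 m : l1 <= rho m by rewrite ler_pdivlMr ?exprn_gt0.
(* [l1 ^+ k m] is at most [2^-1 ^+ m], so the exponents [k m] tend to infinity. *)
have k_oo (v : 'rV[R]_d) : (fun m => v *m A1 ^+ k m) @ omega --> (0 : 'rV[R]_d).
  apply/cvgrPdist_le => eps eps0.
  have : (fun j => 2^-1 ^+ j * `|v|) @ omega --> (0 : R).
    by rewrite -(mul0r `|v|); apply: cvgM; [exact: half_pow_cvg0|exact: cvg_cstr].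
  move=> /cvgrPdist_le /(_ _ eps0) /omega_ex [j]; rewrite sub0r normrN ger0_norm; last first.
    by rewrite mulr_ge0// exprn_ge0.
  move=> Hj.
  have h0 : 0 < l1 ^+ j / 2 by rewrite divr_gt0// exprn_gt0.
  have /cvgrPdist_le /(_ _ h0) := @half_pow_cvg0 R; apply: filterS => m.
  rewrite !sub0r !normrN ger0_norm ?exprn_ge0// => Hm.
  have jk : (j <= k m)%N.
    rewrite leqNgt; apply/negP => kj.
    have l11 : l1 <= 1 by lra.
    have a1 : l1 ^+ j <= l1 ^+ k m by exact: (ler_wiXn2l (ltW l10) l11 (ltnW kj)).
    have a2 : l2 ^+ m <= 2^-1 ^+ m by rewrite lerXn2r// nnegrE ltW.
    have a3 := k1 m.
    have : 0 < l1 ^+ j by rewrite exprn_gt0.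
    lra.
  apply: le_trans (contracting_pow _ _ c1) _; apply: le_trans Hj.
  by rewrite ler_wpM2r// ler_wiXn2l// invf_le1// ler1n.
pose C m := invmx (A2 ^+ m) *m A1 ^+ k m.
pose b m := (p2 - p2 *m invmx (A2 ^+ m)) *m A1 ^+ k m + (p1 - p1 *m A1 ^+ k m).
have autC m : aut Om (C m) (b m).
  exact: (aut_comp (fixaut_inv (fixaut_pow m f2)) (fixaut_pow (k m) f1)).
have eC m : e *m C m = rho m *: e.
  rewrite /C mulmxA (@eigen_inv _ (l2 ^+ m)) ?exprn_gt0//; last 2 first.
  - by have [] := fixaut_pow m f2.
  - exact: eigen_pow.
  by rewrite -scalemxAl (eigen_pow _ eA1) scalerA mulrC.
have pC m : p2 *m C m + b m = p1 + (p2 - p1) *m A1 ^+ k m.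
  rewrite /C /b mulmxA !mulmxBl.
  move: (p2 *m invmx (A2 ^+ m) *m A1 ^+ k m) => a1.
  move: (p2 *m A1 ^+ k m) (p1 *m A1 ^+ k m) => a2 a3.
  by apply/rowP => i; rewrite !mxE; ring.
have [r rr] : exists r : R, rho @ omega --> r.
  apply: (@real_cvg_omega _ _ 1); apply: (@omega_ge _ 0) => m _.
  by rewrite ger0_norm// (le_trans _ (rho2 m))// ltW.
have r1 : r <= 1 by apply: (omega_lim_le rr (@cvg_cstr _ _ omega _ 1)).
have r2 : l1 <= r by apply: (omega_lim_le (@cvg_cstr _ _ omega _ l1) rr).
have pp1 : (fun m => p2 *m C m + b m) @ omega --> p1.
  rewrite (_ : (fun m => _) = fun m => p1 + (p2 - p1) *m A1 ^+ k m); last by apply/funext.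
  by apply: cvg_add0; exact: k_oo.
(* The limit is taken at [p2 + e] instead of the boundary point [p2]; its images tend to [p1 + r e],
   which lies in [Om] because [r] is at least [l1 > 0]. *)
have [A [b' [autA CA bb']]] : exists A' b', [/\ aut Om A' b', C @ omega --> A' & b @ omega --> b'].
  apply: (@aut_limit _ _ _ oOm scOm Om0 OmT C b (fun=> p2 + 1 *: e) (p2 + 1 *: e) (p1 + r *: e)) => //.
  - exact: cvg_cstm.
  - exact: boundary_recession.
  - rewrite (_ : (fun m => _) = fun m => (p2 *m C m + b m) + rho m *: e); last first.
      by apply/funext => m; rewrite scale1r mulmxDl eC addrAC.
    by apply: cvg_addm => //; apply: cvg_scalem => //; exact: cvg_cstm.
  - by apply: boundary_recession => //; exact: lt_le_trans r2.
exists A, b', r; split => //; last by rewrite r2.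
- apply: (cvg_mx_unique _ pp1); apply: cvg_addm => //.
  by apply: cvg_mulmx => //; exact: cvg_cstm.
- apply: (@cvg_mx_unique _ _ _ (fun m => e *m C m)).
    by apply: cvg_mulmx => //; exact: cvg_cstm.
  rewrite (_ : (fun m => _) = fun m => rho m *: e); last by apply/funext.
  by apply: cvg_scalem => //; exact: cvg_cstm.
Qed.

(** Fixed points of contractions are dense in the boundary, and each is carried to [p0]. The scale
    factors of these maps along [e] lie in [[l0, 1]] whatever the fixed point, so the maps converge
    as the fixed points approach [p]. *)
Lemma boundary_transitive : exists p0 A0, [/\ fixaut Om A0 p0, contracting A0 &
  forall p, closure Om p -> ~ Om p -> exists A b, aut Om A b /\ p *m A + b = p0].
Proof.
have [q cq nq] := boundary_ex oOm scOm Om0 OmT.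
have [A0 [p0 [f0 c0 cp0 np0 _]]] :=
  contraction_ex oOm scOm Om0 OmT cK KOm qhK cq nq ltr01.
exists p0, A0; split => // p cp np.
have [l0 l00 eA0] := aut_eigen f0.
have /choice [g Hg] : forall k : nat, exists g : 'rV[R]_d * 'M[R]_d * 'rV[R]_d * R,
    [/\ `|p - g.1.1.1| <= k.+1%:R^-1, aut Om g.1.1.2 g.1.2,
     g.1.1.1 *m g.1.1.2 + g.1.2 = p0, e *m g.1.1.2 = g.2 *: e & l0 <= g.2 <= 1].
  move=> k; have k0 : 0 < k.+1%:R^-1 :> R by rewrite invr_gt0.
  have [A [p' [fA cA cp' np' pp']]] := contraction_ex oOm scOm Om0 OmT cK KOm qhK cp np k0.
  have [B [b [l [? ? ? ?]]]] := contraction_fixpoints_equiv f0 c0 l00 eA0 fA cA.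
  by exists (p', B, b, l).
pose q' k := (g k).1.1.1; pose A k := (g k).1.1.2; pose b k := (g k).1.2; pose l k := (g k).2.
have qp : q' @ omega --> p by apply: cvg_invn => k; have [] := Hg k.
have autA k : aut Om (A k) (b k) by have [] := Hg k.
have qE k : q' k *m A k + b k = p0 by have [] := Hg k.
have eA k : e *m A k = l k *: e by have [] := Hg k.
have l1 k : l0 <= l k <= 1 by have [] := Hg k.
have [r lr] : exists r : R, l @ omega --> r.
  apply: (@real_cvg_omega _ _ 1); apply: (@omega_ge _ 0) => m _.
  have /andP[h1 h2] := l1 m.
  by rewrite ger0_norm// (le_trans _ h1)// ltW.
have r2 : l0 <= r.
  by apply: (omega_lim_le (@cvg_cstr _ _ omega _ l0) lr) => k; have /andP[] := l1 k.
have [A' [b' [autA' AA bb']]] : exists A' b', [/\ aut Om A' b', A @ omega --> A' & b @ omega --> b'].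
  apply: (@aut_limit _ _ _ oOm scOm Om0 OmT A b (fun k => q' k + 1 *: e) (p + 1 *: e) (p0 + r *: e)) => //.
  - by apply: cvg_addm => //; exact: cvg_cstm.
  - exact: boundary_recession.
  - rewrite (_ : (fun m => _) = fun m => p0 + l m *: e); last first.
      by apply/funext => m; rewrite scale1r mulmxDl eA addrAC qE.
    by apply: cvg_addm; [exact: cvg_cstm|apply: cvg_scalem => //; exact: cvg_cstm].
  - by apply: boundary_recession => //; exact: lt_le_trans r2.
exists A', b'; split => //; apply: (@cvg_mx_unique _ _ _ (fun k => q' k *m A k + b k)).
  by apply: cvg_addm => //; exact: cvg_mulmx.
rewrite (_ : (fun m => _) = fun=> p0); last by apply/funext.
exact: cvg_cstm.
Qed.

(** High powers of the contraction shrink [v] until [p0 + e] shifted by its image is in [Om];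
    pulling back restores [v] and stretches [e] by an inverse power of [l0]. *)
Lemma vertical_line A0 p0 v : fixaut Om A0 p0 -> contracting A0 ->
  exists s : R, Om (p0 + v + s *: e).
Proof.
move=> f0 c0; have [cp0 np0] := contracting_fixpoint oOm Om0 OmT c0 f0.
have [l0 l00 eA0] := aut_eigen f0.
have Ome : Om (p0 + 1 *: e) by exact: boundary_recession.
have : (fun k => (p0 + 1 *: e) + v *m A0 ^+ k) @ omega --> p0 + 1 *: e.
  by apply: cvg_add0; exact: contracting_cvg0.
move=> /(omega_open oOm Ome) /omega_ex [k Hk].
exists (l0 ^+ k)^-1; rewrite -addrA; apply/(fixautE (fixaut_pow k f0)).
rewrite mulmxDl -scalemxAl (eigen_pow _ eA0) scalerA mulVf; last first.
  by rewrite gt_eqF// exprn_gt0.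
by rewrite [_ + 1 *: e]addrC addrA.
Qed.

End Transitivity.

(** * The domain as an epigraph *)

Definition strictly_convex_fun (R : realType) n (f : 'rV[R]_n -> R) :=
  forall x y (t : R), x != y -> 0 < t < 1 ->
  f ((1 - t) *: x + t *: y) < (1 - t) * f x + t * f y.

Definition omega_continuous (R : realType) n (f : 'rV[R]_n -> R) :=
  forall (u : nat -> 'rV[R]_n) (x : 'rV[R]_n), u @ omega --> x ->
  (fun k => f (u k)) @ omega --> f x.

(* [x |-> x A + b] lifts to an affine symmetry of the epigraph of [f] that
   scales the vertical direction by [l]. *)
Definition graph_sym (R : realType) n (f : 'rV[R]_n -> R) (A : 'M[R]_n) (b : 'rV[R]_n) (l : R) :=
  [/\ A \in unitmx, 0 < l &
    exists (m : 'cV[R]_n) (c : R), forall x, f (x *m A + b) = l * f x + (x *m m) 0 0 + c].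

Lemma complete_basis (R : realType) n (e : 'rV[R]_n.+1) : e != 0 ->
  exists (E : 'M[R]_(n, n.+1)) (tau : 'cV[R]_n.+1) (P : 'M[R]_(n.+1, n)),
  [/\ e *m tau = 1%:M, e *m P = 0, E *m tau = 0, E *m P = 1%:M &
      tau *m e + P *m E = 1%:M].
Proof.
move=> e0; have [j ej] : exists j, e 0 j != 0.
  apply: contrapT => /forallNP H; case/negP: e0; apply/eqP/rowP => j; rewrite mxE.
  by apply/eqP; apply: contrapT => /negP; exact: H.
pose E : 'M[R]_(n, n.+1) := \matrix_(i < n) delta_mx 0 (lift j i).
have wEj (w : 'rV[R]_n) : (w *m E) 0 j = 0.
  rewrite mxE big1// => i _; rewrite !mxE eqxx /=.
  by rewrite (negbTE (neq_lift _ _)) mulr0.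
have wEl (w : 'rV[R]_n) i : (w *m E) 0 (lift j i) = w 0 i.
  rewrite mxE (bigD1 i)//= big1 ?addr0 => [|k ki]; first by rewrite !mxE !eqxx mulr1.
  by rewrite !mxE eqxx /= (inj_eq lift_inj) eq_sym (negbTE ki) mulr0.
pose S : 'M[R]_(1 + n) := col_mx e E.
have uS : S \in unitmx.
  rewrite -row_free_unit; apply/inj_row_free => v.
  rewrite -[v]hsubmxK mul_row_col; set a := lsubmx v; set w := rsubmx v => H.
  have a0 : a = 0.
    have := congr1 (fun M : 'rV[R]_n.+1 => M 0 j) H.
    rewrite [LHS]mxE wEj addr0 [RHS]mxE mxE big_ord1 => /eqP.
    rewrite mulf_eq0 (negbTE ej) orbF => /eqP a00.
    by apply/matrixP => x y; rewrite !ord1 a00 mxE.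
  have w0 : w = 0.
    move: H; rewrite a0 mul0mx add0r => H; apply/rowP => i.
    by rewrite -wEl H !mxE.
  by rewrite a0 w0 row_mx0.
have H1 := mulmxV uS; have H2 := mulVmx uS.
move: H1 H2; rewrite -[invmx S]hsubmxK; set tau := lsubmx _; set P := rsubmx _.
rewrite mul_col_row mul_row_col .
rewrite scalar_mx_block => /eq_block_mx [? ? ? ?] ?.
by exists E, tau, P.
Qed.

Section Coordinates.
Variables (R : realType) (n : nat) (Om : set 'rV[R]_n.+1).
Hypothesis oOm : open Om.
Hypothesis scOm : strictly_convex Om.
Hypothesis Om0 : Om !=set0.
Hypothesis OmT : Om <> setT.
Variable K : set 'rV[R]_n.+1.
Hypothesis cK : compact K.
Hypothesis KOm : K `<=` Om.
Hypothesis qhK : forall x, Om x -> exists y A b, [/\ K y, aut Om A b & x = y *m A + b].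

Let cOm : convex_dom Om := scOm.1.

(** A section unbounded below would put the whole vertical line in the closure, since [e] is a
    recession direction. *)
Lemma vertical_bounded_below (x e : 'rV[R]_n.+1) : recession Om e -> e != 0 ->
  has_lbound [set s : R | Om (x + s *: e)].
Proof.
move=> re e0; apply: contrapT => H; case/negP: e0; apply/eqP.
apply: (@no_line _ _ _ oOm scOm Om0 OmT x) => s.
have /existsNP [t /not_implyP [Ot /negP]] : ~ lbound [set s : R | Om (x + s *: e)] s.
  by move=> lb; apply: H; exists s.
rewrite -ltNge => ts.
have -> : x + s *: e = x + t *: e + (s - t) *: e by rewrite scalerBl addrA addrAC addrK.
by apply: (recessionP re); [exact: subset_closure|rewrite subr_ge0 ltW].
Qed.

Lemma graph_form : exists (p e : 'rV[R]_n.+1) (E : 'M[R]_(n, n.+1)) (tau : 'cV[R]_n.+1)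
    (P : 'M[R]_(n.+1, n)) (f : 'rV[R]_n -> R),
  [/\ [/\ e *m tau = 1%:M, e *m P = 0, E *m tau = 0, E *m P = 1%:M &
      tau *m e + P *m E = 1%:M],
    forall x (s : R), Om (p + x *m E + s *: e) <-> f x < s,
    strictly_convex_fun f /\ omega_continuous f,
    forall y, exists A b l, graph_sym f A b l /\ y *m A + b = 0 &
    exists A l, [/\ graph_sym f A 0 l, l < 1 &
      forall x : 'rV[R]_n, (fun k => x *m A ^+ k) @ omega --> (0 : 'rV[R]_n)]].
Proof.
have [e re e0] := recession_ex oOm scOm Om0 OmT cK KOm qhK.
have [p [A0 [f0 c0 trans]]] := boundary_transitive oOm scOm Om0 OmT cK KOm qhK re e0.
have [E [tau [P [eT eP ET EP TP]]]] := complete_basis e0.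
pose S x := [set s : R | Om (p + x *m E + s *: e)].
have S0 x : S x !=set0.
  have [s Hs] := vertical_line oOm scOm Om0 OmT cK KOm qhK re e0 (x *m E) f0 c0.
  by exists s.
have Slb x : has_lbound (S x) by exact: vertical_bounded_below.
have Sinf x : has_inf (S x) by split.
pose f x := inf (S x).
have Sup x s t : S x s -> s <= t -> S x t.
  rewrite le_eqVlt => Ss /predU1P[<-//|st]; rewrite /S /=.
  have -> : p + x *m E + t *: e = (p + x *m E + s *: e) + (t - s) *: e.
    by rewrite scalerBl [RHS]addrA [RHS]addrAC addrK.
  apply: (boundary_recession oOm scOm); [exact: subset_closure|exact: re|exact: e0|].
  by rewrite subr_gt0.
(* The inequality is strict because the infimum is not attained, [Om] being open. *)
have fP x s : Om (p + x *m E + s *: e) <-> f x < s.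
  split=> [Os|fs].
    have [r r0 Hr] := open_ball oOm Os.
    have ne : 0 < `|e| by rewrite normr_gt0.
    have : S x (s - r / `|e|).
      rewrite /S /= scalerBl addrA; apply: Hr.
      by rewrite normrN mx_normZ gtr0_norm ?divr_gt0// mulfVK ?gt_eqF.
    move=> /(ge_inf (Slb x)) H; apply: le_lt_trans H _.
    by rewrite ltrBlDr ltrDl divr_gt0.
  have fs0 : 0 < s - f x by rewrite subr_gt0.
  have [t St tf] := inf_adherent fs0 (Sinf x).
  by apply: Sup St _; move: tf; rewrite -/(f x) addrC subrK => /ltW.
have clf x s : closure Om (p + x *m E + s *: e) <-> f x <= s.
  split=> [cs|fs].
    apply/ler_addgt0Pl => eps eps0; apply/ltW/fP.
    rewrite scalerDl [eps *: e + _]addrC addrA.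
    by apply: (boundary_recession oOm scOm cs re e0).
  apply: (@omega_closure _ _ _ (fun k => (p + x *m E + s *: e) + k.+1%:R^-1 *: e)).
    apply: cvg_add0; rewrite -(scale0r e).
    by apply: cvg_scalem; [exact: invn_cvg0|exact: cvg_cstm].
  apply: (@omega_ge _ 0) => k _; apply: subset_closure.
  by rewrite -addrA -scalerDl; apply/fP; rewrite ltr_pwDr// invr_gt0.
have [cp np] := contracting_fixpoint oOm Om0 OmT c0 f0.
have fp : f 0 = 0.
  apply/eqP; rewrite eq_le; apply/andP; split.
    by apply/clf; rewrite mul0mx scale0r !addr0.
  by rewrite leNgt; apply/negP => /fP; rewrite mul0mx scale0r !addr0.
have decomp (z : 'rV[R]_n.+1) : z = (z *m P) *m E + (z *m tau) 0 0 *: e.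
  rewrite -{1}[z]mulmx1 -TP mulmxDr addrC !mulmxA; congr (_ + _).
  by rewrite {1}[z *m tau]mx11_scalar mul_scalar_mx.
(* Since [e] is an eigenvector, the automorphism descends to the base with linear part
   [E *m A *m P]; its component along [e] gives the affine correction of [f]. *)
have symA A b : aut Om A b -> exists l, [/\ 0 < l, e *m A = l *: e &
    graph_sym f (E *m A *m P) ((p *m A + b - p) *m P) l].
  move=> autA; have [l l0 eA] := aut_eigen oOm scOm Om0 OmT cK KOm qhK re e0 autA.
  have [uA HA] := autA.
  exists l; split => //; split => //.
    rewrite -row_free_unit; apply/inj_row_free => v; rewrite !mulmxA => H.
    have := decomp (v *m E *m A); rewrite H mul0mx add0r; set mu := (_ 0 0) => vE.
    have : v *m E = (mu / l) *: e.
      apply: (can_inj (mulmxK uA)); rewrite vE -scalemxAl eA scalerA mulfVK//.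
      by rewrite gt_eqF.
    by move=> /(congr1 (fun M => M *m P)); rewrite -mulmxA EP mulmx1 -scalemxAl eP scaler0.
  exists (E *m A *m tau), (((p *m A + b - p) *m tau) 0 0) => x.
  (* An equivalence for all heights [s]: equating the thresholds of its two sides yields the
     equation for [f]. *)
  have key s : f x < s <-> f (x *m (E *m A *m P) + (p *m A + b - p) *m P) <
      l * s + (x *m (E *m A *m tau)) 0 0 + ((p *m A + b - p) *m tau) 0 0.
    rewrite -!fP (HA (p + x *m E + s *: e)); move: Om => O.
    suff -> : (p + x *m E + s *: e) *m A + b =
      p + (x *m (E *m A *m P) + (p *m A + b - p) *m P) *m E +
      (l * s + (x *m (E *m A *m tau)) 0 0 + ((p *m A + b - p) *m tau) 0 0) *: e by [].
    set u := p *m A + b - p.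
    have -> : (p + x *m E + s *: e) *m A + b = p + u + x *m E *m A + (l * s) *: e.
      rewrite !mulmxDl -scalemxAl eA scalerA /u.
      move: (x *m E *m A) (p *m A) => a1 a2.
      by apply/rowP => i; rewrite !mxE; ring.
    rewrite [(x *m _ + u *m P) *m E]mulmxDl !mulmxA.
    have := decomp u; have := decomp (x *m E *m A).
    move: (u *m P *m E) ((u *m tau) 0 0) => u1 u2.
    move: (x *m E *m A *m P *m E) ((x *m E *m A *m tau) 0 0) => c1 c2 -> ->.
    by apply/rowP => i; rewrite !mxE; ring.
  set c1 := (x *m _) 0 0 in key *; set c2 := (_ 0 0) in key *; set F := f (_ + _) in key *.
  apply/eqP; rewrite eq_le; apply/andP; split.
    rewrite leNgt; apply/negP => lt.
    have /key : f x < (F - c1 - c2) / l by rewrite ltr_pdivlMr// mulrC; lra.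
    by rewrite mulrC mulfVK ?gt_eqF//; lra.
  rewrite leNgt; apply/negP => lt.
  by have /key : F < l * f x + c1 + c2 by []; rewrite ltxx.
exists p, e, E, tau, P, f; split => //.
- split.
    move=> x y t xy t01; apply/fP.
    have c1 : closure Om (p + x *m E + f x *: e) by apply/clf.
    have c2 : closure Om (p + y *m E + f y *: e) by apply/clf.
    have : p + x *m E + f x *: e != p + y *m E + f y *: e.
      apply: contra xy => /eqP /(congr1 (fun v => (v - p) *m P)).
      rewrite ![p + _ + _]addrC ![p + _]addrC !addrA !addrK !mulmxDl -!scalemxAl eP !scaler0 !add0r.
      by rewrite -!mulmxA EP !mulmx1 => ->.
    move=> ne; have := segment_strict oOm scOm c1 c2 ne t01.
    congr Om; rewrite !mulmxDl -!scalemxAl; move: (x *m E) (y *m E) => a c.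
    by apply/rowP => i; rewrite !mxE; ring.
  move=> u x ux; apply/cvgrPdist_le => eps eps0.
  have up : \forall k \near omega, f (u k) < f x + eps.
    have : Om (p + x *m E + (f x + eps) *: e) by apply/fP; rewrite ltrDl.
    move=> Ox; have : \forall k \near omega, Om (p + u k *m E + (f x + eps) *: e).
      apply: (omega_open oOm Ox); apply: cvg_addm; last exact: cvg_cstm.
      apply: cvg_addm; first exact: cvg_cstm.
      by apply: cvg_mulmx; [exact: ux|exact: cvg_cstm].
    by apply: filterS => k /fP.
  have down : \forall k \near omega, f x - eps < f (u k).
    have oC : open (~` closure Om) by apply: closed_openC; exact: closed_closure.
    have Cx : (~` closure Om) (p + x *m E + (f x - eps) *: e).
      by move=> /clf; lra.
    have : \forall k \near omega, (~` closure Om) (p + u k *m E + (f x - eps) *: e).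
      apply: (omega_open oC Cx); apply: cvg_addm; last exact: cvg_cstm.
      apply: cvg_addm; first exact: cvg_cstm.
      by apply: cvg_mulmx; [exact: ux|exact: cvg_cstm].
    apply: filterS => k H; rewrite ltNge; apply/negP => H'; apply: H.
    exact/clf.
  apply: filterS2 up down => k h1 h2; rewrite ler_norml; apply/andP; split; lra.
(* Boundary transitivity moves the graph point above [y] to [p], which lies above the origin. *)
- move=> y; have cy : closure Om (p + y *m E + f y *: e) by apply/clf.
  have ny : ~ Om (p + y *m E + f y *: e) by move=> /fP; rewrite ltxx.
  have [A [b [autA H]]] := trans _ cy ny.
  have [l [l0 eA HS]] := symA _ _ autA.
  exists (E *m A *m P), ((p *m A + b - p) *m P), l; split => //.
  rewrite !mulmxA -mulmxDl.
  have -> : y *m E *m A + (p *m A + b - p) = - (f y *: (e *m A)).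
    move: H; rewrite !mulmxDl -scalemxAl.
    move: (y *m E *m A) (p *m A) (e *m A) => a1 a2 a3 <-.
    by apply/rowP => i; rewrite !mxE; ring.
  by rewrite eA scalerA mulNmx -scalemxAl eP scaler0 oppr0.
- have [l [l0 eA HS]] := symA _ _ f0.
  exists (E *m A0 *m P), l; split.
  + by move: HS; rewrite [p *m A0 + _]addrC subrK subrr mul0mx.
  + by have := contracting_eigen e0 c0 l0 eA; lra.
  move=> x; rewrite (_ : (fun k => _) = fun k => x *m E *m A0 ^+ k *m P); last first.
    apply/funext => k.
    (* Taking powers commutes with passing to the base, because [A0] preserves the line of [e],
       which [P] annihilates. *)
    have -> : (E *m A0 *m P) ^+ k = E *m A0 ^+ k *m P; last by rewrite !mulmxA.
    elim: k => [|k IH]; first by rewrite !expr0 mulmx1.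
    rewrite [in LHS]exprSr IH -[LHS]/(_ *m (E *m A0 *m P)).
    have PE : P *m E = 1%:M - tau *m e by rewrite -TP addrC addKr.
    have PEA : P *m (E *m A0 *m P) = A0 *m P.
      rewrite !mulmxA PE !mulmxBl mul1mx -[tau *m e *m A0]mulmxA eA -scalemxAr.
      by rewrite -scalemxAl -[_ *m e *m P]mulmxA eP mulmx0 scaler0 subr0.
    by rewrite -mulmxA PEA exprSr -[_ ^+ _ * A0]/(_ *m A0) !mulmxA.
  rewrite -(mul0mx _ P); apply: cvg_mulmx; last exact: cvg_cstm.
  exact: contracting_cvg0.
Qed.

End Coordinates.

(** * Touching paraboloids *)

Definition dot (R : realType) n (x y : 'rV[R]_n) : R := (x *m y^T) 0 0.
Definition nsq (R : realType) n (x : 'rV[R]_n) : R := dot x x.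
Definition lin (R : realType) n (m : 'cV[R]_n) (x : 'rV[R]_n) : R := (x *m m) 0 0.

Section SquaredNorm.
Variables (R : realType) (n : nat).
Implicit Types (x y : 'rV[R]_n) (m : 'cV[R]_n).

Lemma nsqE x : nsq x = \sum_i x 0 i ^+ 2.
Proof. by rewrite /nsq /dot mxE; apply: eq_bigr => i _; rewrite mxE expr2. Qed.

Lemma nsq_ge0 x : 0 <= nsq x.
Proof. by rewrite nsqE sumr_ge0// => i _; exact: sqr_ge0. Qed.

Lemma dotC x y : dot x y = dot y x.
Proof. by rewrite /dot !mxE; apply: eq_bigr => i _; rewrite !mxE mulrC. Qed.

Lemma dotDl x y z : dot (x + y) z = dot x z + dot y z.
Proof. by rewrite /dot mulmxDl mxE. Qed.

Lemma dotDr x y z : dot z (x + y) = dot z x + dot z y.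
Proof. by rewrite dotC dotDl !(dotC z). Qed.

Lemma dotZl a x y : dot (a *: x) y = a * dot x y.
Proof. by rewrite /dot -scalemxAl mxE. Qed.

Lemma dotZr a x y : dot x (a *: y) = a * dot x y.
Proof. by rewrite dotC dotZl dotC. Qed.

Lemma nsqZ a x : nsq (a *: x) = a ^+ 2 * nsq x.
Proof. by rewrite /nsq dotZl dotZr expr2 mulrA. Qed.

Lemma nsqD x y : nsq (x + y) = nsq x + 2 * dot x y + nsq y.
Proof. by rewrite /nsq dotDl !dotDr (dotC y x); ring. Qed.

Lemma nsqB x y : nsq (x - y) = nsq x - 2 * dot x y + nsq y.
Proof. by rewrite nsqD -[- y]scaleN1r dotZr nsqZ; ring. Qed.

Lemma nsq0 : nsq (0 : 'rV[R]_n) = 0.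
Proof. by rewrite -(scale0r 0) nsqZ expr0n mul0r. Qed.

Lemma nsqN x : nsq (- x) = nsq x.
Proof. by rewrite -scaleN1r nsqZ sqrrN expr1n mul1r. Qed.

Lemma mx_norm_nsq x : `|x| ^+ 2 <= nsq x.
Proof.
have H i : `|x 0 i| <= Num.sqrt (nsq x).
  rewrite -sqrtr_sqr ler_wsqrtr// nsqE (bigD1 i)//= lerDl sumr_ge0// => j _.
  exact: sqr_ge0.
have h : `|x| <= Num.sqrt (nsq x).
  by apply: mx_norm_leP => [|i j]; [exact: sqrtr_ge0|rewrite ord1].
by rewrite -[leRHS](sqr_sqrtr (nsq_ge0 x)) lerXn2r ?nnegrE ?sqrtr_ge0.
Qed.

Lemma nsq_mx_norm x : nsq x <= n%:R * `|x| ^+ 2.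
Proof.
rewrite nsqE [leRHS](_ : _ = \sum_(i < n) `|x| ^+ 2); last first.
  by rewrite sumr_const card_ord mulr_natl.
apply: ler_sum => i _; rewrite -[x 0 i ^+ 2]ger0_norm ?sqr_ge0// normrX.
by rewrite lerXn2r ?nnegrE// mx_norm_coord.
Qed.

Lemma nsq_eq0 x : nsq x = 0 -> x = 0.
Proof.
move=> x0; apply/eqP; rewrite -normr_eq0 -sqrf_eq0 eq_le sqr_ge0 andbT -x0.
exact: mx_norm_nsq.
Qed.

Lemma nsq_gt0 x : x != 0 -> 0 < nsq x.
Proof.
move=> x0; rewrite lt_neqAle nsq_ge0 andbT eq_sym.
by apply: contra x0 => /eqP/nsq_eq0 ->.
Qed.

Lemma linD m x y : lin m (x + y) = lin m x + lin m y.
Proof. by rewrite /lin mulmxDl mxE. Qed.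

Lemma linZ m a x : lin m (a *: x) = a * lin m x.
Proof. by rewrite /lin -scalemxAl mxE. Qed.

Lemma linDm m m' x : lin (m + m') x = lin m x + lin m' x.
Proof. by rewrite /lin mulmxDr mxE. Qed.

Lemma linZm a m x : lin (a *: m) x = a * lin m x.
Proof. by rewrite /lin -scalemxAr mxE. Qed.

Lemma linBm m m' x : lin (m - m') x = lin m x - lin m' x.
Proof. by rewrite linDm -[- m']scaleN1r linZm mulN1r. Qed.

Lemma linN m x : lin m (- x) = - lin m x.
Proof. by rewrite -scaleN1r linZ mulN1r. Qed.

Lemma lin_eq0 m : (forall x, lin m x = 0) -> m = 0.
Proof.
move=> H; apply/matrixP => i j; rewrite ord1 mxE -(H (delta_mx 0 i)) /lin -rowE.
by rewrite mxE.
Qed.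

Lemma lin_tr x y : lin (x^T) y = dot y x.
Proof. by []. Qed.

Lemma cvg_lin (u : nat -> 'rV[R]_n) (x : 'rV[R]_n) m : u @ omega --> x ->
  (fun k => lin m (u k)) @ omega --> lin m x.
Proof.
move=> ux; have H : (fun k => u k *m m) @ omega --> x *m m.
  by apply: cvg_mulmx; [exact: ux|exact: cvg_cstm].
exact: (@cvg_coord R _ _ _ _ _ _ _ 0 0 H).
Qed.

Lemma cvg_nsq (u : nat -> 'rV[R]_n) (x : 'rV[R]_n) : u @ omega --> x ->
  (fun k => nsq (u k)) @ omega --> nsq x.
Proof.
move=> ux; have H : (fun k => u k *m (u k)^T) @ omega --> x *m x^T.
  by apply: cvg_mulmx; [exact: ux|apply: cvg_trmx; exact: ux].
exact: (@cvg_coord R _ _ _ _ _ _ _ 0 0 H).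
Qed.

Lemma omega_max (g : 'rV[R]_n -> R) (D : set 'rV[R]_n) x0 (M : R) : D x0 ->
  (forall x, D x -> `|x| <= M) ->
  (forall (u : nat -> 'rV[R]_n) (x : 'rV[R]_n), u @ omega --> x -> (forall k, D (u k)) -> D x) ->
  omega_continuous g -> exists2 x, D x & forall y, D y -> g y <= g x.
Proof.
move=> Dx0 DM Dcl cg.
have lim (u : nat -> 'rV[R]_n) : (forall k, D (u k)) -> exists2 x, D x &
    (fun k => g (u k)) @ omega --> g x.
  move=> Du; have [x ux] : exists x : 'rV[R]_n, u @ omega --> x.
    by apply: (@mx_cvg_omega _ _ _ _ M); apply: (@omega_ge _ 0) => k _; exact: DM.
  by exists x; [exact: Dcl ux _|exact: cg].
pose V := [set g x | x in D].
have Vub : has_ubound V.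
  apply: contrapT => nub.
  have /choice [u Hu] : forall k : nat, exists x, D x /\ k%:R < g x.
    move=> k; have /existsNP [t /not_implyP [[x Dx <-] /negP]] : ~ ubound V k%:R.
      by move=> ub; apply: nub; exists k%:R.
    by rewrite -ltNge; exists x.
  have [x Dx gx] := lim u (fun k => (Hu k).1).
  have /cvgrPdist_le /(_ 1 ltr01) H1 := gx.
  have H2 : \forall k \near omega, (Num.bound (`|g x| + 1) <= k)%N.
    by apply: (@omega_ge _ (Num.bound (`|g x| + 1))).
  have [k [gk ak]] := omega_ex (omega_and H1 H2).
  have h1 : `|g x| + 1 < k%:R.
    have p0 : 0 <= `|g x| + 1 by rewrite addr_ge0.
    by rewrite (lt_le_trans (archi_boundP p0))// ler_nat.
  have h2 := (Hu k).2; move: gk; rewrite ler_norml => /andP[h3 _].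
  have := ler_norm (g x); lra.
have supV : has_sup V by split => //; exists (g x0); exists x0.
have /choice [u Hu] : forall k : nat, exists x, D x /\ sup V - k.+1%:R^-1 <= g x.
  move=> k; have k0 : 0 < k.+1%:R^-1 :> R by rewrite invr_gt0.
  by have [_ [x Dx <-] /ltW H] := sup_adherent k0 supV; exists x.
have [x Dx gx] := lim u (fun k => (Hu k).1).
exists x => // y Dy; apply: (@le_trans _ _ (sup V)).
  by apply: ub_le_sup => //; exists y.
apply: (@omega_lim_le _ (fun k => sup V - k.+1%:R^-1) (fun k => g (u k))) => //.
- have := @cvgB R R nat omega _ (fun=> sup V : R) (fun k : nat => k.+1%:R^-1 : R) (sup V) 0
    (cvg_cst _) (@invn_cvg0 R).
  by rewrite subr0; exact.
- by move=> k; exact: (Hu k).2.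
Qed.

End SquaredNorm.

Section SquaredNorm2.
Variables (R : realType) (n : nat).
Implicit Types (x y p v : 'rV[R]_n) (m : 'cV[R]_n).

Lemma nsq_mul (p : nat) (A : 'M[R]_(n, p)) : exists2 k : R, 0 < k & forall x, nsq (x *m A) <= k * nsq x.
Proof.
exists (p%:R * (n%:R * `|A|) ^+ 2 + 1); first by rewrite ltr_wpDl// mulr_ge0// sqr_ge0.
move=> x; apply: le_trans (nsq_mx_norm _) _.
have xA : `|x *m A| ^+ 2 <= (n%:R * `|A|) ^+ 2 * nsq x.
  apply: (@le_trans _ _ ((n%:R * `|A|) ^+ 2 * `|x| ^+ 2)).
    rewrite -exprMn lerXn2r ?nnegrE ?mulr_ge0//.
    by rewrite (le_trans (mx_norm_mul _ _))// mulrAC.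
  by rewrite ler_wpM2l ?sqr_ge0// mx_norm_nsq.
apply: (@le_trans _ _ (p%:R * ((n%:R * `|A|) ^+ 2 * nsq x))); first by rewrite ler_wpM2l.
by rewrite mulrA mulrDl lerDl mul1r nsq_ge0.
Qed.

(** With [eta] half the gap from [nsq p] to 1, the weighted inequality [2 * dot p v <= eta * nsq p +
    eta^-1 * nsq v] costs at most [eta] in its first term, and the radius is chosen so that all
    terms in [nsq v] cost at most [eta] more. *)
Lemma nsq_ball_interior p : nsq p < 1 -> exists2 r : R, 0 < r & forall v, nsq v <= r -> nsq (p + v) <= 1.
Proof.
set a := nsq p => a1; have a0 : 0 <= a := nsq_ge0 p.
pose eta := (1 - a) / 2.
have e0 : 0 < eta by rewrite divr_gt0// subr_gt0.
exists (eta / (1 + eta^-1)).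
  by rewrite divr_gt0// addr_gt0// invr_gt0.
move=> v vr; rewrite nsqD -/a.
have h1 : 2 * dot p v <= eta * a + eta^-1 * nsq v.
  have := nsq_ge0 (eta *: p - v); rewrite nsqD nsqN nsqZ -scaleN1r dotZl dotZr -/a => h.
  have h' : eta * a - 2 * dot p v + eta^-1 * nsq v =
      eta^-1 * (eta ^+ 2 * a + 2 * (eta * (-1 * dot p v)) + nsq v).
    by field; rewrite gt_eqF.
  have : 0 <= eta * a - 2 * dot p v + eta^-1 * nsq v.
    by rewrite h' mulr_ge0// invr_ge0 ltW.
  clear; clearbody eta; lra.
have h2 : (1 + eta^-1) * nsq v <= eta.
  by move: vr; rewrite ler_pdivlMr 1?mulrC// addr_gt0// invr_gt0.
have h3 : eta * a <= eta * 1 by rewrite ler_pM2l// ltW.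
have h4 : eta = (1 - a) / 2 by [].
move: h2; rewrite mulrDl mul1r => h2; clearbody eta; lra.
Qed.

Lemma le_small (a b c t0 : R) : 0 < t0 -> (forall t, 0 < t <= t0 -> a <= b + t * c) -> a <= b.
Proof.
move=> t00 H; apply/ler_addgt0Pr => eps eps0.
have c1 : 0 < `|c| + 1 by rewrite ltr_wpDl.
pose t := Num.min t0 (eps / (`|c| + 1)).
have t_gt0 : 0 < t by rewrite lt_min t00 divr_gt0.
apply: (le_trans (H t _)); first by rewrite t_gt0 ge_min lexx.
rewrite lerD2l (le_trans (ler_norm _))// normrM (gtr0_norm t_gt0).
apply: (@le_trans _ _ (t * (`|c| + 1))); first by rewrite ler_pM2l// lerDl.
by rewrite -ler_pdivlMr// ge_min lexx orbT.
Qed.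

(** At [t v] the linear side is of order [t] and its bound of order [t ^ 2]. As [t] tends to zero
    this gives [lin m v <= 0] for every [v], hence also for [- v]. *)
Lemma lin_small m (C r : R) : 0 < r -> (forall v, nsq v <= r -> lin m v <= C * nsq v) -> m = 0.
Proof.
move=> r0 H.
have H' v : lin m v <= 0.
  have v1 : 0 < nsq v + 1 by rewrite ltr_wpDl// nsq_ge0.
  apply: (@le_small _ _ (C * nsq v) (Num.min 1 (r / (nsq v + 1)))).
    by rewrite lt_min ltr01 divr_gt0.
  move=> t /andP[t0]; rewrite le_min => /andP[t1 tr].
  have := H (t *: v); rewrite nsqZ linZ => H1.
  have : t ^+ 2 * nsq v <= r.
    apply: (@le_trans _ _ (t * (nsq v + 1))); last by rewrite -ler_pdivlMr.
    rewrite expr2 -mulrA ler_pM2l//; apply: (@le_trans _ _ (1 * nsq v)).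
      by rewrite ler_wpM2r// nsq_ge0.
    by rewrite mul1r lerDl.
  move=> /H1 H2; rewrite add0r -(ler_pM2l t0) (le_trans H2)//.
  by rewrite expr2 le_eqVlt; apply/orP; left; apply/eqP; ring.
apply: lin_eq0 => v; apply/eqP; rewrite eq_le H' /=.
by have := H' (- v); rewrite linN oppr_le0.
Qed.

End SquaredNorm2.

Section GraphSym.
Variables (R : realType) (n : nat) (f : 'rV[R]_n -> R).
Implicit Types (x y v : 'rV[R]_n) (A : 'M[R]_n).

Lemma graph_sym_inv A b l : graph_sym f A b l ->
  graph_sym f (invmx A) (- b *m invmx A) l^-1.
Proof.
move=> [uA l0 [m [c H]]]; split; [by rewrite unitmx_inv|by rewrite invr_gt0|].
exists (- l^-1 *: (invmx A *m m)), (- l^-1 * (c - (b *m invmx A *m m) 0 0)) => x.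
have := H (x *m invmx A + - b *m invmx A).
rewrite -mulmxDl mulmxKV// subrK mulmxBl !mulmxBl => ->.
rewrite -scalemxAr mulmxA !mxE.
set u := f _; set p1 := \sum_j _; set p2 := \sum_j _.
by field; rewrite gt_eqF.
Qed.

Lemma graph_sym_comp A b l A' b' l' : graph_sym f A b l -> graph_sym f A' b' l' ->
  graph_sym f (A *m A') (b *m A' + b') (l * l').
Proof.
move=> [uA l0 [m [c H]]] [uA' l'0 [m' [c' H']]]; split; [by rewrite unitmx_mul uA|by rewrite mulr_gt0|].
exists (l' *: m + A *m m'), (l' * c + (b *m m') 0 0 + c') => x.
have := H' (x *m A + b); rewrite H mulmxDl mulmxA addrA => ->.
by rewrite mulmxDl mulmxDr -scalemxAr mulmxA !mxE; ring.
Qed.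

End GraphSym.

(** * Touching paraboloids, the gradient and its Bregman divergence *)

Section Quadratic.
Variables (R : realType) (n : nat) (f : 'rV[R]_n -> R).
Hypothesis scf : strictly_convex_fun f.
Hypothesis contf : omega_continuous f.
Hypothesis trans : forall y, exists A b l, graph_sym f A b l /\ y *m A + b = 0.
Implicit Types (x y v w : 'rV[R]_n) (A : 'M[R]_n).

Lemma graph_sym_transitive y z : exists A b l, graph_sym f A b l /\ y *m A + b = z.
Proof.
have [A [b [l [H H0]]]] := trans y; have [A' [b' [l' [H' H0']]]] := trans z.
exists (A *m invmx A'), (b *m invmx A' + (- b' *m invmx A')), (l * l'^-1); split.
  exact: graph_sym_comp H (graph_sym_inv H').
have [uA' _ _] := H'.
rewrite mulmxA addrA -[y *m A *m _ + _]mulmxDl H0 mul0mx add0r.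
have -> : b' = - (z *m A') by apply/eqP; rewrite -addr_eq0 addrC H0'.
by rewrite opprK mulmxK.
Qed.

Lemma strictly_convex_fun_le x y (t : R) : 0 <= t <= 1 ->
  f ((1 - t) *: x + t *: y) <= (1 - t) * f x + t * f y.
Proof.
move=> /andP[]; rewrite le_eqVlt => /predU1P[<- _|t0].
  by rewrite subr0 scale1r scale0r mul1r mul0r !addr0.
rewrite le_eqVlt => /predU1P[->|t1].
  by rewrite subrr scale1r scale0r mul1r mul0r !add0r.
have [->|xy] := eqVneq x y; last by apply: ltW; apply: scf => //; rewrite t0.
by rewrite -scalerDl -mulrDl subrK scale1r mul1r.
Qed.

(** A paraboloid with slope [m] at [y] that lies above the graph near [y] and meets it there. *)
Definition upper_touch y m (C r : R) :=
  0 < r /\ forall v, nsq v <= r -> f (y + v) <= f y + lin m v + C * nsq v.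

Lemma unit_ball_norm x : nsq x <= 1 -> `|x| <= 1.
Proof.
move=> x1; have := le_trans (mx_norm_nsq x) x1.
by rewrite -[leRHS](expr1n _ 2) ler_sqr ?nnegrE.
Qed.

Lemma omega_continuous_sub_quad (m : 'cV[R]_n) (C : R) :
  omega_continuous (fun x => f x - lin m x - C * nsq x).
Proof.
move=> u x ux; apply: cvgB; first by apply: cvgB; [exact: contf|exact: cvg_lin].
by apply: cvgM; [exact: cvg_cstr|exact: cvg_nsq].
Qed.

Lemma unit_ball_max (g : 'rV[R]_n -> R) : omega_continuous g ->
  exists2 p, nsq p <= 1 & forall y, nsq y <= 1 -> g y <= g p.
Proof.
apply: (@omega_max _ _ g [set x | nsq x <= 1] 0 1).
- by rewrite /= nsq0.
- exact: unit_ball_norm.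
- move=> u x ux H; apply: (omega_lim_le (cvg_nsq ux) (@cvg_cstr _ _ omega _ 1) H).
Qed.

Lemma upper_touch_ex : exists p m C r, upper_touch p m C r.
Proof.
have [q q1 Hq] := unit_ball_max contf.
(* With this opening, [f - C * nsq] is smaller on the unit sphere than at the origin, so its maximum
   over the ball is at an inner point, and there a paraboloid touches from above. *)
pose C := f q - f 0 + 1.
have C1 : 1 <= C by rewrite lerDr subr_ge0 Hq// nsq0.
have [p p1 Hp] := unit_ball_max (@omega_continuous_sub_quad 0 C).
have lin0 x : lin (0 : 'cV[R]_n) x = 0 by rewrite /lin mulmx0 mxE.
have p1' : nsq p < 1.
  rewrite lt_neqAle p1 andbT; apply/negP => /eqP p1'.
  have := Hp 0; rewrite nsq0 !lin0 p1' => /(_ ler01); have := Hq _ p1; rewrite /C; lra.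
have [r r0 Hr] := nsq_ball_interior p1'.
exists p, ((2 * C) *: p^T), C, r; split => // v /Hr /Hp.
by rewrite !lin0 nsqD linZm lin_tr (dotC v); lra.
Qed.

Lemma upper_touch_transport y m C r A b l : upper_touch y m C r -> graph_sym f A b l ->
  exists m' C' r', upper_touch (y *m A + b) m' C' r'.
Proof.
move=> [r0 H] [uA l0 [m0 [c Hf]]].
have [k k0 Hk] := nsq_mul (invmx A).
exists (invmx A *m (l *: m + m0)), (l * `|C| * k), (r / k); split; first by rewrite divr_gt0.
move=> v vr; set w := v *m invmx A.
have vE : v = w *m A by rewrite /w mulmxKV.
have wr : nsq w <= r by apply: le_trans (Hk v) _; rewrite -ler_pdivlMl// mulrC.
have -> : y *m A + b + v = (y + w) *m A + b by rewrite vE mulmxDl addrAC.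
rewrite !Hf mulmxDl mxE.
have -> : lin (invmx A *m (l *: m + m0)) v = l * lin m w + (w *m m0) 0 0.
  by rewrite /lin mulmxA -/w mulmxDr -scalemxAr !mxE.
have h1 := H w wr.
have h2 : l * f (y + w) <= l * (f y + lin m w + C * nsq w) by rewrite ler_pM2l.
have h3 : l * (C * nsq w) <= l * `|C| * k * nsq v.
  rewrite -!mulrA ler_pM2l//; apply: (@le_trans _ _ (`|C| * nsq w)).
    by rewrite ler_wpM2r ?nsq_ge0// ler_norm.
  by rewrite ler_wpM2l// Hk.
rewrite mulrDr mulrDr in h2; lra.
Qed.

Lemma upper_touch_all y : exists m C r, upper_touch y m C r.
Proof.
have [p [m [C [r H]]]] := upper_touch_ex.
have [A [b [l [HA <-]]]] := graph_sym_transitive p y.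
exact: upper_touch_transport H HA.
Qed.

(** [y] lies between [y - t v] and [y + v]. Convexity bounds [f (y + v)] from below through
    [f (y - t v)], which the paraboloid bounds from above up to order [t ^ 2]; divide by [t] and let
    it tend to zero. *)
Lemma upper_touch_subgradient y m C r : upper_touch y m C r ->
  forall v, f y + lin m v <= f (y + v).
Proof.
move=> [r0 H] v.
have v1 : 0 < nsq v + 1 by rewrite ltr_wpDl// nsq_ge0.
apply: (@le_small _ _ _ (C * nsq v) (Num.min 1 (r / (nsq v + 1)))).
  by rewrite lt_min ltr01 divr_gt0.
move=> t /andP[t0]; rewrite le_min => /andP[t1 tr].
have tv : nsq (- t *: v) <= r.
  rewrite nsqZ sqrrN; apply: (@le_trans _ _ (t * (nsq v + 1))); last by rewrite -ler_pdivlMr.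
  rewrite expr2 -mulrA ler_pM2l//; apply: (@le_trans _ _ (1 * nsq v)).
    by rewrite ler_wpM2r// nsq_ge0.
  by rewrite mul1r lerDl.
have h1 := H _ tv; rewrite linZ nsqZ sqrrN in h1.
have t1' : 0 < 1 + t by rewrite addr_gt0.
have h2 := strictly_convex_fun_le (y + - t *: v) (y + v) (t := t / (1 + t)).
have h3 : 0 <= t / (1 + t) <= 1.
  by rewrite divr_ge0 ?(ltW t0) ?(ltW t1')//= ler_pdivrMr// mul1r lerDr.
have h4 : (1 - t / (1 + t)) *: (y + - t *: v) + (t / (1 + t)) *: (y + v) = y.
  by apply/rowP => i; rewrite !mxE; field; rewrite gt_eqF.
move: (h2 h3); rewrite h4 => h5.
have h6 : (1 + t) * f y <= f (y + - t *: v) + t * f (y + v).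
  have -> : f (y + - t *: v) + t * f (y + v) =
    (1 + t) * ((1 - t / (1 + t)) * f (y + - t *: v) + t / (1 + t) * f (y + v)).
    by field; rewrite gt_eqF.
  by rewrite ler_pM2l.
rewrite -(ler_pM2l t0).
have : t ^+ 2 * nsq v = t * (t * nsq v) by ring.
move=> h7; rewrite h7 in h1.
have h8 : t * (f (y + v) + t * (C * nsq v)) = t * f (y + v) + C * (t * (t * nsq v)) by ring.
rewrite h8; lra.
Qed.

Definition gradient y : 'cV[R]_n := projT1 (cid (upper_touch_all y)).

Lemma gradientP y : exists C r, upper_touch y (gradient y) C r.
Proof. exact: (projT2 (cid (upper_touch_all y))). Qed.

(** A supporting plane below and the paraboloid above meet the graph at the same point, so their
    slopes differ by a linear form with a quadratic bound, which is zero. *)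
Lemma gradient_unique y m (r : R) : 0 < r ->
  (forall v, nsq v <= r -> f y + lin m v <= f (y + v)) -> m = gradient y.
Proof.
move=> r0 H; have [C [r' [r'0 H']]] := gradientP y.
apply/eqP; rewrite -subr_eq0; apply/eqP.
apply: (@lin_small _ _ _ C (Num.min r r')); first by rewrite lt_min r0.
move=> v; rewrite le_min => /andP[/H h1 /H' h2].
by rewrite linBm; lra.
Qed.

Definition bregman y x := f (y + x) - f y - lin (gradient y) x.

Lemma bregman_ge0 y x : 0 <= bregman y x.
Proof.
have [C [r H]] := gradientP y.
by have := upper_touch_subgradient H x; rewrite /bregman; lra.
Qed.

Lemma bregman_gt0 y x : x != 0 -> 0 < bregman y x.
Proof.
move=> x0; have h1 := bregman_ge0 y (2^-1 *: x).
have : y != y + x.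
  by rewrite -subr_eq0 opprD addrA subrr sub0r oppr_eq0.
move=> /(@scf _ _ 2^-1); have -> : 0 < (2^-1 : R) < 1 by apply/andP; split; lra.
move=> /(_ isT); have -> : (1 - 2^-1) *: y + 2^-1 *: (y + x) = y + 2^-1 *: x.
  by apply/rowP => i; rewrite !mxE; field.
move: h1; rewrite /bregman linZ; lra.
Qed.

(** The transported slope supports the graph at the image point, so by uniqueness it is the gradient
    there. *)
Lemma bregman_sym y A b l : graph_sym f A b l ->
  forall x, bregman (y *m A + b) (x *m A) = l * bregman y x.
Proof.
move=> [uA l0 [m0 [c Hf]]] x.
have gE : invmx A *m (l *: gradient y + m0) = gradient (y *m A + b).
  apply: (@gradient_unique _ _ 1) => // v _; set w := v *m invmx A.
  have -> : y *m A + b + v = (y + w) *m A + b by rewrite mulmxDl mulmxKV// addrAC.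
  have -> : lin (invmx A *m (l *: gradient y + m0)) v = l * lin (gradient y) w + (w *m m0) 0 0.
    by rewrite /lin mulmxA -/w mulmxDr -scalemxAr !mxE.
  have E : ((y + w) *m m0) 0 0 = (y *m m0) 0 0 + (w *m m0) 0 0 by rewrite mulmxDl mxE.
  rewrite !Hf E.
  have := mulr_ge0 (ltW l0) (bregman_ge0 y w); rewrite /bregman /lin; lra.
rewrite /bregman -gE.
have -> : y *m A + b + x *m A = (y + x) *m A + b by rewrite mulmxDl addrAC.
have E : ((y + x) *m m0) 0 0 = (y *m m0) 0 0 + (x *m m0) 0 0 by rewrite mulmxDl mxE.
have E' : lin (invmx A *m (l *: gradient y + m0)) (x *m A) =
    l * lin (gradient y) x + (x *m m0) 0 0.
  by rewrite /lin mulmxA mulmxK// -[LHS]/(lin _ x) linDm linZm.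
by rewrite !Hf E E'; ring.
Qed.

Lemma sphere_min : exists2 c : R, 0 < c & forall x, nsq x = 1 -> c <= bregman 0 x.
Proof.
(* In dimension zero the unit sphere is empty. *)
have [[x0 x01]|H] := pselect (exists x : 'rV[R]_n, nsq x = 1); last first.
  by exists 1 => // x x1; case: H; exists x.
have cg : omega_continuous (fun x => - bregman 0 x).
  move=> u x ux; apply: cvgN; rewrite /bregman !add0r.
  apply: cvgB; last exact: cvg_lin.
  rewrite (_ : (fun k => _) = fun k => f (u k) - f 0); last by apply/funext => k; rewrite add0r.
  by apply: cvgB; [exact: contf|exact: cvg_cstr].
have [p p1 Hp] : exists2 p, nsq p = 1 & forall y, nsq y = 1 -> - bregman 0 y <= - bregman 0 p.
  apply: (@omega_max _ _ (fun x => - bregman 0 x) [set x | nsq x = 1] x0 1 x01).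
  - by move=> x /= x1; apply: unit_ball_norm; rewrite x1.
  - move=> u x ux H; apply: (cvg_real_unique (cvg_nsq ux)).
    by rewrite (_ : (fun k => _) = fun=> 1); [exact: cvg_cstr|apply/funext].
  - exact: cg.
exists (bregman 0 p); last by move=> x /Hp; rewrite lerN2.
apply: bregman_gt0; apply/negP => /eqP p0.
by move: p1; rewrite /= p0 nsq0 => /eqP; rewrite eq_sym oner_eq0.
Qed.

Lemma lower_touch_ex : exists p c r, [/\ 0 < c, 0 < r &
  forall v, nsq v <= r -> c * nsq v <= bregman p v].
Proof.
have [mu mu0 Hmu] := sphere_min.
(* With half the minimum over the sphere, [f] minus its tangent at the origin minus [c * nsq] is
   still larger on the sphere than at the origin. Its minimum over the ball is therefore at an inner
   point, where a paraboloid touches from below. *)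
pose c := mu / 2; have c0 : 0 < c by rewrite divr_gt0.
have cg : omega_continuous (fun x => - (f x - lin (gradient 0) x - c * nsq x)).
  by move=> u x ux; apply: cvgN; exact: omega_continuous_sub_quad.
have [p p1 Hp] := unit_ball_max cg.
have lin0 m : lin m (0 : 'rV[R]_n) = 0 by rewrite /lin mul0mx mxE.
have p1' : nsq p < 1.
  rewrite lt_neqAle p1 andbT; apply/negP => /eqP p1'.
  have := Hp 0; rewrite nsq0 lin0 p1' => /(_ ler01).
  by have := Hmu p p1'; rewrite /bregman add0r /c; lra.
have [r r0 Hr] := nsq_ball_interior p1'.
have H v : nsq v <= r -> f p + lin (gradient 0 + (2 * c) *: p^T) v + c * nsq v <= f (p + v).
  by move=> /Hr /Hp; rewrite nsqD linD linDm linZm lin_tr (dotC v); lra.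
exists p, c, r; split => // v vr; rewrite /bregman.
have <- : gradient 0 + (2 * c) *: p^T = gradient p.
  apply: (@gradient_unique _ _ r) => // w wr; have := H w wr.
  by have := mulr_ge0 (ltW c0) (nsq_ge0 w); lra.
by have := H v vr; lra.
Qed.

End Quadratic.

Definition divergence (R : realType) n (f : 'rV[R]_n -> R) (G : 'rV[R]_n -> 'cV[R]_n) y x : R :=
  f (y + x) - f y - lin (G y) x.

Lemma gradient_form (R : realType) n (f : 'rV[R]_n -> R) :
  strictly_convex_fun f -> omega_continuous f ->
  (forall y, exists A b l, graph_sym f A b l /\ y *m A + b = 0) ->
  exists G : 'rV[R]_n -> 'cV[R]_n, let D := divergence f G in
  [/\ forall y x, 0 <= D y x,
      forall y A b l, graph_sym f A b l -> forall x, D (y *m A + b) (x *m A) = l * D y x,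
      exists C r, 0 < r /\ forall v, nsq v <= r -> D 0 v <= C * nsq v &
      exists c r, [/\ 0 < c, 0 < r & forall v, nsq v <= r -> c * nsq v <= D 0 v]].
Proof.
move=> scf contf trans; exists (gradient contf trans); split.
- exact: bregman_ge0.
- exact: bregman_sym.
- have [C [r [r0 H]]] := gradientP contf trans 0; exists C, r; split => // v /H.
  by rewrite /divergence; lra.
- have [p [c [r [c0 r0 H]]]] := lower_touch_ex scf contf trans.
  have [A [b [l [HA pA]]]] := trans p; have [uA l0 _] := HA.
  have [k k0 Hk] := nsq_mul A; have [k' k'0 Hk'] := nsq_mul (invmx A).
  exists (l * c / k), (r / k'); split; [by rewrite divr_gt0// mulr_gt0|by rewrite divr_gt0|].
  move=> v vr; have wr : nsq (v *m invmx A) <= r.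
    by apply: le_trans (Hk' v) _; rewrite -ler_pdivlMl// mulrC.
  have := bregman_sym scf contf trans p HA (v *m invmx A).
  rewrite pA mulmxKV// => /[dup] E.
  rewrite -[divergence _ _ _ _]/(bregman contf trans 0 v) => ->.
  rewrite -!mulrA ler_pM2l//; apply: le_trans (H _ wr); rewrite ler_pM2l//.
  have := Hk (v *m invmx A); rewrite mulmxKV// => h.
  by rewrite ler_pdivrMl.
Qed.

Lemma quadratic_coef_le0 (R : realType) (a b c : R) :
  (forall s, a * s ^+ 2 + b * s + c <= 0) -> a <= 0.
Proof.
move=> H; apply: (@le_small _ _ _ (`|b| + `|c|) 1) => // t /andP[t0 t1].
have := H t^-1.
have t20 : 0 < t ^+ 2 by rewrite exprn_gt0.
rewrite -(pmulr_rle0 _ t20).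
have -> : t ^+ 2 * (a * t^-1 ^+ 2 + b * t^-1 + c) = a + b * t + c * t * t.
  by field; rewrite gt_eqF.
have hb : - b <= `|b| by rewrite -normrN ler_norm.
have hc : - c <= `|c| by rewrite -normrN ler_norm.
have h1 := ler_wpM2l (ltW t0) hb.
have h2 := ler_wpM2l (mulr_ge0 (ltW t0) (ltW t0)) hc.
have h3 : t * (t * `|c|) <= t * (1 * `|c|) by rewrite ler_pM2l// ler_wpM2r.
lra.
Qed.

(** * Two-sided quadratic bounds on the divergence, uniform in both arguments *)

Section UniformBounds.
Variables (R : realType) (n : nat) (f : 'rV[R]_n -> R) (G : 'rV[R]_n -> 'cV[R]_n).
Implicit Types (x y v w : 'rV[R]_n) (A : 'M[R]_n).
Let D := divergence f G.
Hypothesis D_sym : forall y A b l, graph_sym f A b l ->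
  forall x, D (y *m A + b) (x *m A) = l * D y x.
Hypothesis D_upper : exists C r, 0 < r /\ forall v, nsq v <= r -> D 0 v <= C * nsq v.
Hypothesis D_lower : exists c r, [/\ 0 < c, 0 < r & forall v, nsq v <= r -> c * nsq v <= D 0 v].
Hypothesis trans : forall y, exists A b l, graph_sym f A b l /\ y *m A + b = 0.
Variables (A0 : 'M[R]_n) (l0 : R).
Hypothesis sym0 : graph_sym f A0 0 l0.
Hypothesis A0_cvg0 : forall x : 'rV[R]_n, (fun k => x *m A0 ^+ k) @ omega --> (0 : 'rV[R]_n).

Lemma D0_pow x k : D 0 (x *m A0 ^+ k) = l0 ^+ k * D 0 x.
Proof.
elim: k => [|k IH]; first by rewrite !expr0 mulmx1 mul1r.
rewrite exprSr -[_ * A0]/(_ *m A0) mulmxA.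
have := D_sym 0 sym0 (x *m A0 ^+ k); rewrite mul0mx addr0 IH => ->.
by rewrite exprS mulrA.
Qed.

Lemma nsq_pow_small x (r : R) : 0 < r -> \forall k \near omega, nsq (x *m A0 ^+ k) <= r.
Proof.
move=> r0; have := cvg_nsq (A0_cvg0 x); rewrite nsq0 => /cvgrPdist_le /(_ _ r0).
by apply: filterS => k; rewrite sub0r normrN ger0_norm ?nsq_ge0.
Qed.

(** The local bounds, read at [x] and at [x *m A0 ^+ k], compare [nsq (x *m A0 ^+ k)] with
    [l0 ^+ k * nsq x]. This comparison is homogeneous of degree two and so extends to all [x]. Since
    high powers bring any vector into the local region, the bounds become global at the price of a
    factor [C / c]. *)
Lemma D0_bounds : exists c C, [/\ 0 < c, 0 < C & forall x, c * nsq x <= D 0 x <= C * nsq x].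
Proof.
have [C' [r1 [r10 HC']]] := D_upper; have [c [r2 [c0 r20 Hc]]] := D_lower.
pose C := `|C'| + 1; have C0 : 0 < C by rewrite ltr_wpDl.
pose r := Num.min r1 r2; have r0 : 0 < r by rewrite lt_min r10.
have loc v : nsq v <= r -> c * nsq v <= D 0 v <= C * nsq v.
  rewrite le_min => /andP[/HC' h1 /Hc ->] /=; apply: le_trans h1 _.
  rewrite ler_wpM2r ?nsq_ge0// /C; have := ler_norm C'; lra.
have [_ l00 _] := sym0.
have lk k : 0 < l0 ^+ k by rewrite exprn_gt0.
have small x : nsq x <= r -> \forall k \near omega,
    c * nsq (x *m A0 ^+ k) <= l0 ^+ k * (C * nsq x) /\
    l0 ^+ k * (c * nsq x) <= C * nsq (x *m A0 ^+ k).
  move=> xr; have /andP[h1 h2] := loc _ xr.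
  apply: filterS (nsq_pow_small x r0) => k /loc; rewrite D0_pow => /andP[h3 h4].
  by split; [apply: le_trans h3 _|apply: le_trans _ h4]; rewrite ler_pM2l.
have all x : \forall k \near omega,
    c * nsq (x *m A0 ^+ k) <= l0 ^+ k * (C * nsq x) /\
    l0 ^+ k * (c * nsq x) <= C * nsq (x *m A0 ^+ k).
  have x1 : 0 < nsq x + 1 by rewrite ltr_wpDl// nsq_ge0.
  pose t := Num.min 1 (r / (nsq x + 1)).
  have t0 : 0 < t by rewrite lt_min ltr01 divr_gt0.
  have t20 : 0 < t ^+ 2 by rewrite exprn_gt0.
  have : nsq (t *: x) <= r.
    rewrite nsqZ; apply: (@le_trans _ _ (t * (nsq x + 1))).
      rewrite expr2 -mulrA ler_pM2l//; apply: (@le_trans _ _ (1 * nsq x)).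
        by rewrite ler_wpM2r ?nsq_ge0// ge_min lexx.
      by rewrite mul1r lerDl.
    by rewrite -ler_pdivlMr// ge_min lexx orbT.
  move=> /small; apply: filterS => k; rewrite -scalemxAl !nsqZ => -[h1 h2].
  by split; rewrite -(ler_pM2l t20); [move: h1|move: h2]; congr (_ <= _); ring.
exists (c * c / C), (C * C / c); split; [by rewrite divr_gt0 ?mulr_gt0..|].
move=> x; have [k [[h1 h2] /loc]] := omega_ex (omega_and (all x) (nsq_pow_small x r0)).
rewrite D0_pow => /andP[h3 h4].
apply/andP; split; rewrite -(ler_pM2l (lk k)).
  have -> : l0 ^+ k * (c * c / C * nsq x) = c * (C^-1 * (l0 ^+ k * (c * nsq x))) by ring.
  by apply: le_trans h3; rewrite ler_pM2l// ler_pdivrMl.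
have -> : l0 ^+ k * (C * C / c * nsq x) = C * (c^-1 * (l0 ^+ k * (C * nsq x))) by ring.
by apply: le_trans h4 _; rewrite ler_pM2l// ler_pdivlMl.
Qed.

Lemma D_shift y x : D y x = D 0 (y + x) - D 0 y - lin (G y - G 0) x.
Proof. by rewrite /D /divergence !add0r linD linBm; ring. Qed.

(** A symmetry relates [D 0] to [D b], which differs from a translate of [D 0] only by an affine
    function. Along [s *: x] that function is of lower order, so the coefficients of [s ^+ 2] give
    one bound, and the inverse symmetry gives the other. *)
Lemma sym_bounds : exists2 K : R, 0 < K & forall A b l, graph_sym f A b l ->
  forall x, nsq (x *m A) <= K * l * nsq x /\ l * nsq x <= K * nsq (x *m A).
Proof.
have [c [C [c0 C0 H]]] := D0_bounds.
have half A b l : graph_sym f A b l -> forall x, c * nsq (x *m A) <= C * l * nsq x.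
  move=> sA x; set z := x *m A; rewrite -subr_le0.
  apply: (@quadratic_coef_le0 _ _ (2 * c * dot b z - lin (G b - G 0) z) (c * nsq b - D 0 b)) => s.
  have := D_sym 0 sA (s *: x); rewrite mul0mx add0r -scalemxAl -/z D_shift linZ.
  have /andP[h1 _] := H (b + s *: z); have /andP[_ h2] := H (s *: x).
  have [_ lp _] := sA.
  have h3 : l * D 0 (s *: x) <= l * (C * nsq (s *: x)) by rewrite ler_pM2l.
  move: h1 h3; rewrite nsqD !nsqZ dotZr => h1 h3 h4.
  have e1 : c * (nsq b + 2 * (s * dot b z) + s ^+ 2 * nsq z) =
    c * nsq b + 2 * c * dot b z * s + c * nsq z * s ^+ 2 by ring.
  have e2 : l * (C * (s ^+ 2 * nsq x)) = C * l * nsq x * s ^+ 2 by ring.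
  rewrite e1 in h1; rewrite e2 in h3; rewrite !mulrBl; lra.
exists (C / c); first by rewrite divr_gt0.
move=> A b l sA x; split.
  have -> : C / c * l * nsq x = c^-1 * (C * l * nsq x) by ring.
  by rewrite ler_pdivlMl// (half _ _ _ sA).
have [uA lp _] := sA.
have := half _ _ _ (graph_sym_inv sA) (x *m A); rewrite mulmxK// => h.
have -> : C / c * nsq (x *m A) = l * (c^-1 * (C * l^-1 * nsq (x *m A))).
  by field; rewrite !gt_eqF.
by rewrite ler_pM2l// ler_pdivlMl.
Qed.

(** Transport [y] to the origin; the scale [l] of the divergence cancels against that of [nsq]. *)
Lemma D_bounds : exists c C, [/\ 0 < c, 0 < C & forall y x, c * nsq x <= D y x <= C * nsq x].
Proof.
have [c [C [c0 C0 H]]] := D0_bounds; have [K K0 HK] := sym_bounds.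
exists (c / K), (C * K); split; [by rewrite divr_gt0|by rewrite mulr_gt0|] => y x.
have [A [b [l [sA yA]]]] := trans y; have [_ lp _] := sA.
have := D_sym y sA x; rewrite yA => E.
have /andP[h1 h2] := H (x *m A); have [h3 h4] := HK _ _ _ sA x; rewrite E in h1 h2.
apply/andP; split; rewrite -(ler_pM2l lp).
  have -> : l * (c / K * nsq x) = c * (K^-1 * (l * nsq x)) by ring.
  by apply: le_trans h1; rewrite ler_pM2l// ler_pdivrMl.
have -> : l * (C * K * nsq x) = C * (K * l * nsq x) by ring.
by apply: le_trans h2 _; rewrite ler_pM2l.
Qed.

End UniformBounds.

(** * Invariant quadratic forms *)

Definition qform (R : realType) n (Q : 'M[R]_n) (x : 'rV[R]_n) : R := (x *m Q *m x^T) 0 0.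

(** The matrix of the form [Q (x A) / l]. Under this action a form lying below every [D y] stays
    below every [D y]. *)
Definition form_act (R : realType) n (A : 'M[R]_n) (l : R) (Q : 'M[R]_n) : 'M[R]_n :=
  l^-1 *: (A *m Q *m A^T).

Section Forms.
Variables (R : realType) (n : nat).
Implicit Types (Q M : 'M[R]_n) (x : 'rV[R]_n).

Lemma qformD Q M x : qform (Q + M) x = qform Q x + qform M x.
Proof. by rewrite /qform mulmxDr mulmxDl mxE. Qed.

Lemma qformZ a Q x : qform (a *: Q) x = a * qform Q x.
Proof. by rewrite /qform -scalemxAr -scalemxAl mxE. Qed.

Lemma qformB Q M x : qform (Q - M) x = qform Q x - qform M x.
Proof. by rewrite qformD -[- M]scaleN1r qformZ mulN1r. Qed.

Lemma qform_act A l Q x : qform (form_act A l Q) x = l^-1 * qform Q (x *m A).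
Proof. by rewrite /form_act qformZ /qform trmx_mul !mulmxA. Qed.

Lemma qform_sqr p (B : 'M[R]_(n, p)) x : qform (B *m B^T) x = nsq (x *m B).
Proof. by rewrite /qform /nsq /dot trmx_mul !mulmxA. Qed.

Lemma qform1 x : qform 1%:M x = nsq x.
Proof. by rewrite /qform mulmx1. Qed.

Lemma form_actD A l Q M : form_act A l (Q + M) = form_act A l Q + form_act A l M.
Proof. by rewrite /form_act mulmxDr mulmxDl scalerDr. Qed.

Lemma form_actZ A l a Q : form_act A l (a *: Q) = a *: form_act A l Q.
Proof. by rewrite /form_act -scalemxAr -scalemxAl scalerA mulrC -scalerA. Qed.

Lemma form_actB A l Q M : form_act A l (Q - M) = form_act A l Q - form_act A l M.
Proof. by rewrite form_actD -[- M]scaleN1r form_actZ scaleN1r. Qed.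

Lemma form_act_comp A l A' l' Q : form_act A l (form_act A' l' Q) = form_act (A *m A') (l * l') Q.
Proof.
by rewrite /form_act -scalemxAr -scalemxAl scalerA invfM trmx_mul !mulmxA.
Qed.

Lemma form_act1 Q : form_act 1%:M 1 Q = Q.
Proof. by rewrite /form_act invr1 scale1r mul1mx trmx1 mulmx1. Qed.

Lemma mxvec_norm_le M : `|mxvec M| <= `|M|.
Proof.
apply: mx_norm_leP => // i j; rewrite ord1; case/mxvec_indexP: j => a b.
by rewrite mxvecE mx_norm_coord.
Qed.

Lemma norm_le_mxvec M : `|M| <= `|mxvec M|.
Proof. by apply: mx_norm_leP => // i j; rewrite -mxvecE mx_norm_coord. Qed.

Lemma trmx_norm_le M : `|M^T| <= `|M|.
Proof. by apply: mx_norm_leP => // i j; rewrite mxE mx_norm_coord. Qed.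

(** The left side is the trace pairing, and [B *m B^T] is a sum of rank-one squares of the columns
    of [B]. A form [M] that dominates the identity therefore pairs with it to at least the sum of
    the squared columns. *)
Lemma dot_mxvec_sqr p M (B : 'M[R]_(n, p)) :
  dot (mxvec M) (mxvec (B *m B^T)) = \sum_k qform M (row k B^T).
Proof.
have -> : B *m B^T = \sum_k (row k B^T)^T *m row k B^T.
  apply/matrixP => i j; rewrite mxE summxE; apply: eq_bigr => k _.
  by rewrite !mxE big_ord1 !mxE.
rewrite dotC /dot [mxvec (\sum_k _)]linear_sum /= mulmx_suml summxE; apply: eq_bigr => k _.
by rewrite mxvec_dotmul.
Qed.

Lemma norm_le_rows p (B : 'M[R]_(n, p)) : `|B| ^+ 2 <= \sum_k nsq (row k B^T).
Proof.
have S0 : 0 <= \sum_k nsq (row k B^T) by rewrite sumr_ge0// => k _; exact: nsq_ge0.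
have h : `|B| <= Num.sqrt (\sum_k nsq (row k B^T)).
  apply: mx_norm_leP => [|i j]; first exact: sqrtr_ge0.
  rewrite -sqrtr_sqr ler_wsqrtr// (bigD1 j)//= nsqE (bigD1 i)//= !mxE -addrA lerDl.
  by rewrite addr_ge0// sumr_ge0// => k _; rewrite ?sqr_ge0 ?nsq_ge0.
by rewrite -[leRHS](sqr_sqrtr S0) lerXn2r ?nnegrE ?sqrtr_ge0.
Qed.

End Forms.

(** * An invariant and maximal form from a closest-point problem *)

Section InvariantForm.
Variables (R : realType) (n : nat) (Gam : 'M[R]_n -> R -> Prop).
Hypothesis Gam_pos : forall A l, Gam A l -> A \in unitmx /\ 0 < l.
Hypothesis Gam1 : Gam 1%:M 1.
Hypothesis GamM : forall A l A' l', Gam A l -> Gam A' l' -> Gam (A *m A') (l * l').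
Hypothesis GamV : forall A l, Gam A l -> Gam (invmx A) l^-1.
Variable K : R.
Hypothesis K0 : 0 < K.
Hypothesis GamK : forall A l, Gam A l -> forall x, nsq (x *m A) <= K * l * nsq x.

Lemma Gam_norm A l : Gam A l -> `|A| ^+ 2 <= K * l.
Proof.
move=> GA; have [_ l0] := Gam_pos GA; have Kl : 0 <= K * l by rewrite mulr_ge0 ?ltW.
have h : `|A| <= Num.sqrt (K * l).
  apply: mx_norm_leP => [|i j]; first exact: sqrtr_ge0.
  rewrite -sqrtr_sqr ler_wsqrtr//.
  have := GamK GA (delta_mx 0 i); rewrite -rowE => h1.
  apply: (@le_trans _ _ (nsq (row i A))).
    rewrite nsqE (bigD1 j)//= !mxE lerDl sumr_ge0// => k _; exact: sqr_ge0.
  apply: le_trans h1 _; rewrite -[leRHS]mulr1 ler_wpM2l//.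
  rewrite nsqE (bigD1 i)//= big1 ?addr0 => [|k ki]; first by rewrite mxE !eqxx expr1n.
  by rewrite mxE eqxx (negbTE ki) expr0n.
by rewrite -[leRHS](sqr_sqrtr Kl) lerXn2r ?nnegrE ?sqrtr_ge0.
Qed.

(** [A] enters twice and so contributes a factor of order [K * l], from which the division by [l]
    removes the scale. *)
Lemma form_act_bound : exists2 k : R, 0 < k & forall A l, Gam A l ->
  forall M, nsq (mxvec (form_act A l M)) <= k * nsq (mxvec M).
Proof.
pose k0 := n%:R * n%:R * K : R.
have k00 : 0 <= k0 by rewrite !mulr_ge0// ltW.
exists ((n * n)%:R * k0 ^+ 2 + 1); first by rewrite ltr_wpDl// mulr_ge0// sqr_ge0.
move=> A l GA M; have [_ l0] := Gam_pos GA.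
have h : `|form_act A l M| <= k0 * `|M|.
  rewrite mx_normZ gtr0_norm ?invr_gt0// ler_pdivrMl//.
  apply: le_trans (mx_norm_mul _ _) _.
  apply: (@le_trans _ _ (n%:R * (n%:R * `|A| * `|M|) * `|A|)).
    by apply: ler_pM; rewrite ?mulr_ge0// ?ler_wpM2l ?mx_norm_mul ?trmx_norm_le.
  have -> : n%:R * (n%:R * `|A| * `|M|) * `|A| = n%:R * n%:R * `|M| * `|A| ^+ 2 by ring.
  have -> : l * (k0 * `|M|) = n%:R * n%:R * `|M| * (K * l) by rewrite /k0; ring.
  by rewrite ler_wpM2l ?mulr_ge0// Gam_norm.
clearbody k0; apply: le_trans (nsq_mx_norm _) _.
have h2 : `|mxvec (form_act A l M)| ^+ 2 <= k0 ^+ 2 * nsq (mxvec M).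
  apply: (@le_trans _ _ ((k0 * `|mxvec M|) ^+ 2)).
    rewrite lerXn2r ?nnegrE ?mulr_ge0// (le_trans (mxvec_norm_le _))// (le_trans h)//.
    by rewrite ler_wpM2l// norm_le_mxvec.
  by rewrite exprMn ler_wpM2l ?sqr_ge0// mx_norm_nsq.
apply: (@le_trans _ _ ((n * n)%:R * (k0 ^+ 2 * nsq (mxvec M)))); first by rewrite ler_wpM2l.
by rewrite mulrA mulrDl lerDl mul1r nsq_ge0.
Qed.

Lemma form_actK A l M : Gam A l -> form_act (invmx A) l^-1 (form_act A l M) = M.
Proof.
move=> GA; have [uA l0] := Gam_pos GA.
by rewrite form_act_comp mulVmx// mulVf ?gt_eqF// form_act1.
Qed.

Variables (QQ : set 'M[R]_n) (C : R).
Hypothesis QQ0 : QQ 0.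
Hypothesis QQc : forall Q Q' (t : R), QQ Q -> QQ Q' -> 0 <= t <= 1 -> QQ ((1 - t) *: Q + t *: Q').
Hypothesis QQlim : forall (u : nat -> 'M[R]_n) (Q : 'M[R]_n),
  u @ omega --> Q -> (forall k, QQ (u k)) -> QQ Q.
Hypothesis QQact : forall A l Q, Gam A l -> QQ Q -> QQ (form_act A l Q).
Hypothesis QQC : forall Q, QQ Q -> forall x, qform Q x <= C * nsq x.

(** [th] bounds the squared Frobenius distance from [C + 1] to every form in the orbit, which makes
    the condition invariant. Any form of [QQ] is at most [C], so [C + 1] exceeds it by at least the
    identity. *)
Definition orbit_within (th : R) Q :=
  forall A l, Gam A l -> nsq (mxvec ((C + 1)%:M - form_act A l Q)) <= th.

Lemma orbit_within_min : exists th Q, [/\ QQ Q, orbit_within th Q &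
  forall Q' th', QQ Q' -> orbit_within th' Q' -> th <= th'].
Proof.
pose E := [set th : R | exists2 Q, QQ Q & orbit_within th Q].
have E0 : E !=set0.
  exists (nsq (mxvec ((C + 1)%:M : 'M[R]_n))); exists 0 => // A l _.
  by rewrite /form_act mulmx0 mul0mx scaler0 subr0.
have Elb : lbound E 0.
  by move=> th [Q _ /(_ _ _ Gam1)]; apply: le_trans; exact: nsq_ge0.
have infE : has_inf E by split => //; exists 0.
have /choice [u Hu] : forall k : nat, exists Q, QQ Q /\ orbit_within (inf E + k.+1%:R^-1) Q.
  move=> k; have k0 : 0 < k.+1%:R^-1 :> R by rewrite invr_gt0.
  have [th [Q QQQ fQ] lt] := inf_adherent k0 infE.
  by exists Q; split => // A l /fQ h; apply: le_trans h (ltW lt).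
have ub k : `|u k| <= `|((C + 1)%:M : 'M[R]_n)| + (inf E + 1 + 1).
  have := (Hu k).2 _ _ Gam1; rewrite form_act1 => h.
  rewrite -[u k](subKr (C + 1)%:M) (le_trans (ler_normB _ _))// lerD2l.
  have k1 : k.+1%:R^-1 <= 1 :> R by rewrite invf_le1// ler1n.
  have i0 : 0 <= inf E by apply: lb_le_inf.
  have h2 := mx_norm_nsq (mxvec ((C + 1)%:M - u k)).
  have h3 := norm_le_mxvec ((C + 1)%:M - u k).
  set a := `|mxvec _| in h2 h3; have a0 : 0 <= a by exact: normr_ge0.
  have h4 : a <= a ^+ 2 + 1.
    by have := sqr_ge0 (a - 1); rewrite sqrrB1 mulr2n; lra.
  apply: le_trans h3 _; apply: le_trans h4 _; rewrite lerD2r (le_trans h2)// (le_trans h)//.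
  by rewrite lerD2l.
have [Q uQ] : exists Q : 'M[R]_n, u @ omega --> Q.
  by apply: (mx_cvg_omega (M := `|((C + 1)%:M : 'M[R]_n)| + (inf E + 1 + 1))); apply: (@omega_ge _ 0) => k _; exact: ub.
exists (inf E), Q; split.
- by apply: (QQlim uQ) => k; have [] := Hu k.
- move=> A l GA; apply: (@omega_lim_le _ (fun k => nsq (mxvec ((C + 1)%:M - form_act A l (u k))))
     (fun k => inf E + k.+1%:R^-1)).
  + apply: cvg_nsq.
    have H : (fun k => (C + 1)%:M - form_act A l (u k)) @ omega --> (C + 1)%:M - form_act A l Q.
      apply: cvg_subm; first exact: cvg_cstm.
      apply: cvg_scalec; apply: cvg_mulmx; last exact: cvg_cstm.
      by apply: cvg_mulmx; [exact: cvg_cstm|exact: uQ].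
    apply: mx_cvg => i j; rewrite ord1; case/mxvec_indexP: j => a b.
    rewrite mxvecE (_ : (fun k => _) = fun k => ((C + 1)%:M - form_act A l (u k)) a b); last first.
      by apply/funext => k; rewrite mxvecE.
    exact: (@cvg_coord R _ _ _ _ _ _ _ a b H).
  + have := @cvgD R R nat omega _ (fun=> inf E : R) (fun k : nat => k.+1%:R^-1 : R) (inf E) 0
      (cvg_cst _) (@invn_cvg0 R).
    by rewrite addr0; exact.
  + by move=> k; exact: (Hu k).2.
- by move=> Q' th' QQ' f'; apply: ge_inf; [exists 0|exists Q'].
Qed.

(* The point of [QQ] whose orbit is closest to [C + 1] is unique by the
   parallelogram law, hence invariant; it is maximal since [C + 1] dominates [QQ]. *)
Lemma invariant_form : exists2 Q, QQ Q & (forall A l, Gam A l -> form_act A l Q = Q) /\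
  forall p (B : 'M[R]_(n, p)) (eps : R), 0 < eps -> QQ (Q + eps *: (B *m B^T)) -> B = 0.
Proof.
have [th [Q [QQQ fQ minQ]]] := orbit_within_min; have [k k0 Hk] := form_act_bound.
exists Q => //; split.
  move=> A0 l0 G0; set Q' := form_act A0 l0 Q.
  have QQ' : QQ Q' by exact: QQact.
  have fQ' : orbit_within th Q'.
    by move=> A l GA; rewrite /Q' form_act_comp; apply: fQ; exact: GamM.
  clearbody Q'.
  have mid : QQ ((1 - 2^-1) *: Q + 2^-1 *: Q').
    by apply: QQc => //; apply/andP; split; lra.
  (* The parallelogram law gains a quarter of the squared distance between the images of [Q] and
     [Q']. The bound for the inverse action keeps that squared distance above [k^-1] times the
     original one, uniformly along the orbit. *)
  have : orbit_within (th - 4^-1 * (k^-1 * nsq (mxvec (Q - Q')))) ((1 - 2^-1) *: Q + 2^-1 *: Q').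
    move=> A l GA; have h1 := fQ _ _ GA; have h2 := fQ' _ _ GA.
    rewrite form_actD !form_actZ.
    have h3 : k^-1 * nsq (mxvec (Q - Q')) <= nsq (mxvec (form_act A l Q - form_act A l Q')).
      rewrite ler_pdivrMl//; have := Hk _ _ (GamV GA) (form_act A l (Q - Q')).
      by rewrite form_actK// form_actB.
    move: h1 h2 h3; move: (form_act A l Q) (form_act A l Q') => X Y h1 h2 h3.
    have -> : (C + 1)%:M - ((1 - 2^-1) *: X + 2^-1 *: Y) =
       2^-1 *: (((C + 1)%:M - X) + ((C + 1)%:M - Y)).
      by apply/matrixP => i j; rewrite !mxE; field.
    have eXY : X - Y = ((C + 1)%:M - Y) - ((C + 1)%:M - X) by apply/matrixP => i j; rewrite !mxE; ring.
    rewrite eXY in h3; move: h1 h2 h3; move: (k^-1 * nsq (mxvec (Q - Q'))) => z.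
    move: ((C + 1)%:M - X) ((C + 1)%:M - Y) => V W.
    rewrite [mxvec (_ *: _)]linearZ [mxvec (W - V)]linearB /= [mxvec (V + W)]linearD /= nsqZ nsqB nsqD (dotC (mxvec W)) => h1 h2 h3.
    set d := dot _ _ in h3 *; set v := nsq (mxvec V) in h1 h3 *.
    set w := nsq (mxvec W) in h2 h3 *.
    have -> : (2^-1 : R) ^+ 2 = 4^-1 by field.
    lra.
  move=> /(minQ _ _ mid) h.
  have h0 : nsq (mxvec (Q - Q')) <= 0.
    have h' : k^-1 * nsq (mxvec (Q - Q')) <= 0 by lra.
    by rewrite -(pmulr_rle0 _ (_ : 0 < k^-1)) ?invr_gt0.
  have /nsq_eq0 : nsq (mxvec (Q - Q')) = 0 by apply/eqP; rewrite eq_le h0 nsq_ge0.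
  move=> /eqP; rewrite mxvec_eq0 subr_eq0 => /eqP <- //.
move=> p B eps eps0 Qe; apply/eqP; apply: contrapT => /negP B0.
have [i Bi] : exists i, row i B != 0.
  apply: contrapT => /forallNP H; case/negP: B0; apply/eqP/row_matrixP => i.
  by rewrite row0; apply/eqP; apply: contrapT => /negP; exact: H.
pose x0 : 'rV[R]_n := delta_mx 0 i.
have xB : 0 < nsq (x0 *m B) by rewrite nsq_gt0// -rowE.
have x00 : 0 < nsq x0.
  by apply: nsq_gt0; apply: contraTneq xB => ->; rewrite mul0mx nsq0 ltxx.
(* The trace of the image of [B *m B^T]. It stays away from zero along the orbit, because the
   nonzero vector [x0 *m B] is recovered from [A *m B] by applying it to [x0 *m invmx A], whose size
   is controlled. *)
pose S (A : 'M[R]_n) (l : R) := l^-1 * \sum_j nsq (row j (A *m B)^T).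
pose c1 := p%:R * n%:R ^+ 2 * (K * nsq x0) : R.
have low A l : Gam A l -> nsq (x0 *m B) <= c1 * S A l.
  move=> GA; have [uA l0] := Gam_pos GA; set E := A *m B.
  have -> : x0 *m B = (x0 *m invmx A) *m E by rewrite /E mulmxA mulmxKV.
  set u := x0 *m invmx A; apply: le_trans (nsq_mx_norm _) _.
  have hu : nsq u <= K * l^-1 * nsq x0 by exact: (GamK (GamV GA)).
  have h1 : `|u *m E| ^+ 2 <= (n%:R * `|u| * `|E|) ^+ 2.
    by rewrite lerXn2r ?nnegrE ?mulr_ge0// mx_norm_mul.
  have h2 : (n%:R * `|u| * `|E|) ^+ 2 <= n%:R ^+ 2 * (K * l^-1 * nsq x0) * \sum_j nsq (row j E^T).
    rewrite !exprMn; apply: ler_pM; rewrite ?mulr_ge0 ?sqr_ge0//; last exact: norm_le_rows.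
    by rewrite ler_wpM2l ?sqr_ge0// (le_trans (mx_norm_nsq _)).
  have -> : c1 * S A l = p%:R * (n%:R ^+ 2 * (K * l^-1 * nsq x0) * \sum_j nsq (row j E^T)).
    by rewrite /c1 /S; ring.
  by rewrite ler_wpM2l// (le_trans h1).
have c10 : 0 <= c1 by rewrite /c1 !mulr_ge0 ?sqr_ge0 ?nsq_ge0 ?(ltW K0).
pose N := k * nsq (mxvec (B *m B^T)).
pose del := nsq (x0 *m B) / (c1 + 1).
have c11 : 0 < c1 + 1 by rewrite ltr_wpDl.
have del0 : 0 < del by rewrite divr_gt0.
have lowS A l : Gam A l -> del <= S A l.
  move=> GA; rewrite ler_pdivrMr// (le_trans (low _ _ GA))// mulrDr mulr1 mulrC lerDl.
  have [_ l0] := Gam_pos GA.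
  by rewrite mulr_ge0 ?invr_ge0 ?(ltW l0)// sumr_ge0// => j _; exact: nsq_ge0.
(* Moving [Q] towards [Q + eps B B^T] lowers all orbit distances to first order: [C + 1] minus an
   image of [Q] is at least the identity, so it pairs with the image of [B B^T] to at least [S].
   Minimality of [th] then leaves [2 * del <= t * N] for all small [t]. *)
have key t : 0 <= t <= eps -> orbit_within (th - 2 * t * del + t ^+ 2 * N) (Q + t *: (B *m B^T)).
  move=> /andP[t0 te] A l GA; have [uA l0] := Gam_pos GA; rewrite form_actD form_actZ.
  have actB : form_act A l (B *m B^T) = l^-1 *: ((A *m B) *m (A *m B)^T).
    by rewrite /form_act trmx_mul !mulmxA.
  rewrite opprD addrA; set X := (C + 1)%:M - form_act A l Q.
  have hX : nsq (mxvec X) <= th by exact: fQ.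
  have hN : nsq (mxvec (form_act A l (B *m B^T))) <= N by exact: Hk.
  have hd : S A l <= dot (mxvec X) (mxvec (form_act A l (B *m B^T))).
    rewrite actB [mxvec (_ *: _)]linearZ /= dotZr dot_mxvec_sqr /S ler_pM2l ?invr_gt0//.
    apply: ler_sum => j _; set y := row _ _.
    have := QQC (QQact GA QQQ) y; rewrite /X qformB -scalemx1 qformZ qform1.
    lra.
  rewrite [mxvec (_ - _)]linearB /= [mxvec (_ *: _)]linearZ /= nsqB nsqZ dotZr.
  set Y := mxvec (form_act _ _ _) in hN hd *; set XX := mxvec X in hX hd *.
  have h1 : t * S A l <= t * dot XX Y by rewrite ler_wpM2l.
  have h2 : t * del <= t * S A l by rewrite ler_wpM2l// lowS.
  have h3 : t ^+ 2 * nsq Y <= t ^+ 2 * N by rewrite ler_wpM2l ?sqr_ge0.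
  lra.
have : 2 * del <= 0.
  apply: (@le_small _ _ _ N eps) => // t /andP[t0 te]; rewrite add0r.
  have QQt : QQ (Q + t *: (B *m B^T)).
    have := QQc QQQ Qe (t := t / eps).
    rewrite divr_ge0 ?(ltW t0) ?(ltW eps0)// ler_pdivrMr// mul1r te => /(_ isT).
    congr QQ; apply/matrixP => a b; rewrite !mxE; set bb := \sum_j _.
    by field; rewrite gt_eqF.
  have /key/(minQ _ _ QQt) h : 0 <= t <= eps by rewrite (ltW t0).
  rewrite -(ler_pM2l t0); lra.
lra.
Qed.

End InvariantForm.

(** Take a matrix of maximal rank with row space in [Z]; a further vector of [Z] would raise the
    rank. *)
Lemma subspace_matrix (R : realType) n (Z : set 'rV[R]_n) : Z 0 ->
  (forall x y, Z x -> Z y -> Z (x + y)) -> (forall a x, Z x -> Z (a *: x)) ->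
  exists V : 'M[R]_n, forall x, Z x <-> (x <= V)%MS.
Proof.
move=> Z0 ZD ZZ.
pose P r := `[< exists2 V : 'M[R]_n, (forall x : 'rV_n, (x <= V)%MS -> Z x) & \rank V = r >].
have exP : exists r, P r.
  exists 0%N; apply/asboolP; exists 0; last exact: mxrank0.
  by move=> x; rewrite submx0 => /eqP ->.
have ubP r : P r -> (r <= n)%N by move=> /asboolP [V _ <-]; exact: rank_leq_row.
case: (ex_maxnP exP ubP) => r /asboolP [V VZ rV] maxr.
exists V => x; split; last exact: VZ.
move=> Zx; apply: contrapT => /negP xV.
have : P (\rank (V + x)%MS).
  apply/asboolP; exists (V + x)%MS => // y /sub_addsmxP [[u a] /= ->].
  apply: ZD; first by apply: VZ; exact: submxMl.
  by rewrite [a]mx11_scalar mul_scalar_mx; exact: ZZ.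
move=> /maxr; rewrite -rV leqNgt => /negP; apply.
by apply: rank_ltmx; rewrite ltmxE addsmxSl /= addsmx_sub submx_refl.
Qed.

(** * The excess of the divergence over [Q]: its zero set and a lower bound transversal to it *)

Section ZeroSet.
Variables (R : realType) (n : nat) (f : 'rV[R]_n -> R) (G : 'rV[R]_n -> 'cV[R]_n).
Implicit Types (x y z v w : 'rV[R]_n) (A : 'M[R]_n).
Hypothesis contf : omega_continuous f.
Hypothesis trans : forall y, exists A b l, graph_sym f A b l /\ y *m A + b = 0.
Variables (A0 : 'M[R]_n) (l0 : R).
Hypothesis sym0 : graph_sym f A0 0 l0.
Hypothesis l01 : l0 < 1.
Variables (K C : R).
Hypothesis K0 : 0 < K.
Hypothesis symK : forall A b l, graph_sym f A b l -> forall x,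
  nsq (x *m A) <= K * l * nsq x /\ l * nsq x <= K * nsq (x *m A).
Variable Q : 'M[R]_n.
Hypothesis Qs : Q^T = Q.
Let u y x := divergence f G y x - qform Q x.
Hypothesis u_ge0 : forall y x, 0 <= u y x.
Hypothesis u_sym : forall y A b l, graph_sym f A b l ->
  forall x, u (y *m A + b) (x *m A) = l * u y x.
Hypothesis uC : forall y x, u y x <= C * nsq x.

(** The excess [u] is again a divergence: that of [U], with gradient [N]. *)
Let U x := f x - qform Q x.
Let N y := G y - 2 *: (Q *m y^T).

Lemma qformD_arg y x : qform Q (y + x) = qform Q y + 2 * lin (Q *m y^T) x + qform Q x.
Proof.
have add00 (X Y : 'M[R]_1) : (X + Y) 0 0 = X 0 0 + Y 0 0 by rewrite mxE.
rewrite /qform /lin linearD /= mulmxDr !mulmxDl !add00.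
have -> : (y *m Q *m x^T) 0 0 = (x *m Q *m y^T) 0 0.
  by rewrite -[y *m Q *m x^T]trmxK [LHS]mxE !trmx_mul trmxK Qs mulmxA.
by rewrite mulmxA; ring.
Qed.

Lemma excess_divergence y x : u y x = U (y + x) - U y - lin (N y) x.
Proof. by rewrite /u /U /N /divergence linBm linZm qformD_arg; ring. Qed.

Lemma excess_shift a b x : u b x = u a (b - a + x) - u a (b - a) - lin (N b - N a) x.
Proof.
rewrite !excess_divergence !linD linBm.
have -> : a + (b - a + x) = b + x by rewrite addrA (addrC a) subrK.
have -> : a + (b - a) = b by rewrite addrC subrK.
ring.
Qed.

Lemma excess_at0 y : u y 0 = 0.
Proof.
by rewrite excess_divergence addr0 subrr /lin mul0mx mxE subr0.
Qed.

(** Nonnegativity of [u] at the base point [y + m] says that [u y] has a supporting affine function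
    at [m]. *)
Lemma excess_convex y v w (t : R) : 0 <= t <= 1 ->
  u y ((1 - t) *: v + t *: w) <= (1 - t) * u y v + t * u y w.
Proof.
move=> /andP[t0 t1]; set m := _ + _.
have E z : u (y + m) (z - m) = u y z - u y m - lin (N (y + m) - N y) (z - m).
  rewrite (excess_shift y (y + m)); have -> : y + m - y = m by rewrite addrC addKr.
  by rewrite (addrC m) subrK.
have h1 := u_ge0 (y + m) (v - m); have h2 := u_ge0 (y + m) (w - m).
rewrite E in h1; rewrite E in h2.
have t1' : 0 <= 1 - t by rewrite subr_ge0.
have h3 := mulr_ge0 t1' h1; have h4 := mulr_ge0 t0 h2.
have e : (1 - t) * lin (N (y + m) - N y) (v - m) + t * lin (N (y + m) - N y) (w - m) = 0.
  have e0 : (1 - t) *: (v - m) + t *: (w - m) = 0.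
    by rewrite /m; apply/rowP => i; rewrite !mxE; ring.
  by rewrite -!linZ -linD e0 /lin mul0mx mxE.
move: h3 h4 e; move: (lin _ (v - m)) (lin _ (w - m)) (u y m) => a1 a2 a3 h3 h4 e.
lra.
Qed.

Lemma excess_continuous y : omega_continuous (u y).
Proof.
move=> w x wx; rewrite excess_divergence (_ : (fun k => _) = fun k => U (y + w k) - U y - lin (N y) (w k)); last first.
  by apply/funext => k; rewrite excess_divergence.
apply: cvgB; last exact: cvg_lin.
apply: cvgB; last exact: cvg_cstr.
have yw : (fun k => y + w k) @ omega --> y + x by apply: cvg_addm; [exact: cvg_cstm|exact: wx].
apply: cvgB; first exact: contf.
have H : (fun k => (y + w k) *m Q *m (y + w k)^T) @ omega --> (y + x) *m Q *m (y + x)^T.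
  apply: cvg_mulmx; last by apply: cvg_trmx; exact: yw.
  by apply: cvg_mulmx; [exact: yw|exact: cvg_cstm].
exact: (@cvg_coord R _ _ _ _ _ _ _ 0 0 H).
Qed.

Lemma l0_gt0 : 0 < l0. Proof. by have [] := sym0. Qed.

Lemma sym0_pow k : graph_sym f (A0 ^+ k) 0 (l0 ^+ k).
Proof.
elim: k => [|k IH].
  rewrite !expr0; split; [exact: unitmx1|exact: ltr01|].
  by exists 0, 0 => x; rewrite mulmx1 addr0 mulmx0 mxE mul1r !addr0.
have := graph_sym_comp IH sym0; rewrite mul0mx addr0 !exprSr; exact.
Qed.

Lemma sym_fix_u A l x : graph_sym f A 0 l -> u 0 (x *m A) = l * u 0 x.
Proof. by move=> sA; have := u_sym 0 sA x; rewrite mul0mx addr0. Qed.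

Lemma sym_fix_inv A l : graph_sym f A 0 l -> graph_sym f (invmx A) 0 l^-1.
Proof. by move=> /graph_sym_inv; rewrite oppr0 mul0mx. Qed.

Lemma zeros_shrink x (s : R) : u 0 x = 0 -> 0 <= s <= 1 -> u 0 (s *: x) = 0.
Proof.
move=> ux s01; apply/eqP; rewrite eq_le u_ge0 andbT.
have := @excess_convex 0 0 x s s01; rewrite scaler0 add0r excess_at0 ux !mulr0 addr0.
exact.
Qed.

(* Up to scaling, arbitrarily high powers of the contraction come back near
   the identity. *)
Lemma zeros_cone x (s : R) : u 0 x = 0 -> 0 <= s -> u 0 (s *: x) = 0.
Proof.
move=> ux s0.
have l00 := l0_gt0.
(* A symmetry of scale [l0] changes lengths by about the square root of [l0]. After this
   normalisation the powers and their inverses stay bounded, and their limits [L'] and [L] are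
   inverse to each other. *)
pose q := Num.sqrt l0.
have q0 : 0 < q by rewrite sqrtr_gt0.
have q2 k : (q ^+ k) ^+ 2 = l0 ^+ k by rewrite -exprM mulnC exprM sqr_sqrtr// ltW.
have q1 : q < 1 by rewrite -(sqrtr1 R) ltr_sqrt.
have qk0 k : 0 < q ^+ k by rewrite exprn_gt0.
pose M k := q ^+ k *: invmx (A0 ^+ k); pose M' k := (q ^+ k)^-1 *: A0 ^+ k.
have uA k : A0 ^+ k \in unitmx by have [] := sym0_pow k.
have bndmx (X : nat -> 'M[R]_n) (k0 : R) : 0 <= k0 -> (forall k (v : 'rV[R]_n), nsq (v *m X k) <= k0 * nsq v) ->
    exists L : 'M[R]_n, X @ omega --> L.
  move=> k00 HX; apply: (@mx_cvg_omega _ _ _ _ (Num.sqrt (k0 * n%:R) / 1)); apply: (@omega_ge _ 0) => k _.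
  apply: mx_norm_rows => // v v1; have h1 := HX k v; have h2 := mx_norm_nsq (v *m X k); have h3 := nsq_mx_norm v.
  have h4 : `|v| ^+ 2 <= 1 by rewrite expr_le1.
  rewrite -[leLHS]ger0_norm// -sqrtr_sqr ler_wsqrtr//.
  apply: le_trans h2 _; apply: le_trans h1 _; rewrite ler_wpM2l//; apply: le_trans h3 _.
  by rewrite -[leRHS]mulr1 ler_wpM2l.
have [L ML] : exists L : 'M[R]_n, M @ omega --> L.
  apply: (bndmx _ K (ltW K0)) => k v; rewrite -scalemxAr nsqZ q2.
  have [h _] := symK (sym_fix_inv (sym0_pow k)) v.
  have lk : 0 < l0 ^+ k by rewrite exprn_gt0.
  rewrite mulrC -ler_pdivlMr//; apply: le_trans h _.
  by rewrite le_eqVlt; apply/orP; left; apply/eqP; ring.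
have [L' ML'] : exists L : 'M[R]_n, M' @ omega --> L.
  apply: (bndmx _ K (ltW K0)) => k v; rewrite -scalemxAr nsqZ exprVn q2.
  have [h _] := symK (sym0_pow k) v.
  have lk : 0 < l0 ^+ k by rewrite exprn_gt0.
  rewrite ler_pdivrMl//; apply: le_trans h _.
  by rewrite le_eqVlt; apply/orP; left; apply/eqP; ring.
have LL' : L *m L' = 1%:M.
  apply: (@cvg_mx_unique _ _ _ (fun k => M k *m M' k)).
    by apply: cvg_mulmx; [exact: ML|exact: ML'].
  rewrite (_ : (fun k => _) = fun=> 1%:M); first exact: cvg_cstm.
  apply/funext => k; rewrite /M /M' -scalemxAl -scalemxAr scalerA mulfV ?gt_eqF//.
  by rewrite scale1r mulVmx.
(* For large [j] the point is a zero, namely a preimage of [x] under a power of [A0], times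
   [s q ^ (j - i)], which is then at most 1; so it is a zero by shrinking. The limit in [j] gives
   this claim, and the later limit in [i] recovers [s *: x]. *)
have step1 i : u 0 (s *: (x *m L *m M' i)) = 0.
  have cv : (fun j => s *: (x *m M j *m M' i)) @ omega --> s *: (x *m L *m M' i).
    apply: cvg_scalec; apply: cvg_mulmx; last exact: cvg_cstm.
    by apply: cvg_mulmx; [exact: cvg_cstm|exact: ML].
  apply: (cvg_real_unique (excess_continuous cv)).
  have qj0 : (fun j : nat => s * (q ^+ i)^-1 * q ^+ j) @ omega --> (0 : R).
    rewrite -(mulr0 (s * (q ^+ i)^-1)); apply: cvgM; first exact: cvg_cstr.
    by apply: cvg_omega; apply: cvg_expr; rewrite ger0_norm// ltW.
  have near1 : \forall j \near omega, u 0 (s *: (x *m M j *m M' i)) = 0.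
    have /cvgrPdist_le /(_ 1 ltr01) := qj0.
    have ij : \forall j \near omega, (i <= j)%N by exact: (@omega_ge _ i).
    apply: filterS2 ij => j ij; rewrite sub0r normrN ger0_norm; last first.
      by rewrite !mulr_ge0// ?invr_ge0 ltW.
    move=> sq1.
    have -> : s *: (x *m M j *m M' i) = (s * (q ^+ i)^-1 * q ^+ j) *: (x *m invmx (A0 ^+ (j - i))).
      have AE : A0 ^+ j = A0 ^+ i *m A0 ^+ (j - i).
        by rewrite -[RHS]/(_ * _) -exprD subnKC.
      have E : invmx (A0 ^+ j) *m A0 ^+ i = invmx (A0 ^+ (j - i)).
        apply: (can_inj (mulKmx (uA j))); rewrite mulmxA mulmxV// mul1mx {1}AE.
        by rewrite -mulmxA mulmxV// mulmx1.
      rewrite -mulmxA /M /M' -scalemxAl -[invmx _ *m _]scalemxAr E scalerA.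
      by rewrite -scalemxAr scalerA mulrA mulrAC.
    apply: zeros_shrink; last by rewrite sq1 !mulr_ge0 ?invr_ge0// ltW.
    by rewrite (sym_fix_u _ (sym_fix_inv (sym0_pow (j - i)))) ux mulr0.
  apply/cvgrPdist_le => eps eps0; apply: filterS near1 => j ->.
  by rewrite subrr normr0 ltW.
have cv : (fun i => s *: (x *m L *m M' i)) @ omega --> s *: x.
  have -> : s *: x = s *: (x *m L *m L') by rewrite -mulmxA LL' mulmx1.
  by apply: cvg_scalec; apply: cvg_mulmx; [exact: cvg_cstm|exact: ML'].
apply: (cvg_real_unique (excess_continuous cv)).
by rewrite (_ : (fun k => _) = fun=> 0); [exact: cvg_cstr|apply/funext].
Qed.

(** [u 0] is nonnegative around its zero [y] and [u y] is at most quadratic, so the difference of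
    the two gradients is a linear form with a quadratic bound and vanishes. *)
Lemma zeros_shift y v : u 0 y = 0 -> u y v = u 0 (y + v).
Proof.
move=> uy; have E w : u 0 (y + w) = u y w + lin (N y - N 0) w.
  by rewrite (excess_shift 0 y w) subr0 uy; ring.
suff N0 : N 0 - N y = 0.
  by rewrite E -opprB N0 oppr0 /lin mulmx0 mxE addr0.
apply: (@lin_small _ _ _ C 1) => // w _.
have := u_ge0 0 (y + w); rewrite E; have := uC y w; rewrite !linBm; lra.
Qed.

(** Seen from [y], the vector [- y] is a zero, as it leads back to the origin. A symmetry taking [y]
    to the origin shows that the zeros at [y] form a cone, so [- 2 y] is one too, and seen from the
    origin this is [- y]. *)
Lemma zeros_opp y : u 0 y = 0 -> u 0 (- y) = 0.
Proof.
move=> uy; have [A [b [l [sA yA]]]] := trans y; have [_ lp _] := sA.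
have E w : u 0 (w *m A) = l * u y w by have := u_sym y sA w; rewrite yA.
have h1 : u 0 (- y *m A) = 0 by rewrite E zeros_shift// subrr excess_at0 mulr0.
have := zeros_cone h1 (ler0n _ 2); rewrite scalemxAl E => /eqP.
rewrite mulf_eq0 gt_eqF//= zeros_shift// => /eqP <-; congr u.
by apply/rowP => i; rewrite !mxE; ring.
Qed.

Lemma zeros_scale0 x (s : R) : u 0 x = 0 -> u 0 (s *: x) = 0.
Proof.
move=> ux; have [s0|s0] := leP 0 s; first exact: zeros_cone.
rewrite -[s *: x]opprK -scaleNr; apply: zeros_opp; apply: zeros_cone => //.
by rewrite oppr_ge0 ltW.
Qed.

Lemma zeros_scale y x (s : R) : u y x = 0 -> u y (s *: x) = 0.
Proof.
move=> ux; have [A [b [l [sA yA]]]] := trans y; have [_ lp _] := sA.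
have E w : u 0 (w *m A) = l * u y w by have := u_sym y sA w; rewrite yA.
have h1 : u 0 (x *m A) = 0 by rewrite E ux mulr0.
have := zeros_scale0 s h1; rewrite scalemxAl E => /eqP.
by rewrite mulf_eq0 gt_eqF//= => /eqP.
Qed.

(** Write [x + z] as the combination of [x / (1 - t)] and the zero [z / t] with weights [1 - t] and
    [t], use convexity, and let [t] tend to zero. The choice [t = 1 / (k + 2)] keeps [1 - t]
    positive. *)
Lemma zeros_invariant_le y z x : u y z = 0 -> u y (x + z) <= u y x.
Proof.
move=> uz.
have tk k : 0 < 1 - k.+2%:R^-1 :> R by rewrite subr_gt0 invf_lt1// ltr1n.
have cv1 : (fun k => k.+2%:R^-1) @ omega --> (0 : R).
  apply/cvgrPdist_le => eps eps0; have /cvgrPdist_le /(_ _ eps0) := @invn_cvg0 R.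
  apply: filterS => k; rewrite !sub0r !normrN !ger0_norm ?invr_ge0//; apply: le_trans.
  by rewrite lef_pV2 ?posrE ?ltr0n// ler_nat.
have cv2 : (fun k => 1 - k.+2%:R^-1) @ omega --> (1 : R).
  have := @cvgB R R nat omega _ (fun=> 1 : R) (fun k : nat => k.+2%:R^-1 : R) 1 0
    (cvg_cst _) cv1.
  by rewrite subr0; exact.
have cv3 : (fun k => (1 - k.+2%:R^-1)^-1 *: x) @ omega --> x.
  rewrite -[X in _ --> X]scale1r -[X in X *: x]invr1.
  apply: cvg_scalem; last exact: cvg_cstm.
  by apply: cvgV => //; rewrite oner_neq0.
apply: (@omega_lim_le _ (fun=> u y (x + z)) (fun k => (1 - k.+2%:R^-1) * u y ((1 - k.+2%:R^-1)^-1 *: x))).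
- exact: cvg_cstr.
- rewrite -[u y x in X in _ --> X]mul1r; apply: cvgM; first exact: cv2.
  exact: excess_continuous.
move=> k; have k1 : 0 <= (k.+2%:R^-1 : R) <= 1 by rewrite invr_ge0 ler0n invf_le1// ler1n.
have := excess_convex y ((1 - k.+2%:R^-1)^-1 *: x) (k.+2%:R *: z) k1.
rewrite (zeros_scale _ uz) mulr0 addr0 !scalerA mulfV ?gt_eqF// mulVf// !scale1r.
exact.
Qed.

Lemma zeros_invariant y z x : u y z = 0 -> u y (x + z) = u y x.
Proof.
move=> uz; apply/eqP; rewrite eq_le zeros_invariant_le//=.
have uz' : u y (- z) = 0 by rewrite -scaleN1r zeros_scale.
by have := zeros_invariant_le (x + z) uz'; rewrite addrK.
Qed.

(** Along the line of [z] the excess at [b] is linear, and it is nonnegative at both [z] and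
    [- z]. *)
Lemma zeros_base a b z : u a z = 0 -> u b z = 0.
Proof.
move=> uz; have E (s : R) : u b (s *: z) = - (s * lin (N b - N a) z).
  by rewrite (excess_shift a) zeros_invariant ?zeros_scale// linZ; ring.
have h1 := u_ge0 b (1 *: z); have h2 := u_ge0 b ((-1) *: z).
have := E 1; rewrite !E in h1 h2; rewrite scale1r mul1r => ->; lra.
Qed.

Lemma zeros_sym A b l z : graph_sym f A b l -> u 0 z = 0 -> u 0 (z *m A) = 0.
Proof.
move=> sA uz; apply: (@zeros_base b).
by have := u_sym 0 sA z; rewrite mul0mx add0r uz mulr0.
Qed.

Lemma zeros_matrix : exists B : 'M[R]_n, forall x, u 0 x = 0 <-> x *m B = 0.
Proof.
have [V HV] : exists V : 'M[R]_n, forall x, u 0 x = 0 <-> (x <= V)%MS.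
  apply: (@subspace_matrix _ _ [set x | u 0 x = 0]) => /=.
  - exact: excess_at0.
  - by move=> x y ux uy; rewrite zeros_invariant.
  - by move=> a x ux; exact: zeros_scale.
exists (cokermx V) => x; rewrite HV submxE.
by split=> [/eqP|->].
Qed.

Section LowerBound.
Variable B : 'M[R]_n.
Hypothesis HB : forall x, u 0 x = 0 <-> x *m B = 0.
Let P := pinvmx B.

Lemma coker_projK x : x *m B *m P *m B = x *m B.
Proof. by rewrite mulmxKpV// submxMl. Qed.

Lemma excess_proj y x : u y (x *m B *m P) = u y x.
Proof.
have h : u 0 (x *m B *m P - x) = 0 by apply/HB; rewrite mulmxBl coker_projK subrr.
by have := @zeros_invariant y (x *m B *m P - x) x (zeros_base y h); rewrite addrC subrK.
Qed.

(** Symmetries preserve the zero set, which is the kernel of [B], and so act on the quotient. There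
    the bounds follow from those for the representative [x *m B *m P], whose norm is controlled by
    [x *m B]. *)
Lemma sym_bounds_coker : exists2 k : R, 0 < k & forall A b l, graph_sym f A b l ->
  forall x, nsq (x *m A *m B) <= k * l * nsq (x *m B) /\ l * nsq (x *m B) <= k * nsq (x *m A *m B).
Proof.
have [k1 k10 H1] := nsq_mul B; have [k2 k20 H2] := nsq_mul P.
have half A b l : graph_sym f A b l -> forall x, nsq (x *m A *m B) <= k1 * (K * k2) * l * nsq (x *m B).
  move=> sA x; have [_ lp _] := sA.
  have h : u 0 (x *m B *m P - x) = 0 by apply/HB; rewrite mulmxBl coker_projK subrr.
  have /HB := zeros_sym sA h; rewrite !mulmxBl => /eqP; rewrite subr_eq0 => /eqP <-.
  apply: le_trans (H1 _) _; rewrite -!mulrA ler_pM2l//.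
  have [h3 _] := symK sA (x *m B *m P); apply: le_trans h3 _.
  have -> : K * (k2 * (l * nsq (x *m B))) = K * l * (k2 * nsq (x *m B)) by ring.
  by rewrite ler_pM2l ?mulr_gt0.
exists (k1 * (K * k2)); first by rewrite !mulr_gt0.
move=> A b l sA x; split; first exact: half sA x.
have [uA lp _] := sA.
have := half _ _ _ (graph_sym_inv sA) (x *m A); rewrite mulmxK// => h.
rewrite -ler_pdivlMl//; apply: le_trans h _.
by rewrite le_eqVlt; apply/orP; left; apply/eqP; ring.
Qed.

(** Compactness modulo the zero set: only [x *m B] is bounded, so [x] is replaced by the
    representative [x *m B *m P], which has the same excess. *)
Lemma excess_annulus (T : R) : exists2 eps : R, 0 < eps & forall x,
  1 <= nsq (x *m B) <= T -> eps <= u 0 x.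
Proof.
apply: contrapT => H.
have /choice [w Hw] : forall k : nat, exists x, 1 <= nsq (x *m B) <= T /\ u 0 x <= k.+1%:R^-1.
  move=> k; apply: contrapT => Hk; apply: H; exists k.+1%:R^-1; first by rewrite invr_gt0.
  by move=> x xT; rewrite leNgt; apply/negP => /ltW lt; apply: Hk; exists x.
have [l wl] : exists l : 'rV[R]_n, (fun k => w k *m B) @ omega --> l.
  apply: (@mx_cvg_omega _ _ _ _ (T + 1)); apply: (@omega_ge _ 0) => k _.
  have [/andP[_ wT] _] := Hw k; have := mx_norm_nsq (w k *m B); set a := `|_| => h.
  have a0 : 0 <= a by exact: normr_ge0.
  by have := sqr_ge0 (a - 1); rewrite sqrrB1 mulr2n; lra.
have l1 : 1 <= nsq l.
  apply: (omega_lim_le (@cvg_cstr _ _ omega _ 1) (cvg_nsq wl)) => k.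
  by have [/andP[]] := Hw k.
have lPc : (fun k => w k *m B *m P) @ omega --> l *m P.
  by apply: cvg_mulmx; [exact: wl|exact: cvg_cstm].
have u_le0 : u 0 (l *m P) <= 0.
  apply: (omega_lim_le (excess_continuous lPc) (@invn_cvg0 R)) => k.
  by rewrite excess_proj; have [] := Hw k.
have /HB lPB : u 0 (l *m P) = 0 by apply/eqP; rewrite eq_le u_le0 u_ge0.
have lE : l = l *m P *m B.
  apply: (cvg_mx_unique wl).
  rewrite (_ : (fun k => _) = fun k => w k *m B *m P *m B); last first.
    by apply/funext => k; rewrite coker_projK.
  by apply: cvg_mulmx; [exact: lPc|exact: cvg_cstm].
by move: l1; rewrite lE lPB nsq0 ler10.
Qed.

Lemma excess_lower : exists2 eps : R, 0 < eps & forall y x, eps * nsq (x *m B) <= u y x.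
Proof.
have [k k0 Hk] := sym_bounds_coker; have l00 := l0_gt0.
(* One application of [A0] divides [nsq (x *m B)] by at most [k / l0]. Once an inverse power has
   brought it to at least 1, the iterate just before the first one below 1 therefore lies in
   [[1, T]]. *)
pose T := k / l0.
have [e1 e10 He1] := excess_annulus T.
have norm x : x *m B != 0 -> exists A l, graph_sym f A 0 l /\ 1 <= nsq (x *m A *m B) <= T.
  move=> xB; have xB0 := nsq_gt0 xB.
  have pw0 : (fun j : nat => l0 ^+ j) @ omega --> (0 : R).
    by apply: cvg_omega; apply: cvg_expr; rewrite ger0_norm// ltW.
  have [j Hj] : exists j, 1 <= nsq (x *m invmx (A0 ^+ j) *m B).
    have kx : 0 < nsq (x *m B) / k by rewrite divr_gt0.
    have /cvgrPdist_le /(_ _ kx) /omega_ex [j] := pw0.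
    rewrite sub0r normrN ger0_norm ?exprn_ge0 ?(ltW l00)// => Hj; exists j.
    have lj : 0 < l0 ^+ j by rewrite exprn_gt0.
    have [_ h] := Hk _ _ _ (sym_fix_inv (sym0_pow j)) x.
    rewrite -(ler_pM2l k0) mulr1; apply: le_trans h.
    rewrite ler_pdivlMl// mulrC -ler_pdivlMl//; move: Hj.
    by rewrite ler_pdivlMr// ler_pdivlMl// mulrC.
  set x' := x *m invmx (A0 ^+ j) in Hj.
  have exi : exists i, nsq (x' *m A0 ^+ i *m B) < 1.
    have kx : 0 < (k * nsq (x' *m B) + 1)^-1 / 2.
      by rewrite divr_gt0// invr_gt0 ltr_wpDl// mulr_ge0 ?nsq_ge0// ltW.
    have /cvgrPdist_le /(_ _ kx) /omega_ex [i] := pw0.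
    rewrite sub0r normrN ger0_norm ?exprn_ge0 ?(ltW l00)// => Hi; exists i.
    have [h _] := Hk _ _ _ (sym0_pow i) x'.
    apply: le_lt_trans h _.
    have p1 : 0 < k * nsq (x' *m B) + 1 by rewrite ltr_wpDl// mulr_ge0 ?nsq_ge0// ltW.
    have p2 : 0 <= k * nsq (x' *m B) by rewrite mulr_ge0 ?nsq_ge0// ltW.
    have h1 := ler_wpM2l p2 Hi.
    have h2 : k * nsq (x' *m B) * ((k * nsq (x' *m B) + 1)^-1 / 2) < 1.
      rewrite mulrA ltr_pdivrMr// mul1r.
      apply: (@le_lt_trans _ _ 1); last by rewrite ltr1n.
      by rewrite ler_pdivrMr// mul1r lerDl.
    by apply: le_lt_trans h2; apply: le_trans h1; rewrite mulrAC.
  case: (ex_minnP exi) => -[|i] Hi mini.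
    by move: Hi; rewrite expr0 mulmx1 ltNge Hj.
  exists (invmx (A0 ^+ j) *m A0 ^+ i), ((l0 ^+ j)^-1 * l0 ^+ i); split.
    by have := graph_sym_comp (sym_fix_inv (sym0_pow j)) (sym0_pow i); rewrite mul0mx addr0.
  rewrite mulmxA -/x'; apply/andP; split.
    by rewrite leNgt; apply/negP => /mini; rewrite ltnn.
  have [_ h] := Hk _ _ _ sym0 (x' *m A0 ^+ i).
  rewrite /T ler_pdivlMr// mulrC; apply: le_trans h _.
  rewrite -[leRHS]mulr1 ler_pM2l// ltW//.
  by move: Hi; rewrite exprSr -[_ * A0]/(_ *m A0) mulmxA.
have low0 x : e1 / (k * T) * nsq (x *m B) <= u 0 x.
  have [xB|xB] := eqVneq (x *m B) 0; first by rewrite xB nsq0 mulr0 u_ge0.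
  have [A [l [sA /andP[h1 h2]]]] := norm x xB; have [_ lp _] := sA.
  have T0 : 0 < T by rewrite divr_gt0.
  have h3 : e1 <= u 0 (x *m A) by apply: He1; rewrite h1.
  rewrite (sym_fix_u _ sA) in h3.
  have [_ h4] := Hk _ _ _ sA x.
  have h5 : l * nsq (x *m B) <= k * T by apply: le_trans h4 _; rewrite ler_pM2l.
  rewrite -(ler_pM2l lp); apply: le_trans h3.
  have kT : 0 < k * T by rewrite mulr_gt0.
  rewrite mulrCA -mulrA -[leRHS]mulr1 ler_pM2l// ler_pdivrMl// mulr1.
  by [].
have T0 : 0 < T by rewrite divr_gt0.
exists (e1 / (k * T) / k); first by rewrite !divr_gt0// mulr_gt0.
move=> y x; have [A [b [l [sA yA]]]] := trans y; have [_ lp _] := sA.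
have := u_sym y sA x; rewrite yA => E.
have h1 := low0 (x *m A); rewrite E in h1.
have [_ h2] := Hk _ _ _ sA x.
rewrite -(ler_pM2l lp); apply: le_trans h1.
have ekT : 0 < e1 / (k * T) by rewrite divr_gt0// mulr_gt0.
by rewrite mulrCA -[e1 / _ / k * _]mulrA ler_pM2l// ler_pdivrMl.
Qed.

End LowerBound.
End ZeroSet.

(** * Reduction to the paraboloid *)

(** Induction on the size: [D'] is the Schur complement, left after completing the square in the
    first coordinate. *)
Lemma cholesky (R : realType) n (Q : 'M[R]_n) : Q^T = Q ->
  (forall x, x != 0 -> 0 < qform Q x) -> exists2 S : 'M[R]_n, S \in unitmx & Q = S *m S^T.
Proof.
elim: n Q => [|n IH] Q Qs Qpos.
  by exists 1%:M; [exact: unitmx1|apply/matrixP => -[]].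
pose M : 'M[R]_(1 + n) := Q.
have Ms : M^T = M := Qs.
have Mpos (x : 'rV[R]_(1 + n)) : x != 0 -> 0 < qform M x := Qpos x.
suff [S uS MS] : exists2 S : 'M[R]_(1 + n), S \in unitmx & M = S *m S^T by exists S.
clearbody M; clear Q Qs Qpos.
pose a := ulsubmx M 0 0; pose b := ursubmx M; pose D := drsubmx M.
have aE : ulsubmx M = a%:M by exact: mx11_scalar.
have bE : dlsubmx M = b^T by rewrite /b -{1}Ms trmx_ursub.
have Ds : D^T = D by rewrite /D -{2}Ms trmx_drsub.
have ME : M = block_mx a%:M b b^T D by rewrite -{1}[M]submxK aE bE.
have qM (t : R) (y : 'rV[R]_n) : qform M (row_mx t%:M y) =
    a * t ^+ 2 + 2 * t * (y *m b^T) 0 0 + qform D y.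
  have add00 (X Y : 'M[R]_1) : (X + Y) 0 0 = X 0 0 + Y 0 0 by rewrite mxE.
  rewrite /qform ME mul_row_block tr_row_mx mul_row_col !mulmxDl !add00 tr_scalar_mx.
  have e1 : (t%:M *m a%:M *m t%:M : 'M[R]_1) 0 0 = a * t ^+ 2.
    by rewrite -!scalar_mxM mxE eqxx mulr1n; ring.
  have e2 : (y *m b^T *m t%:M) 0 0 = t * (y *m b^T) 0 0 by rewrite mul_mx_scalar mxE.
  have e3 : (t%:M *m b *m y^T) 0 0 = t * (y *m b^T) 0 0.
    have <- : (b *m y^T)^T = y *m b^T by rewrite trmx_mul trmxK.
    by rewrite mul_scalar_mx -scalemxAl [LHS]mxE; congr (_ * _); rewrite [RHS]mxE.
  by rewrite e1 e2 e3; ring.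
have a0 : 0 < a.
  have := Mpos (row_mx 1%:M 0); rewrite qM mul0mx /qform !mul0mx !mxE.
  rewrite expr1n mulr1 mulr0 !addr0; apply; apply/negP => /eqP.
  rewrite -[0 in RHS]row_mx0 => /eq_row_mx [/matrixP /(_ 0 0)]; rewrite !mxE eqxx => /eqP.
  by rewrite oner_eq0.
pose D' := D - a^-1 *: (b^T *m b).
have qD' (y : 'rV[R]_n) : qform D' y = qform D y - a^-1 * (y *m b^T) 0 0 ^+ 2.
  rewrite /D' qformB qformZ; congr (_ - _ * _).
  rewrite -{2}[b]trmxK qform_sqr /nsq /dot [y *m b^T]mx11_scalar tr_scalar_mx.
  by rewrite mul_scalar_mx !mxE eqxx mulr1n expr2.
have [S' uS' D'E] : exists2 S : 'M[R]_n, S \in unitmx & D' = S *m S^T.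
  apply: IH.
    by rewrite /D' linearB linearZ /= trmx_mul trmxK Ds.
  (* The first coordinate that minimises the form for given [y]; the minimum is the value of [D'] at
     [y]. *)
  move=> y y0; have := Mpos (row_mx (- (a^-1 * (y *m b^T) 0 0))%:M y).
  rewrite qM qD'; set s := (_ 0 0).
  have -> : a * (- (a^-1 * s)) ^+ 2 + 2 * - (a^-1 * s) * s + qform D y =
     qform D y - a^-1 * s ^+ 2 by field; rewrite gt_eqF.
  apply; apply: contra y0 => /eqP; rewrite -[0 in RHS]row_mx0 => /eq_row_mx [_ ->].
  by [].
pose q := Num.sqrt a; have q0 : 0 < q by rewrite sqrtr_gt0.
have q2 : q * q = a by rewrite -expr2 sqr_sqrtr// ltW.
exists (block_mx q%:M 0 (q^-1 *: b^T) S').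
  rewrite unitmxE det_lblock unitrM det_scalar1 unitfE gt_eqF//=.
rewrite tr_block_mx mulmx_block ME tr_scalar_mx trmx0 !mulmx0 !mul0mx !addr0.
rewrite -scalar_mxM q2 linearZ /= trmxK mul_scalar_mx scalerA mulfV ?gt_eqF// scale1r.
rewrite mul_mx_scalar scalerA mulfV ?gt_eqF// scale1r.
rewrite -D'E -scalemxAl -scalemxAr scalerA -invfM q2 /D' addrC subrK //.
Qed.

Lemma graph_function_quadratic (R : realType) n (f : 'rV[R]_n -> R) :
  strictly_convex_fun f -> omega_continuous f ->
  (forall y, exists A b l, graph_sym f A b l /\ y *m A + b = 0) ->
  (exists A l, [/\ graph_sym f A 0 l, l < 1 &
      forall x : 'rV[R]_n, (fun k => x *m A ^+ k) @ omega --> (0 : 'rV[R]_n)]) ->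
  exists Q m c, [/\ Q^T = Q, forall x, x != 0 -> 0 < qform Q x &
    forall x, f x = qform Q x + lin m x + c].
Proof.
move=> scf contf trans [A0 [l0 [sym0 l01 A0cvg]]].
have [G [D_ge0 D_sym D_upper D_lower]] := gradient_form scf contf trans.
set D := divergence f G in D_ge0 D_sym D_upper D_lower.
have [c [C [c0 C0 Dbnd]]] := D_bounds D_sym D_upper D_lower trans sym0 A0cvg.
have [K K0 symK] := sym_bounds D_sym D_upper D_lower sym0 A0cvg.
pose Gam A l := exists b, graph_sym f A b l.
pose QQ := [set Q : 'M[R]_n | Q^T = Q /\ forall y x, qform Q x <= D y x].
have qform0 x : qform (0 : 'M[R]_n) x = 0 by rewrite /qform mulmx0 mul0mx mxE.
have [Q [Qs QD] [Qinv Qmax]] : exists2 Q, QQ Q &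
    (forall A l, Gam A l -> form_act A l Q = Q) /\
    forall p (B : 'M[R]_(n, p)) (eps : R), 0 < eps -> QQ (Q + eps *: (B *m B^T)) -> B = 0.
  apply: (@invariant_form _ _ Gam _ _ _ _ K K0 _ QQ C).
  - by move=> A l [b []].
  - exists 0; split; [exact: unitmx1|exact: ltr01|].
    by exists 0, 0 => x; rewrite mulmx1 addr0 mulmx0 mxE mul1r !addr0.
  - move=> A l A' l' [b sA] [b' sA']; exists (b *m A' + b').
    exact: graph_sym_comp sA sA'.
  - by move=> A l [b sA]; exists (- b *m invmx A); exact: graph_sym_inv sA.
  - by move=> A l [b sA] x; have [] := symK _ _ _ sA x.
  - by split; [rewrite trmx0|move=> y x; rewrite qform0 D_ge0].
  - move=> Q Q' t [Qs QD] [Q's Q'D] /andP[t0 t1]; split.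
      by rewrite linearD !linearZ /= Qs Q's.
    move=> y x; rewrite qformD !qformZ.
    have t1' : 0 <= 1 - t by rewrite subr_ge0.
    have := ler_wpM2l t1' (QD y x); have := ler_wpM2l t0 (Q'D y x); lra.
  - move=> u Q uQ uQQ; split.
      apply: (@cvg_mx_unique _ _ _ (fun k => (u k)^T)); first by apply: cvg_trmx; exact: uQ.
      by rewrite (_ : (fun k => _) = u)//; apply/funext => k; have [] := uQQ k.
    move=> y x; apply: (@omega_lim_le _ (fun k => qform (u k) x) (fun=> D y x)).
    + have H : (fun k => x *m u k *m x^T) @ omega --> x *m Q *m x^T.
        apply: cvg_mulmx; last exact: cvg_cstm.
        by apply: cvg_mulmx; [exact: cvg_cstm|exact: uQ].
      exact: (@cvg_coord R _ _ _ _ _ _ _ 0 0 H).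
    + exact: cvg_cstr.
    + by move=> k; have [_] := uQQ k; exact.
  - move=> A l Q [b sA] [Qs QD]; have [_ lp _] := sA; split.
      by rewrite /form_act linearZ /= !trmx_mul trmxK Qs mulmxA.
    move=> y x; rewrite qform_act ler_pdivrMl//.
    by have := D_sym y _ _ _ sA x => <-; exact: QD.
  - by move=> Q [_ QD] x; apply: le_trans (QD 0 x) _; have /andP[] := Dbnd 0 x.
have Qsym A b l x : graph_sym f A b l -> qform Q (x *m A) = l * qform Q x.
  move=> sA; have [_ lp _] := sA.
  have := Qinv A l (ex_intro _ b sA) => {2}<-; rewrite qform_act mulVKf ?gt_eqF//.
have u_ge0 y x : 0 <= divergence f G y x - qform Q x by rewrite subr_ge0 QD.
have u_sym y A b l : graph_sym f A b l -> forall x,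
    divergence f G (y *m A + b) (x *m A) - qform Q (x *m A) =
    l * (divergence f G y x - qform Q x).
  move=> sA x; rewrite (Qsym _ _ _ _ sA) mulrBr; congr (_ - _).
  exact: (D_sym y _ _ _ sA x).
(* At this stage [Q] may take negative values, so a lower bound for it is extracted from
   [nsq (x *m Q + x) >= 0]. *)
have [C2 uC] : exists C2, forall y x, divergence f G y x - qform Q x <= C2 * nsq x.
  have [k k0 Hk] := nsq_mul Q.
  exists (C + (1 + k)) => y x; have /andP[_ h1] := Dbnd y x.
  have h2 : - qform Q x <= (1 + k) * nsq x.
    have := nsq_ge0 (x *m Q + x); rewrite nsqD => h3.
    have h4 : dot (x *m Q) x = qform Q x by [].
    have h5 := Hk x; have h6 := nsq_ge0 (x *m Q); have h7 := nsq_ge0 x.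
    have h8 : 0 <= k * nsq x by rewrite mulr_ge0// ltW.
    rewrite h4 in h3; rewrite mulrDl mul1r; lra.
  rewrite mulrDl; rewrite -/D in h1 *; lra.
have [B HB] := zeros_matrix contf trans sym0 l01 K0 symK Qs u_ge0 u_sym uC.
have [eps eps0 Heps] := excess_lower contf trans sym0 l01 K0 symK Qs u_ge0 u_sym uC HB.
have B0 : B = 0.
  apply: (Qmax _ _ eps eps0); split.
    by rewrite linearD linearZ /= trmx_mul trmxK Qs.
  by move=> y x; rewrite qformD qformZ qform_sqr; have := Heps y x; rewrite -/D; lra.
have DQ x : D 0 x = qform Q x.
  have /HB : x *m B = 0 by rewrite B0 mulmx0.
  by move=> /eqP; rewrite subr_eq0 => /eqP.
exists Q, (G 0), (f 0); split => //.
  move=> x x0; rewrite -DQ; have /andP[h _] := Dbnd 0 x; apply: lt_le_trans h.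
  by rewrite mulr_gt0// nsq_gt0.
by move=> x; rewrite -DQ /D /divergence add0r; ring.
Qed.

Lemma subgroup_orbit (R : realType) n (Om : set 'rV[R]_n) : quasi_homogeneous Om ->
  exists K : set 'rV[R]_n, [/\ compact K, K `<=` Om &
    forall x, Om x -> exists y A b, [/\ K y, aut Om A b & x = y *m A + b]].
Proof.
move=> [K [G [cK KOm [GA _ _ _] GK]]]; exists K; split => // x Omx.
have : [set g x | g in G & x in K] x by rewrite GK.
move=> [g Gg [y Ky gy]]; have [[A [b [uA gE]]] gOm] := GA _ Gg.
exists y, A, b; split => //; last by rewrite -gy gE.
split=> // z; split=> [Omz|].
  by rewrite -gOm; exists z => //; rewrite gE.
rewrite -{1}gOm => -[z' Omz']; rewrite gE /affine_map => /addIr /(can_inj (mulmxK uA)) <-.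
exact: Omz'.
Qed.

(** The empty set and the whole space have empty boundary and satisfy the other hypotheses, but are
    not paraboloids; [Omega !=set0] and [Omega <> setT] exclude these two. *)
Theorem theorem5p9 (R : realType) (n : nat) (Omega : set 'rV[R]_n.+1) :
  affine_domain Omega ->
  Omega !=set0 ->
  Omega <> setT ->
  strictly_convex Omega ->
  quasi_homogeneous Omega ->
  exists (A : 'M[R]_n.+1) (b : 'rV[R]_n.+1),
    A \in unitmx /\ affine_map A b @` Omega = paraboloid R n.
Proof.
move=> [oOm _] Om0 OmT scOm /subgroup_orbit [K [cK KOm qhK]].
have [p [e [E [tau [P [f [[eT eP ET EP TP] fP [scf contf] trans ctr]]]]]]] :=
  graph_form oOm scOm Om0 OmT cK KOm qhK.
have [Q [m [c [Qs Qpos fE]]]] := graph_function_quadratic scf contf trans ctr.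
have [S uS QE] := cholesky Qs Qpos.
(* The new coordinates of [w] are [w *m P *m S], in which [Q] is a sum of squares, and last the
   height [w *m tau] less the linear part of [f]. *)
pose A : 'M[R]_n.+1 := \matrix_(i, j)
  if unlift ord_max j is Some k then (P *m S) i k else (tau - P *m m) i 0.
have Aw (w : 'rV[R]_n.+1) k : (w *m A) 0 (widen_ord (leqnSn n) k) = (w *m P *m S) 0 k.
  have -> : widen_ord (leqnSn n) k = lift ord_max k.
    by apply: val_inj; rewrite /= /bump leqNgt ltn_ord.
  rewrite -mulmxA mxE [RHS]mxE; apply: eq_bigr => i _.
  by rewrite [in LHS]mxE liftK.
have Am (w : 'rV[R]_n.+1) : (w *m A) 0 ord_max = (w *m tau) 0 0 - lin m (w *m P).
  have -> : (w *m A) 0 ord_max = (w *m (tau - P *m m)) 0 0.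
    rewrite mxE [RHS]mxE; apply: eq_bigr => i _; congr (_ * _).
    by rewrite [in LHS]mxE unlift_none.
  by rewrite mulmxBr mulmxA [LHS]mxE; congr (_ + _); rewrite [LHS]mxE.
have decomp (w : 'rV[R]_n.+1) : w = (w *m P) *m E + (w *m tau) 0 0 *: e.
  rewrite -{1}[w]mulmx1 -TP mulmxDr addrC !mulmxA; congr (_ + _).
  by rewrite {1}[w *m tau]mx11_scalar mul_scalar_mx.
have uA : A \in unitmx.
  rewrite -row_free_unit; apply/inj_row_free => w wA.
  have wP : w *m P = 0.
    apply: (can_inj (mulmxK uS)); rewrite mul0mx; apply/rowP => k.
    by rewrite -Aw wA !mxE.
  have := Am w; rewrite wA wP /lin mul0mx !mxE subr0 => wt.
  rewrite [w]decomp wP mul0mx add0r [X in X *: _](_ : _ = 0) ?scale0r//.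
  by rewrite [LHS]mxE -wt.
(* Moves [p] to the origin and subtracts the constant term of [f] from the height. *)
pose b := - (p *m A) - c *: delta_mx 0 ord_max.
exists A, b; split => //.
have image (z : 'rV[R]_n.+1) : Omega z <-> paraboloid R n (z *m A + b).
  pose w := z - p.
  have -> : z *m A + b = w *m A - c *: delta_mx 0 ord_max by rewrite /b addrA -mulmxBl.
  have zE : z = p + w *m P *m E + (w *m tau) 0 0 *: e.
    by rewrite -addrA -decomp /w addrC subrK.
  rewrite {1}zE fP fE /paraboloid /=.
  have -> : \sum_(i < n) (w *m A - c *: delta_mx 0 ord_max) ord0 (widen_ord (leqnSn n) i) ^+ 2
      = qform Q (w *m P).
    rewrite QE qform_sqr nsqE; apply: eq_bigr => i _; rewrite -Aw [in LHS]mxE.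
    rewrite [X in _ + X]mxE [X in - X]mxE [delta_mx _ _ _ _]mxE eqxx /=.
    have /negbTE -> : widen_ord (leqnSn n) i != ord_max.
      by rewrite -val_eqE /= neq_ltn ltn_ord.
    by rewrite mulr0 subr0.
  have -> : (w *m A - c *: delta_mx 0 ord_max) ord0 ord_max =
      (w *m tau) 0 0 - lin m (w *m P) - c.
    rewrite [LHS]mxE [X in _ + X]mxE [X in - X]mxE [delta_mx _ _ _ _]mxE !eqxx /= mulr1.
    by rewrite -Am.
  by split; lra.
apply/seteqP; split=> [_ [z Omz <-]|y py]; first exact/image.
exists ((y - b) *m invmx A); last by rewrite /affine_map mulmxKV// subrK.
by apply/image; rewrite mulmxKV// subrK.
Qed.
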